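(* Let $V=V^0\oplus V^1$ be a vertex operator superalgebra (SVOA) and let $A_t(V)=V/O_t(V)$ be its $\mathbb{Z}_2$-twisted Zhu algebra with product $*_t$. Then: (1) The quotient space $(A_t(V),*_t)$ is a $\mathbb{Z}_2$-graded associative algebra with unit element $\mathbf{1}+O_t(V)$. (2) Let $M=\bigoplus_{n\in\mathbb{N}}M(n)$ be a $\mathbb{Z}_2$-twisted $V$-module. Then the top level $M(0)$ of $M$ is an $A_t(V)$-module under the action $a+O_t(V)\mapsto o(a)=a_{\mathrm{wt}(a)-1}$ for homogeneous $a\in V$. (3) Let $(W,\pi)$ be an irreducible $A_t(V)$-module. Then there exists an irreducible $\mathbb{Z}_2$-twisted $V$-module $M=\bigoplus_{n\in\mathbb{N}}M(n)$ such that the top level $M(0)$ of $M$ is isomorphic to $W$ as an $A_t(V)$-module.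
   Context: Conventions. $\mathbb{N}=\{0,1,2,\dots\}$; the base field is $\mathbb{C}$. An SVOA $(V,Y,\mathbf{1},\omega)$ has a $\mathbb{Z}_2$-grading $V=V^0\oplus V^1$ with $V^0=\bigoplus_{n\in\mathbb{Z}}V^0_n$, $V^1=\bigoplus_{n\in\mathbb{Z}}V^1_{n+1/2}$, where $V^i_s=\{v\in V^i: L_0v=sv\}$; every $L_0$-weight space is finite dimensional. For $L_0$-homogeneous $a\in V_s$ put $\mathrm{wt}(a)=s$. For $\mathbb{Z}_2$-homogeneous $a,b$: $q(a)=i$ if $a\in V^i$; $p(a,b)=1$ if $a,b\in V^1$ and $p(a,b)=0$ otherwise. $\mathrm{Res}_z$ is the coefficient of $z^{-1}$, $\delta(z)=\sum_{n\in\mathbb{Z}}z^n$, and binomials are expanded in nonnegative powers of the second variable; $(1+z)^s$ is expanded in nonnegative powers of $z$. $\mathbb{Z}_2$-twisted Zhu algebra. For $L_0$-homogeneous $a\in V$ and $b\in V$ set $$a*_tb:=\mathrm{Res}_z\,Y(a,z)\frac{(1+z)^{\mathrm{wt}(a)}}{z}b,\qquad a\circ_tb:=\mathrm{Res}_z\,Y(a,z)\frac{(1+z)^{\mathrm{wt}(a)}}{z^2}b,$$ extended bilinearly to $V\otimes V$. $O_t(V)\subset V$ is the linear span of all $a\circ_tb$, and $A_t(V)=V/O_t(V)$. The $\mathbb{Z}_2$-grading on $A_t(V)$ is the one induced from $V=V^0\oplus V^1$. $\mathbb{Z}_2$-twisted modules. A $\mathbb{Z}_2$-twisted $V$-module is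 a pair $(M,Y_M)$ consisting of an $\mathbb{N}$-graded vector space $M=\bigoplus_{n\in\mathbb{N}}M(n)$ and a linear map $Y_M(\cdot,z):V\to\mathrm{End}(M)[[z^{1/2},z^{-1/2}]]$ such that: (i) for $a\in V^i$, $Y_M(a,z)=\sum_{n\in\frac{i}{2}+\mathbb{Z}}a_nz^{-n-1}$; (ii) for $a\in V$, $v\in M$, $a_nv=0$ for $n\in\frac12\mathbb{Z}$ sufficiently large; (iii) $Y_M(\mathbf{1},z)=\mathrm{id}_M$; (iv) $a_nM(s)\subset M(s+\mathrm{wt}(a)-n-1)$; (v) for all $\mathbb{Z}_2$-homogeneous $a,b\in V$, $$z_0^{-1}\delta\Big(\frac{z_1-z_2}{z_0}\Big)Y_M(a,z_1)Y_M(b,z_2)-(-1)^{p(a,b)}z_0^{-1}\delta\Big(\frac{-z_2+z_1}{z_0}\Big)Y_M(b,z_2)Y_M(a,z_1)=z_2^{-1}\delta\Big(\frac{z_1-z_0}{z_2}\Big)\Big(\frac{z_1-z_0}{z_2}\Big)^{-q(a)/2}Y_M(Y(a,z_0)b,z_2).$$ *)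

(* Defs.v *)
From HB Require Import structures.
From mathcomp Require Import all_boot all_order all_algebra.
From mathcomp Require Import generic_quotient ring_quotient.
From mathcomp Require Import boolp classical_sets functions cardinality fsbigop.
From mathcomp Require Import reals.
From mathcomp Require Import complex.

Set Implicit Arguments.
Unset Strict Implicit.
Unset Printing Implicit Defensive.

Import Order.TTheory GRing.Theory Num.Theory.
Local Open Scope classical_set_scope.
Local Open Scope ring_scope.
Local Open Scope quotient_scope.

Section LinearAlgebra.
Variables (K : fieldType) (V : lmodType K).

Definition subspace (U : set V) : Prop :=
  U 0 /\ forall (k : K) u v, U u -> U v -> U (k *: u + v).

Definition lspan (S : set V) : set V :=
  [set v | exists (n : nat) (c : 'I_n -> K) (x : 'I_n -> V),
     (forall i, S (x i)) /\ v = \sum_(i < n) c i *: x i].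

Definition finite_dim (U : set V) : Prop :=
  exists (n : nat) (e : 'I_n -> V), U `<=` lspan (range e).

Definition decomposes (I : choiceType) (U : I -> set V) (v : V) (f : I -> V) :=
  [/\ finite_set [set i | f i != 0], (forall i, U i (f i))
    & v = \sum_(i \in [set: I]) f i].

Definition direct_sum (I : choiceType) (S : set V) (U : I -> set V) : Prop :=
  [/\ subspace S, (forall i, subspace (U i)), (forall i, U i `<=` S)
    & forall v, S v -> exists! f : I -> V, decomposes U v f].

(* The homogeneous components of v for the decomposition given by U; the choice
   is irrelevant when U is a direct sum. *)
Definition component (I : choiceType) (U : I -> set V) (v : V) : I -> V :=
  if pselect (exists f, decomposes U v f) is left e then projT1 (cid e)
  else fun=> 0.

Lemma subspace_lspan (S : set V) : subspace (lspan S).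
Proof.
split.
  exists 0%N, (fun=> 0), (fun=> 0); split; first by case.
  by rewrite big_ord0.
move=> k _ _ [n [c [x [Sx ->]]]] [m [d [y [Sy ->]]]].
exists (n + m)%N, (fun i => match fintype.split i with inl j => k * c j | inr j => d j end),
  (fun i => match fintype.split i with inl j => x j | inr j => y j end).
split; first by move=> i; case: (fintype.split i).
rewrite big_split_ord /= scaler_sumr; congr (_ + _); apply: eq_bigr => i _.
  by rewrite (unsplitK (inl i)) scalerA.
by rewrite (unsplitK (inr i)).
Qed.

Definition spred (U : set V) (hU : subspace U) : {pred V} := fun v => `[< U v >].

Section Carrier.
Variables (U : set V) (hU : subspace U).

Lemma spred_submod_closed : submod_closed (spred hU).
Proof.
case: (hU) => U0 UD; split; first exact/asboolP.
by move=> k u v /asboolP Uu /asboolP Uv; apply/asboolP/UD.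
Qed.

HB.instance Definition _ :=
  GRing.isSubmodClosed.Build K V (spred hU) spred_submod_closed.

Record subspace_type := SubspaceType {
  sub_val : V;
  sub_valP : sub_val \in spred hU
}.

HB.instance Definition _ := [isSub for sub_val].
HB.instance Definition _ := [Choice of subspace_type by <:].
HB.instance Definition _ := [SubChoice_isSubLmodule of subspace_type by <:].

Definition quotient : Type := {ideal_quot (spred hU)}.

HB.instance Definition _ := GRing.Zmodule.on quotient.

Definition qproj (v : V) : quotient := \pi_{ideal_quot (spred hU)} v.
Definition qrepr (x : quotient) : V := repr (x : {ideal_quot (spred hU)}).

Lemma qreprK : cancel qrepr qproj.
Proof. by move=> x; exact: reprK. Qed.

Lemma qproj_eq (u v : V) : qproj u = qproj v <-> U (u - v).
Proof.
have E := Quotient.idealrBE (spred hU) u v; split=> [uv|Uuv].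
  by apply/asboolP; rewrite -[`[< _ >]]/(_ \in spred hU) E; apply/eqP.
by apply/eqP; rewrite -[_ == _]E; apply/asboolP.
Qed.

Lemma qprojD (u v : V) : qproj (u + v) = qproj u + qproj v.
Proof. exact: (Quotient.pi_add (spred hU)). Qed.

Definition qscale (k : K) (x : quotient) : quotient := qproj (k *: qrepr x).

Lemma qprojZ (k : K) (u : V) : qproj (k *: u) = qscale k (qproj u).
Proof.
apply/qproj_eq; rewrite -scalerBr -[_ *: _]addr0.
by apply: (proj2 hU _ _ _ _ (proj1 hU)); apply/qproj_eq; rewrite qreprK.
Qed.

Lemma qscaleA (a b : K) x : qscale a (qscale b x) = qscale (a * b) x.
Proof. by rewrite -[x]qreprK -!qprojZ scalerA. Qed.

Lemma qscale1 : left_id 1 qscale.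
Proof. by move=> x; rewrite -[x]qreprK -qprojZ scale1r. Qed.

Lemma qscaleDr : right_distributive qscale +%R.
Proof.
by move=> k x y; rewrite -[x]qreprK -[y]qreprK -qprojD -!qprojZ -qprojD scalerDr.
Qed.

Lemma qscaleDl (x : quotient) : {morph (fun k => qscale k x) : a b / a + b}.
Proof. by move=> a b /=; rewrite -[x]qreprK -!qprojZ -qprojD scalerDl. Qed.

HB.instance Definition _ := GRing.Zmodule_isLmodule.Build K quotient
  qscaleA qscale1 qscaleDr qscaleDl.

End Carrier.
End LinearAlgebra.

(* The coefficient of y^i in (1 + y)^x. *)
Definition gbin (K : fieldType) (x : K) (i : nat) : K :=
  (\prod_(j < i) (x - j%:R)) / (i`!)%:R.

Definition qhalf (i : bool) : rat := (nat_of_bool i)%:R / 2.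
Definition hcoset (i : bool) : set rat :=
  [set x | exists k : int, x = k%:~R + qhalf i].

(* Vertex operators are given by their modes, Y(a,z) = sum_n a_n z^(-n-1), with
   [vmode a n b] = a_n b.  A product of formal series applied to a vector has,
   in each coefficient, a sum over i : nat with finitely many nonzero terms by
   truncation; these are written \sum_(i \in [set: nat]).

   The Jacobi identity is stated coefficientwise: with all binomials expanded in
   nonnegative powers of the second variable, [jacobi] below equates the
   coefficients of z0^(-l-1) z1^(-m-1) z2^(-n-1), using
     z0^-1 delta((z1 - z2)/z0)
       = sum_l z0^(-l-1) sum_i (-1)^i C(l,i) z1^(l-i) z2^i,
     z0^-1 delta((-z2 + z1)/z0)
       = sum_l z0^(-l-1) sum_i C(l,i) (-1)^(l-i) z2^(l-i) z1^i,
     z2^-1 delta((z1 - z0)/z2) ((z1 - z0)/z2)^(-q/2)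
       = sum_(t in -q/2+Z) sum_i (-1)^i C(t,i) z0^i z1^(t-i) z2^(-t-1);
   in the last one the coefficient of z1^(-m-1) comes from t = i - m - 1. *)
Record svoa (K : fieldType) := SVOA {
  svoa_sort :> lmodType K;
  vmode : svoa_sort -> int -> svoa_sort -> svoa_sort;
  vac : svoa_sort;
  conf : svoa_sort;
  par : bool -> set svoa_sort;   (* V^0 and V^1 *)
  ccharge : K;
  virL := fun n : int => vmode conf (n + 1);
  wtsp := fun s : rat => [set v : svoa_sort | virL 0 v = ratr s *: v];

  vmode_linl : forall n b, linear (fun a => vmode a n b);
  vmode_linr : forall a n, linear (vmode a n);
  vmode_trunc : forall a b, exists N : int, forall n, N <= n -> vmode a n b = 0;

  par_sum : direct_sum setT par;
  par_grading : forall i : bool,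
    direct_sum (par i) (fun n : int => par i `&` wtsp (n%:~R + qhalf i));
  wtsp_fin : forall s : rat, finite_dim (wtsp s);
  par_vmode : forall i j a b n, par i a -> par j b -> par (i (+) j) (vmode a n b);

  vac_par : par false vac;
  vac_mode : forall n b, vmode vac n b = if n == -1 then b else 0;
  vac_create : forall a, vmode a (-1) vac = a;
  vac_trunc : forall a (n : int), 0 <= n -> vmode a n vac = 0;

  conf_par : par false conf;
  conf_wt : wtsp 2 conf;
  virasoro : forall (m n : int) v,
    virL m (virL n v) - virL n (virL m v) =
    (m - n)%:~R *: virL (m + n) v
    + (if m + n == 0 then ((m ^+ 3 - m)%:~R / 12 * ccharge) *: v else 0);
  vderiv : forall a n b,
    vmode (virL (-1) a) n b = - n%:~R *: vmode a (n - 1) b;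

  jacobi : forall (i j : bool) a b v (l m n : int), par i a -> par j b ->
    (\sum_(k \in [set: nat]) ((-1) ^+ k * gbin l%:~R k) *:
       vmode a (m + l - k%:Z) (vmode b (n + k%:Z) v))
    - (-1) ^+ (i && j) *:
      (\sum_(k \in [set: nat]) ((-1) ^ (l - k%:Z) * gbin l%:~R k) *:
         vmode b (n + l - k%:Z) (vmode a (m + k%:Z) v))
    = \sum_(k \in [set: nat]) ((-1) ^+ k * gbin (k%:Z - m - 1)%:~R k) *:
        vmode (vmode a (l + k%:Z) b) (m + n - k%:Z) v
}.

Section TwistedZhuAlgebra.
Variables (K : fieldType) (V : svoa K).

(* Res_z Y(a,z) (1+z)^(wt a) z^(-p) b, extended linearly in a through the
   decomposition of a into L_0-homogeneous components. *)
Definition tres (p : nat) (a b : V) : V :=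
  \sum_(s \in [set: rat]) \sum_(i \in [set: nat])
    gbin (ratr s) i *: vmode (component (@wtsp K V) a s) (i%:Z - p%:Z) b.

Definition tstar : V -> V -> V := tres 1.
Definition tcirc : V -> V -> V := tres 2.

Definition Ot : set V := lspan [set v | exists a b, v = tcirc a b].

Lemma Ot_subspace : subspace Ot.
Proof. exact: subspace_lspan. Qed.

(* A_t(V) = V / O_t(V) as a vector space, and the class a + O_t(V). *)
Definition zhu : lmodType K := quotient Ot_subspace.

Definition zcl (a : V) : zhu := qproj Ot_subspace a.

(* The product induced by *_t, through representatives; its independence of
   the representatives is [zhu_algebra_compat] below. *)
Definition zmul (x y : zhu) : zhu := zcl (tstar (qrepr x) (qrepr y)).

Definition zpar (i : bool) : set zhu := [set x | exists2 a, par i a & x = zcl a].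

Record zhu_graded_algebra : Prop := {
  zhu_algebra_compat : forall a b, zmul (zcl a) (zcl b) = zcl (tstar a b);
  zhu_algebra_linl : forall y, linear (fun x => zmul x y);
  zhu_algebra_linr : forall x, linear (zmul x);
  zhu_algebra_assoc : associative zmul;
  zhu_algebra_unitl : left_id (zcl (vac V)) zmul;
  zhu_algebra_unitr : right_id (zcl (vac V)) zmul;
  zhu_algebra_sum : direct_sum setT zpar;
  zhu_algebra_par : forall i j x y, zpar i x -> zpar j y -> zpar (i (+) j) (zmul x y)
}.

Record zhu_module (W : lmodType K) (act : zhu -> W -> W) : Prop := {
  zhu_module_linl : forall w, linear (fun x => act x w);
  zhu_module_linr : forall x, linear (act x);
  zhu_module_unit : forall w, act (zcl (vac V)) w = w;
  zhu_module_mul : forall x y w, act (zmul x y) w = act x (act y w)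
}.

Definition zhu_irreducible (W : lmodType K) (act : zhu -> W -> W) : Prop :=
  (exists w : W, w != 0) /\
  forall U : set W, subspace U -> (forall x w, U w -> U (act x w)) ->
    U = [set 0] \/ U = setT.

Definition zhu_isomorphic (W W' : lmodType K)
    (act : zhu -> W -> W) (act' : zhu -> W' -> W') : Prop :=
  exists f : W -> W',
    [/\ linear f, bijective f & forall x w, f (act x w) = act' x (f w)].

End TwistedZhuAlgebra.

(* Modes on a twisted module are indexed by rat; by [tmode_coset] only the
   indices in (1/2)Z occur.  In [tjacobi] the coefficients with m or n outside
   the stated cosets vanish identically on both sides. *)
Record twisted_module (K : fieldType) (V : svoa K) := TwistedModule {
  tw_sort :> lmodType K;
  tmode : V -> rat -> tw_sort -> tw_sort;
  tgr : nat -> set tw_sort;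
  tgrq := fun x : rat =>   (* M(x), with M(x) = 0 unless x is in N *)
    [set v : tw_sort | v = 0 \/ exists2 k : nat, x = k%:R & tgr k v];

  tgr_sum : direct_sum setT tgr;
  tmode_linl : forall n v, linear (fun a => tmode a n v);
  tmode_linr : forall a n, linear (tmode a n);
  tmode_coset : forall i a n v, par i a -> ~ hcoset i n -> tmode a n v = 0;
  tmode_trunc : forall a v, exists N : rat, forall n, N <= n -> tmode a n v = 0;
  tmode_vac : forall n v, tmode (vac V) n v = if n == -1 then v else 0;
  tmode_gr : forall (s : rat) a n k v, wtsp s a -> tgr k v ->
    tgrq (k%:R + s - n - 1) (tmode a n v);

  tjacobi : forall (i j : bool) (a b : V) v (l : int) (m n : rat),
    par i a -> par j b -> hcoset i m -> hcoset j n ->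
    (\sum_(k \in [set: nat]) ((-1) ^+ k * gbin l%:~R k) *:
       tmode a (m + l%:~R - k%:R) (tmode b (n + k%:R) v))
    - (-1) ^+ (i && j) *:
      (\sum_(k \in [set: nat]) ((-1) ^ (l - k%:Z) * gbin l%:~R k) *:
         tmode b (n + l%:~R - k%:R) (tmode a (m + k%:R) v))
    = \sum_(k \in [set: nat]) ((-1) ^+ k * gbin (ratr (k%:R - m - 1)) k) *:
        tmode (vmode a (l + k%:Z) b) (m + n - k%:R) v
}.

Section TopLevel.
Variables (K : fieldType) (V : svoa K) (M : twisted_module V).

Lemma subspace_tgr (k : nat) : subspace (@tgr K V M k).
Proof. by case: (tgr_sum M). Qed.

Definition top_level : lmodType K := subspace_type (subspace_tgr 0).

Definition top_val (w : top_level) : M := sub_val w.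

(* [act] is an A_t(V)-module structure on M(0) with a + O_t(V) acting by o(a). *)
Definition top_action (act : zhu V -> top_level -> top_level) : Prop :=
  zhu_module act /\
  forall (s : rat) (a : V) (w : top_level), wtsp s a ->
    top_val (act (zcl a) w) = tmode a (s - 1) (top_val w).

Definition twisted_irreducible : Prop :=
  (exists v : M, v != 0) /\
  forall U : set M, subspace U -> (forall a n v, U v -> U (tmode a n v)) ->
    U = [set 0] \/ U = setT.

End TopLevel.

(* Main.v *)
(* Everything rests on the operators wop s a x p, the residues at z = 1 of
   z^(s-1+x) (z-1)^p Y(a, z-1) dz for a of weight s, and on the Jacobi identity
   rewritten for them (wop_borcherds).  O_t(V) contains all residues whose
   differential vanishes to order x >= 1 at 0 and is regular at infinity, i.e.
   x + p <= -1; Zhu's identities are instances of wop_borcherds modulo these.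

   To build a module with top level W, embed it among the functionals
   V -> W, v |-> <w', Y(v, 1) u>, with w' a formal lowest covector.  The form
   <w', Y(v, 1) Y(a, z) u> dz has poles only at 0, 1 and infinity: its
   expansion at 1 is given by wop, at infinity by the action of A_t(V), and the
   residue theorem then forces its expansion at 0, which defines the modes a_n on
   functionals.  Expanding both sides of wop_borcherds at 0 gives the twisted
   Jacobi identity for these modes.  L_(-1) + L_0 = z d/dz grades the
   functionals; the submodule generated by the v |-> [v] w has top level W.
   It is irreducible since phi(v) is the value at the vacuum of a mode of v
   applied to phi, so that no nonzero submodule misses the top level. *)

(* The weight s of a homogeneous a and its mode indices on a twisted module lie in the same coset
   i/2 + Z, so a_n is written with n = s - 1 + x for an integer x, the amount by which a_n lowers
   the degree. One calculus thus serves both parities, and s survives only inside binomial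
   coefficients. The obstacle is that a mode on functionals is known only through residues at 1,
   never in closed form. Rational functions are avoided as follows. Multiplying an expansion at 0 by
   (z - 1)^p gives a system in its coefficients that is triangular with diagonal entries 1 or -1,
   and coefficients of large index vanish. An identity between modes therefore follows, by downward
   induction on the index, once it holds after multiplication by (z - 1)^p with p so negative that
   infinity contributes nothing. This reduction ([bcf_unique], and its two-variable form in
   [emode_jacobi]) yields independence of choices, smoothness, grading and the Jacobi identity.
   Modes act on u, not on v, so the order of operators is reversed between [wop] and [emode]. *)
Require Import Defs.
From mathcomp Require Import all_boot all_order all_algebra.
From mathcomp Require Import zify ring lra.
From mathcomp Require Import boolp classical_sets functions cardinality fsbigop.
From mathcomp Require Import reals complex.

Set Implicit Arguments.
Unset Strict Implicit.
Unset Printing Implicit Defensive.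

Import Order.TTheory GRing.Theory Num.Theory.
Local Open Scope classical_set_scope.
Local Open Scope ring_scope.

(** * Generalized binomials and finite sums *)

Section Binomials.
Variable K : numFieldType.
Implicit Types (x y : K) (i j k n u : nat).

Lemma gbin0 x : gbin x 0 = 1.
Proof. by rewrite /gbin big_ord0 mul1r invr1. Qed.

Lemma gbinS x i : i.+1%:R * gbin x i.+1 = (x - i%:R) * gbin x i.
Proof.
rewrite /gbin big_ord_recr /= factS natrM invfM.
have h : i.+1%:R != 0 :> K by rewrite pnatr_eq0.
have h' : i`!%:R != 0 :> K by rewrite pnatr_eq0 -lt0n fact_gt0.
by field; rewrite h' nat1r.
Qed.

Lemma gbin1 x : gbin x 1 = x.
Proof. by have := gbinS x 0; rewrite gbin0 mul1r subr0 mulr1. Qed.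

(** The factor n + 1 is split as i + (n + 1 - i), the Leibniz rule for the derivative of (1 + z)^x
    (1 + z)^y. *)
Lemma gbin_vandermonde x y n :
  \sum_(i < n.+1) gbin x i * gbin y (n - i) = gbin (x + y) n.
Proof.
elim: n => [|n IH]; first by rewrite big_ord1 subnn !gbin0 mulr1.
apply: (@mulfI _ n.+1%:R); first by rewrite pnatr_eq0.
rewrite gbinS -IH !mulr_sumr.
rewrite (eq_bigr (fun i : 'I_n.+2 => i%:R * gbin x i * gbin y (n.+1 - i) +
   gbin x i * ((n.+1 - i)%:R * gbin y (n.+1 - i)))); last first.
  move=> i _; have le_i : (i <= n.+1)%N by rewrite -ltnS.
  by rewrite natrB //; ring.
rewrite big_split /= big_ord_recl /= mul0r mul0r add0r.
rewrite [X in _ + X]big_ord_recr /= subnn mul0r mulr0 addr0 -big_split /=.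
apply: eq_bigr => i _; rewrite /bump /= add1n gbinS subSS.
have le_i : (i <= n)%N by rewrite -ltnS.
by rewrite subSn // gbinS natrB //; ring.
Qed.

Lemma gbin_pascal x i : gbin (x + 1) i.+1 = gbin x i.+1 + gbin x i.
Proof.
elim: i => [|i IH]; first by rewrite !gbin1 gbin0.
apply: (@mulfI _ i.+2%:R); first by rewrite pnatr_eq0.
rewrite gbinS IH !mulrDr gbinS.
have := gbinS x i; rewrite -natr1 -[i.+2%:R]natr1 -[i.+1%:R]natr1 => e.
have -> : (x + 1 - (i%:R + 1)) * gbin x i = (i%:R + 1) * gbin x i.+1.
  by rewrite e; ring.
have e' : x * gbin x i = (i%:R + 1) * gbin x i.+1 + i%:R * gbin x i.
  by rewrite e; ring.
by rewrite mulrDl mulrDl; ring: e.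
Qed.

Lemma gbin_nat n u : gbin (n%:R : K) u = 'C(n, u)%:R.
Proof.
elim: n u => [|n IH] [|u]; rewrite ?bin0 ?gbin0 //.
  have := gbinS 0 u => /eqP; case: u => [|u]; first by rewrite gbin1.
  rewrite bin0n /= /gbin big_ord_recl /= subrr !mul0r //.
by rewrite -natr1 gbin_pascal !IH binS natrD.
Qed.

Definition ffactr x n := \prod_(j < n) (x - j%:R).

Lemma ffactrD x u j : ffactr x (u + j) = ffactr x u * ffactr (x - u%:R) j.
Proof.
rewrite /ffactr big_split_ord /=; congr (_ * _); apply: eq_bigr => i _.
by rewrite natrD opprD addrA.
Qed.

Lemma gbin_trinomial x u j :
  gbin x (u + j) * gbin (u + j)%:R u = gbin x u * gbin (x - u%:R) j.
Proof.
have e : 'C(u + j, u)%:R * (u`!%:R * j`!%:R) = (u + j)`!%:R :> K.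
  by rewrite -!natrM -(bin_fact (leq_addr j u)) addKn.
rewrite gbin_nat /gbin -!/(ffactr _ _) ffactrD.
have := fact_gt0 (u + j); rewrite lt0n -(pnatr_eq0 K) -e => h.
have hC : 'C(u + j, u)%:R != 0 :> K by move: h; rewrite mulf_eq0 negb_or => /andP[].
have hu : u`!%:R != 0 :> K by rewrite pnatr_eq0 -lt0n fact_gt0.
have hj : j`!%:R != 0 :> K by rewrite pnatr_eq0 -lt0n fact_gt0.
by field; rewrite hC hu hj.
Qed.

Lemma gbin_nat_small n u : (n < u)%N -> gbin (n%:R : K) u = 0.
Proof. by move=> h; rewrite gbin_nat bin_small. Qed.

(** Coefficient of z^(u+r) in the product of (z^u / u!) (d/dz)^u (1 + z)^x and (1 + z)^y. *)
Lemma gbin_vandermonde_shift x y u r :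
  \sum_(i < (u + r).+1) gbin x i * gbin i%:R u * gbin y (u + r - i)
    = gbin x u * gbin (x + y - u%:R) r.
Proof.
rewrite -addnS big_split_ord /= big1 ?add0r => [|i _]; last first.
  by rewrite gbin_nat_small ?mulr0 ?mul0r.
rewrite addrAC -gbin_vandermonde mulr_sumr; apply: eq_bigr => i _.
by rewrite gbin_trinomial subnDl mulrA.
Qed.

Lemma gbin_sym x u j : gbin x u * gbin (x - u%:R) j = gbin x j * gbin (x - j%:R) u.
Proof.
rewrite /gbin -!/(ffactr _ _).
rewrite mulrACA -ffactrD [RHS]mulrACA -ffactrD addnC; congr (_ * _).
by rewrite mulrC.
Qed.

Lemma gbin_absorb x r : r.+1%:R * gbin x r.+1 = x * gbin (x - 1) r.
Proof. by rewrite gbinS; have := gbin_sym x 1 r; rewrite !gbin1 => ->; rewrite mulrC. Qed.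

(** Upper negation: it turns the coefficients on the right of the two Jacobi identities into C(m,
    k). *)
Lemma gbin_neg x k : (-1) ^+ k * gbin (k%:R - x - 1) k = gbin x k.
Proof.
rewrite /gbin mulrA; congr (_ / _).
rewrite -[X in (-1) ^+ X]card_ord -prodr_const -big_split /=.
rewrite (reindex_inj rev_ord_inj) /=; apply: eq_bigr => i _.
by rewrite natrB //; ring.
Qed.

End Binomials.

Section NatSums.
Variable U : zmodType.
Implicit Types F : nat -> U.

Lemma nsumE N F : (forall k, (N <= k)%N -> F k = 0) ->
  \sum_(k \in [set: nat]) F k = \sum_(k < N) F k.
Proof.
move=> F0; rewrite fsbig_ord; apply/esym/fsbig_widen => // k [_ /=] /negP.
by rewrite -leqNgt; apply: F0.
Qed.

Lemma ord_widen N M F : (N <= M)%N -> (forall k, (N <= k)%N -> F k = 0) ->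
  \sum_(k < M) F k = \sum_(k < N) F k.
Proof.
move=> NM F0; rewrite -!(big_mkord predT) (big_cat_nat _ NM) //=.
rewrite [X in _ + X]big_nat_cond [X in _ + X]big1 ?addr0 // => k /andP[/andP[Nk _] _].
exact: F0.
Qed.

End NatSums.

(** * Linear functions and direct sums *)

Section LinearFunctions.
Variables (K : fieldType) (U V : lmodType K) (f : U -> V).
Hypothesis lin_f : linear f.

Lemma lin0 : f 0 = 0.
Proof. by have := lin_f (-1) 0 0; rewrite scaler0 addr0 scaleN1r addNr. Qed.

Lemma linZ k u : f (k *: u) = k *: f u.
Proof. by rewrite -[k *: u]addr0 lin_f lin0 addr0. Qed.

Lemma linD u v : f (u + v) = f u + f v.
Proof. by rewrite -[u]scale1r lin_f !scale1r. Qed.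

Lemma linN u : f (- u) = - f u.
Proof. by rewrite -scaleN1r linZ scaleN1r. Qed.

Lemma linB u v : f (u - v) = f u - f v.
Proof. by rewrite linD linN. Qed.

Lemma lin_sum (I : Type) (r : seq I) (P : pred I) F :
  f (\sum_(i <- r | P i) F i) = \sum_(i <- r | P i) f (F i).
Proof.
elim/big_rec2: _ => [|i x y _ <-]; first exact: lin0.
by rewrite linD.
Qed.

End LinearFunctions.

Section Subspaces.
Variables (K : fieldType) (V : lmodType K) (S : set V).
Hypothesis sub_S : subspace S.

Lemma sub0 : S 0. Proof. by case: sub_S. Qed.

Lemma subD u v : S u -> S v -> S (u + v).
Proof. by case: sub_S => _ /(_ 1 u v); rewrite scale1r. Qed.

Lemma subZ k u : S u -> S (k *: u).
Proof. by case: sub_S => S0 /(_ k u 0); rewrite addr0 => h /h; apply. Qed.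

Lemma subN u : S u -> S (- u).
Proof. by rewrite -scaleN1r; apply: subZ. Qed.

Lemma sub_sum (I : Type) (r : seq I) (P : pred I) F :
  (forall i, P i -> S (F i)) -> S (\sum_(i <- r | P i) F i).
Proof. by move=> SF; elim/big_ind: _ => //; [exact: sub0|exact: subD]. Qed.

End Subspaces.

Lemma sub_preim (K : fieldType) (U V : lmodType K) (f : U -> V) (S : set V) :
  linear f -> subspace S -> subspace [set u | S (f u)].
Proof.
move=> lf sS; split=> [|k u v hu hv] /=; first by rewrite (lin0 lf); apply: sub0.
by rewrite lf; apply: (proj2 sS).
Qed.

Section DirectSums.
Variables (K : fieldType) (I : choiceType) (V : lmodType K).
Implicit Types (U : I -> set V) (f g : I -> V).

Lemma fsum_seq (X : zmodType) (r : seq I) (F : I -> X) : uniq r ->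
  (forall i, i \notin r -> F i = 0) -> \sum_(i \in [set: I]) F i = \sum_(i <- r) F i.
Proof.
move=> ur F0; rewrite -(fsbig_widen [set` r] setT) //; last first.
  by move=> i [_ /= /negP]; apply: F0.
by rewrite [RHS](fsbig_seq _ _ ur).
Qed.

Lemma finite_support_seq f : finite_set [set i | f i != 0] <->
  exists2 r : seq I, uniq r & forall i, i \notin r -> f i = 0.
Proof.
split=> [/finite_seqP[r fr]|[r ur fr]].
  exists (undup r); first exact: undup_uniq.
  move=> i; rewrite mem_undup => ir; apply/eqP; apply: contraNT ir => fi.
  by have : [set i | f i != 0] i by []; rewrite fr.
apply: (@sub_finite_set _ _ [set` r]) => [i /=|]; last exact: finite_seq.
by apply: contraNT => ir; rewrite (fr _ ir).
Qed.

Lemma common_support f g : finite_set [set i | f i != 0] ->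
  finite_set [set i | g i != 0] ->
  exists r : seq I, [/\ uniq r, forall i, i \notin r -> f i = 0
    & forall i, i \notin r -> g i = 0].
Proof.
move=> /finite_support_seq[r _ fr] /finite_support_seq[s _ gs].
exists (undup (r ++ s)); split; first exact: undup_uniq.
  by move=> i; rewrite mem_undup mem_cat negb_or => /andP[/fr].
by move=> i; rewrite mem_undup mem_cat negb_or => /andP[_ /gs].
Qed.

Lemma decomposes_lin U u v f g k : (forall i, subspace (U i)) ->
  decomposes U u f -> decomposes U v g ->
  decomposes U (k *: u + v) (fun i => k *: f i + g i).
Proof.
move=> sU [Ff Uf ->] [Fg Ug ->]; have [r [ur fr gr]] := common_support Ff Fg.
have h i : i \notin r -> k *: f i + g i = 0.
  by move=> ir; rewrite fr // gr // scaler0 addr0.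
split; first by apply/finite_support_seq; exists r.
- by move=> i; case: (sU i) => _; apply.
- by rewrite !(fsum_seq ur) // scaler_sumr -big_split.
Qed.

Lemma decomposes_single U i v : (forall i, subspace (U i)) -> U i v ->
  decomposes U v (fun j => if j == i then v else 0).
Proof.
move=> sU Uv; have h j : j \notin [:: i] -> (if j == i then v else 0) = 0.
  by rewrite inE => /negPf->.
split; first by apply/finite_support_seq; exists [:: i].
- by move=> j; case: eqP => [->//|_]; apply: sub0.
- by rewrite (@fsum_seq _ [:: i]) // big_seq1 eqxx.
Qed.

Lemma decomposes_in U u f (P : set V) : subspace P -> decomposes U u f ->
  (forall i, P (f i)) -> P u.
Proof.
move=> sP [/finite_support_seq[r ur fr] Uf ->] Pf.
by rewrite (fsum_seq ur) //; apply: sub_sum.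
Qed.

Lemma decomposes_subspace U : (forall i, subspace (U i)) ->
  subspace [set v | exists f, decomposes U v f].
Proof.
move=> sU; split=> [|k u v [f df] [g dg]]; last first.
  by exists (fun i => k *: f i + g i); apply: decomposes_lin.
exists (fun=> 0); split; last by rewrite fsbig1.
- by apply/finite_support_seq; exists [::].
- by move=> i; apply: sub0.
Qed.

Section Component.
Variable U : I -> set V.
Hypothesis dU : direct_sum setT U.

Lemma componentP v : decomposes U v (component U v).
Proof.
rewrite /component; case: pselect => [e|ne]; first by case: cid.
by exfalso; apply: ne; case: dU => _ _ _ /(_ v Logic.I) [f [df _]]; exists f.
Qed.

Lemma component_uniq v f : decomposes U v f -> component U v = f.
Proof.
by move=> df; case: dU => _ _ _ /(_ v Logic.I) [g [_ ug]];
   rewrite -(ug _ df) -(ug _ (componentP v)).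
Qed.

Lemma component_in v i : U i v ->
  component U v = fun j => if j == i then v else 0.
Proof.
by move=> Uv; apply/component_uniq/decomposes_single => //; case: dU.
Qed.

Lemma component_lin i : linear (fun v => component U v i).
Proof.
move=> k u v; rewrite (@component_uniq _ (fun i => k *: component U u i + component U v i)) //.
by apply: decomposes_lin; [case: dU|exact: componentP..].
Qed.

Lemma componentU v i : U i (component U v i).
Proof. by have [] := componentP v. Qed.

Lemma direct_sum_ind (P : set V) : subspace P -> (forall i v, U i v -> P v) ->
  forall v, P v.
Proof.
by move=> sP UP v; apply: (decomposes_in sP (componentP v)) => i;
   apply: UP; apply: componentU.
Qed.

Variables (X : lmodType K) (L : I -> V -> X).
Hypothesis lin_L : forall i, linear (L i).

Definition lin_ext v : X := \sum_(i \in [set: I]) L i (component U v i).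

Lemma lin_ext_linear : linear lin_ext.
Proof.
move=> k u v; rewrite /lin_ext.
have [Ff _ _] := componentP u; have [Fg _ _] := componentP v.
have [r [ur fr gr]] := common_support Ff Fg.
rewrite !(fsum_seq ur) //.
- by rewrite scaler_sumr -big_split; apply: eq_bigr => i _; rewrite component_lin lin_L.
- by move=> i ir; rewrite gr // lin0.
- by move=> i ir; rewrite fr // lin0.
- by move=> i ir; rewrite component_lin fr // gr // scaler0 addr0 lin0.
Qed.

Lemma lin_extE i v : U i v -> lin_ext v = L i v.
Proof.
move=> Uv; rewrite /lin_ext (component_in Uv) (@fsum_seq _ [:: i]) //.
  by rewrite big_seq1 eqxx.
by move=> j; rewrite inE => /negPf->; rewrite lin0.
Qed.

End Component.

Section Eigenspaces.
Variables (X : lmodType K) (e L : V -> X) (c : I -> K) (U : I -> set V).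
Hypotheses (lin_e : linear e) (inj_e : injective e) (lin_L : linear L).
Hypotheses (inj_c : injective c) (sU : forall i, subspace (U i)).
Hypothesis eig : forall i v, U i v -> L v = c i *: e v.

(** Applying L - c_x e removes the term of index x. The eigenvalue equation passes through an
    injection [e] into another space because [L] need not preserve the space: for functionals it is
    precomposition with [euler], not known in advance to preserve the generated module. *)
Lemma eigen_independent (r : seq I) f : uniq r -> (forall i, U i (f i)) ->
  \sum_(i <- r) f i = 0 -> forall i, i \in r -> f i = 0.
Proof.
elim: r f => // x r IH f /andP[xr ur] Uf f0.
have h i : i \in r -> (c i - c x) *: f i = 0.
  apply: (IH (fun i => (c i - c x) *: f i)) => // [j|]; first exact: subZ.
  apply: inj_e; rewrite (lin0 lin_e) (lin_sum lin_e).
  have := congr1 L f0; rewrite (lin0 lin_L) (lin_sum lin_L).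
  have := congr1 (fun v => c x *: e v) f0.
  rewrite (lin0 lin_e) scaler0 (lin_sum lin_e) scaler_sumr => e1 e2.
  have : \sum_(i <- x :: r) (L (f i) - c x *: e (f i)) = 0 by rewrite sumrB e1 e2 subr0.
  rewrite big_cons (eig (Uf x)) subrr add0r => s0; rewrite -[RHS]s0.
  by apply: eq_bigr => j _; rewrite (linZ lin_e) (eig (Uf j)) scalerBl.
have h' i : i \in r -> f i = 0.
  move=> ir; apply/eqP; have /eqP := h i ir; rewrite scaler_eq0 subr_eq0.
  by case/orP => [/eqP /inj_c ix|//]; rewrite -ix ir in xr.
move=> i; rewrite inE => /orP[/eqP->|/h' //].
by move: f0; rewrite big_cons big_seq big1 ?addr0 // => j /h'.
Qed.

Lemma eigen_direct_sum : (forall v, exists f, decomposes U v f) -> direct_sum setT U.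
Proof.
move=> ex; split=> // [v _]; have [f df] := ex v; exists f; split=> // g dg.
have := decomposes_lin (-1) sU df dg; rewrite scaleN1r addNr.
case=> /finite_support_seq[r ur fr] Ur; rewrite (fsum_seq ur fr) => /esym s0.
apply: funext => i; apply/esym/eqP; rewrite -subr_eq0 addrC -scaleN1r; apply/eqP.
by case: (boolP (i \in r)) => [ir|/fr //]; exact: (eigen_independent ur Ur s0 ir).
Qed.

End Eigenspaces.
End DirectSums.

(** * Weights and modes of a vertex superalgebra *)

Section WeightSpaces.
Variables (K : numFieldType) (V : svoa K).
Implicit Types (a b v : V) (i j : bool) (s t : rat).

Lemma virL_lin n : linear (@virL K V n). Proof. exact: vmode_linr. Qed.

Lemma wtsp_subspace s : subspace (@wtsp K V s).
Proof.
rewrite /wtsp; split=> [|k u v hu hv] /=.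
  by rewrite scaler0 (lin0 (virL_lin 0)).
by rewrite (virL_lin 0) hu hv scalerDr !scalerA mulrC.
Qed.

Lemma par_subspace i : subspace (@par K V i).
Proof. by case: (par_sum V). Qed.

Definition homog i s : set V := [set a | [/\ par i a, wtsp s a & hcoset i s]].

Lemma par_homog_ind i (P : set V) : subspace P -> (forall s a, homog i s a -> P a) ->
  forall a, par i a -> P a.
Proof.
move=> sP hP a; have [_ sU _ ex] := par_grading V i.
move=> /ex[f [df _]]; apply: (decomposes_in sP df) => n.
case: df => _ /(_ n)[pf wf] _; apply: (hP (n%:~R + qhalf i)); split=> //.
by exists n.
Qed.

Lemma homog_ind (P : set V) : subspace P -> (forall i s a, homog i s a -> P a) ->
  forall a, P a.
Proof.
move=> sP hP; apply: (direct_sum_ind (par_sum V) sP) => i.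
by apply: par_homog_ind => // s a; apply: hP.
Qed.

(** Decompositions exist by the gradings of V^0 and V^1; they are unique because distinct rationals
    remain distinct eigenvalues in characteristic 0. *)
Lemma wt_direct : direct_sum setT (@wtsp K V).
Proof.
apply: (@eigen_direct_sum _ _ V V id (@virL K V 0) (fun s => ratr s)) => //.
- exact: vmode_linr.
- exact: fmorph_inj.
- exact: wtsp_subspace.
apply: homog_ind; first exact/decomposes_subspace/wtsp_subspace.
move=> i s a [_ wa _]; exists (fun t => if t == s then a else 0).
by apply: decomposes_single => //; apply: wtsp_subspace.
Qed.

Lemma hcoset_inj i j s : hcoset i s -> hcoset j s -> i = j.
Proof.
move=> [k ->] [l /eqP]; rewrite /qhalf; case: i j => [] [] //=; rewrite ?mul0r ?addr0.
  rewrite -(inj_eq (mulIf (x:=2%:Q) _)) // mulrDl mul1r mulVf //.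
  rewrite -[1]/(1%:~R) -[2%:Q]/(2%:~R) -!intrM -intrD eqr_int => /eqP h; exfalso; lia.
rewrite -(inj_eq (mulIf (x:=2%:Q) _)) // mulrDl mul1r mulVf //.
rewrite -[1]/(1%:~R) -[2%:Q]/(2%:~R) -!intrM -intrD eqr_int => /eqP h; exfalso; lia.
Qed.

Lemma component_par i s a : hcoset i s -> par (~~ i) a -> component (@wtsp K V) a s = 0.
Proof.
move=> si; apply: (@par_homog_ind (~~ i) [set a | component (@wtsp K V) a s = 0]).
  split=> /= [|k u v hu hv]; first by rewrite (lin0 (component_lin wt_direct _)).
  by rewrite component_lin ?hu ?hv ?scaler0 ?addr0 //; apply: wt_direct.
move=> t b [_ wb ti] /=; rewrite (component_in wt_direct wb); case: eqP => // st.
by rewrite st in si; have := hcoset_inj si ti; case: (i).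
Qed.

(** The part of a in the other parity has weights in the other coset only, so it has no component of
    weight s. *)
Lemma wt_homog i s a : wtsp s a -> hcoset i s -> homog i s a.
Proof.
move=> wa si; split=> //.
have sP : subspace [set v : V | par i (component (@wtsp K V) v s)].
  split=> /= [|k u v hu hv].
    by rewrite (lin0 (component_lin wt_direct _)); apply: sub0; apply: par_subspace.
  rewrite component_lin; last exact: wt_direct.
  by case: (par_subspace i) => _; apply.
have : par i (component (@wtsp K V) a s); last first.
  by rewrite (component_in wt_direct wa) eqxx.
apply: (direct_sum_ind (par_sum V) sP) => j v pv /=.
case: (eqVneq j i) => [ji|ji]; last first.
  have -> : component (@wtsp K V) v s = 0; last by apply: sub0; apply: par_subspace.
  by apply: (component_par si); move: pv; case: (i) (j) ji => [] [].
rewrite -ji; rewrite -ji in si; move: v pv.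
apply: par_homog_ind; first by rewrite ji.
move=> t v [pv wv _] /=; rewrite (component_in wt_direct wv); case: eqP => // _.
by apply: sub0; apply: par_subspace.
Qed.

Lemma wt_out s a : wtsp s a -> (forall i, ~ hcoset i s) -> a = 0.
Proof.
move=> wa si; have := component_in wt_direct wa => /(congr1 (@^~ s)); rewrite eqxx => <-.
apply: (@homog_ind [set v | component (@wtsp K V) v s = 0]).
  split=> /= [|k u v hu hv]; first by rewrite (lin0 (component_lin wt_direct _)).
  by rewrite component_lin ?hu ?hv ?scaler0 ?addr0 //; apply: wt_direct.
move=> i t v [_ wv ti] /=; rewrite (component_in wt_direct wv); case: eqP => // st.
by case: (si i); rewrite st.
Qed.

(** The parity read off from the weight, so that modes can be defined from the weight decomposition
    alone. Weights outside (1/2)Z occur for the zero vector only. *)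
Definition wpar s : bool := `[< hcoset true s >].

Lemma wparE i s : hcoset i s -> wpar s = i.
Proof.
rewrite /wpar; case: i => h; first exact/asboolP.
by apply/asboolPn => h'; have := hcoset_inj h h'.
Qed.

Lemma wt_homog_wpar s a : wtsp s a -> a <> 0 -> homog (wpar s) s a.
Proof.
move=> wa a0; apply: wt_homog => //; apply: contrapT => h.
apply: a0; apply: (wt_out wa) => i si; apply: h.
by rewrite (wparE si).
Qed.

Lemma hcosetD i j s t (n : int) : hcoset i s -> hcoset j t ->
  hcoset (i (+) j) (s + t + n%:~R).
Proof.
move=> [k ->] [l ->]; rewrite /qhalf.
case: i j => [] [] /=; [exists (k + l + n + 1)|exists (k + l + n)..];
  rewrite /qhalf !rmorphD /=; lra.
Qed.

End WeightSpaces.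

Lemma triangle_sum (U : nmodType) R (F : nat -> nat -> U) :
  \sum_(j < R) \sum_(i < R - j) F j i = \sum_(r < R) \sum_(i < r.+1) F i (r - i)%N.
Proof.
elim: R => [|R IH]; first by rewrite !big_ord0.
rewrite [RHS]big_ord_recr /= -IH big_ord_recr /= subSnn big_ord1.
rewrite [X in _ = _ + X]big_ord_recr /= subnn addrA; congr (_ + _).
rewrite -big_split /=; apply: eq_bigr => j _.
by rewrite subSn ?big_ord_recr //= ltnW.
Qed.

Lemma square_sum (U : zmodType) R M M' (F : nat -> nat -> U) :
  (R <= M)%N -> (R <= M')%N -> (forall j i, (R <= j + i)%N -> F j i = 0) ->
  \sum_(j < M) \sum_(i < M') F j i = \sum_(r < R) \sum_(i < r.+1) F i (r - i)%N.
Proof.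
move=> RM RM' F0; rewrite -triangle_sum.
rewrite (ord_widen (N := R) (F := fun j => \sum_(i < M') F j i)) //.
  apply: eq_bigr => j _; apply: ord_widen => [|k jk].
    by rewrite (leq_trans (leq_subr _ _)).
  by apply: F0; rewrite -leq_subLR.
move=> k Rk; rewrite big1 // => i _; apply: F0.
by rewrite (leq_trans Rk) ?leq_addr.
Qed.

(** The product of two power series, paired with a finitely supported sequence A; the ranges only
    have to cover the support. *)
Lemma cauchy_sum (K : fieldType) (U : lmodType K) R M M' (f g : nat -> K) (A : nat -> U) :
  (R <= M)%N -> (R <= M')%N -> (forall r, (R <= r)%N -> A r = 0) ->
  \sum_(j < M) \sum_(i < M') (f j * g i) *: A (j + i)%N
    = \sum_(r < R) (\sum_(i < r.+1) f i * g (r - i)%N) *: A r.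
Proof.
move=> RM RM' A0; rewrite (square_sum (R := R) (F := fun j i => (f j * g i) *: A (j + i)%N)) //.
  apply: eq_bigr => r _; rewrite scaler_suml; apply: eq_bigr => i _.
  by rewrite subnKC // -ltnS.
by move=> j i /A0 ->; rewrite scaler0.
Qed.

Lemma exchange_sum3 (K : fieldType) (U : lmodType K) N (c : nat -> K)
    (d : nat -> nat -> K) (X : nat -> nat -> nat -> U) :
  \sum_(k < N) c k *: (\sum_(e < N) \sum_(f < N) d e f *: X k e f)
  = \sum_(e < N) \sum_(f < N) d e f *: (\sum_(k < N) c k *: X k e f).
Proof.
under eq_bigr do rewrite scaler_sumr; rewrite exchange_big; apply: eq_bigr => e _ /=.
under eq_bigr do rewrite scaler_sumr; rewrite exchange_big; apply: eq_bigr => f _ /=.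
by rewrite scaler_sumr; apply: eq_bigr => k _; rewrite !scalerA mulrC.
Qed.

(** * Residues of vertex operators against powers of 1 + y and y *)

Section Modes.
Variables (K : numFieldType) (V : svoa K).
Implicit Types (a b c v : V) (i j : bool) (s t : rat) (l m n p q : int) (x y : K).

Lemma vmode_addl n b k u v :
  vmode (k *: u + v) n b = k *: vmode u n b + vmode v n b.
Proof. exact: vmode_linl. Qed.

Lemma borcherds i j a b v l m n : par i a -> par j b ->
    (\sum_(k \in [set: nat]) ((-1) ^+ k * gbin l%:~R k) *:
       vmode a (m + l - k%:Z) (vmode b (n + k%:Z) v))
    - (-1) ^+ (i && j) *:
      (\sum_(k \in [set: nat]) ((-1) ^ (l - k%:Z) * gbin l%:~R k) *:
         vmode b (n + l - k%:Z) (vmode a (m + k%:Z) v))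
    = \sum_(k \in [set: nat]) gbin m%:~R k *: vmode (vmode a (l + k%:Z) b) (m + n - k%:Z) v.
Proof.
move=> pa pb; rewrite (jacobi v l m n pa pb); apply: eq_fsbigr => k _.
by rewrite -[gbin m%:~R k]gbin_neg !rmorphB.
Qed.

Lemma vmode_trunc_nat a b p : exists N : nat, forall n, p + N%:Z <= n -> vmode a n b = 0.
Proof.
have [N aN] := vmode_trunc a b; exists `|N - p|%N => n h; apply: aN; lia.
Qed.

Lemma vmode_trunc_family a (F : nat -> V) N : (forall r, (N <= r)%N -> F r = 0) ->
  exists T : int, forall r n, T <= n -> vmode a n (F r) = 0.
Proof.
elim: N F => [|N IH] F F0.
  by exists 0 => r n _; rewrite F0 // (lin0 (vmode_linr _ _)).
have [T hT] := IH (fun r => F r.+1) (fun r h => F0 r.+1 h).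
have [T' hT'] := vmode_trunc a (F 0%N).
exists (`|T| + `|T'|)%:Z => -[|r] n h; [apply: hT'; lia|apply: hT; lia].
Qed.

Lemma vmode_trunc_familyl (F : nat -> V) v N : (forall r, (N <= r)%N -> F r = 0) ->
  exists T : int, forall r n, T <= n -> vmode (F r) n v = 0.
Proof.
elim: N F => [|N IH] F F0.
  by exists 0 => r n _; rewrite F0 // (lin0 (vmode_linl _ _)).
have [T hT] := IH (fun r => F r.+1) (fun r h => F0 r.+1 h).
have [T' hT'] := vmode_trunc (F 0%N) v.
exists (`|T| + `|T'|)%:Z => -[|r] n h; [apply: hT'; lia|apply: hT; lia].
Qed.

(** The inner mode vanishes unless k + i' is small; this leaves finitely many vectors, which have a
    common truncation bound for the outer mode. *)
Lemma vmode2_trunc a b v p q : exists N : nat, forall k i i' : nat,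
  [|| N <= k, N <= i | N <= i']%N ->
  vmode a (p - k%:Z + i%:Z) (vmode b (q + k%:Z + i'%:Z) v) = 0.
Proof.
have [N bN] := vmode_trunc_nat b v q.
have bN' (r : nat) : (N <= r)%N -> vmode b (q + r%:Z) v = 0.
  by move=> Nr; apply: bN; lia.
have [T aT] := vmode_trunc_family a (F := fun r => vmode b (q + r%:Z) v) (N := N)
  bN'.
exists (N + `|T - p|)%N => k i i' h.
case: (leqP N (k + i')%N) => [hk|hk].
  by rewrite (bN (q + k%:Z + i'%:Z)) ?(lin0 (vmode_linr _ _)) //; lia.
rewrite (_ : q + k%:Z + i'%:Z = q + (k + i')%N%:Z) ?aT //; lia.
Qed.

Lemma vmode_iter_trunc a b v l p : exists N : nat, forall k i i' : nat,
  [|| N <= k, N <= i | N <= i']%N ->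
  vmode (vmode a (l + k%:Z) b) (p - k%:Z + i%:Z + i'%:Z) v = 0.
Proof.
have [N bN] := vmode_trunc_nat a b l.
have bN' (r : nat) : (N <= r)%N -> vmode a (l + r%:Z) b = 0.
  by move=> Nr; apply: bN; lia.
have [T aT] := vmode_trunc_familyl v (F := fun r => vmode a (l + r%:Z) b) (N := N)
  bN'.
exists (N + `|T - p|)%N => k i i' h.
case: (leqP N k) => [hk|hk].
  by rewrite (bN (l + k%:Z)) ?(lin0 (vmode_linl _ _)) //; lia.
by rewrite aT //; lia.
Qed.

(* Res_y (1 + y)^x y^p Y(a, y) b *)
Definition vop a x p b : V := \sum_(i \in [set: nat]) gbin x i *: vmode a (p + i%:Z) b.

Lemma vopE N a x p b : (forall i : nat, (N <= i)%N -> vmode a (p + i%:Z) b = 0) ->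
  vop a x p b = \sum_(i < N) gbin x i *: vmode a (p + i%:Z) b.
Proof. by move=> h; apply: nsumE => k /h->; rewrite scaler0. Qed.

Lemma vop_trunc a b p : exists N : nat, forall (k : nat), (N <= k)%N ->
  vmode a (p + k%:Z) b = 0.
Proof. by have [N h] := vmode_trunc_nat a b p; exists N => k Nk; apply: h; lia. Qed.

Lemma vop_linr a x p : linear (vop a x p).
Proof.
move=> k u v; have [N hN] := vop_trunc a u p; have [M hM] := vop_trunc a v p.
have h w : (forall i : nat, (N <= i)%N -> vmode a (p + i%:Z) w = 0) \/
     (forall i : nat, (M <= i)%N -> vmode a (p + i%:Z) w = 0) -> 
     forall i : nat, (N + M <= i)%N -> vmode a (p + i%:Z) w = 0.
  by case=> h i hi; apply: h; lia.
have hu := h u (or_introl hN); have hv := h v (or_intror hM).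
rewrite !(vopE (N := (N + M)%N)) //; last first.
  by move=> i hi; rewrite vmode_linr hu // hv // scaler0 addr0.
rewrite scaler_sumr -big_split; apply: eq_bigr => i _ /=.
by rewrite vmode_linr scalerDr !scalerA mulrC.
Qed.

Lemma vop_linl x p b : linear (fun a => vop a x p b).
Proof.
move=> k u v /=; have [N hN] := vop_trunc u b p; have [M hM] := vop_trunc v b p.
have hu (i : nat) : (N + M <= i)%N -> vmode u (p + i%:Z) b = 0 by move=> h; apply: hN; lia.
have hv (i : nat) : (N + M <= i)%N -> vmode v (p + i%:Z) b = 0 by move=> h; apply: hM; lia.
have huv (i : nat) : (N + M <= i)%N -> vmode (k *: u + v) (p + i%:Z) b = 0.
  by move=> h; rewrite vmode_addl hu // hv // scaler0 addr0.
rewrite (vopE _ hu) (vopE _ hv) (vopE _ huv).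
rewrite scaler_sumr -big_split; apply: eq_bigr => i _ /=.
by rewrite vmode_addl scalerDr !scalerA mulrC.
Qed.

Lemma vop_eq0 a x p b : (forall i : nat, vmode a (p + i%:Z) b = 0) -> vop a x p b = 0.
Proof. by move=> h; rewrite (vopE (N := 0)) ?big_ord0. Qed.

Lemma vop_shift N a x y p b : (forall i : nat, (N <= i)%N -> vmode a (p + i%:Z) b = 0) ->
  vop a (x + y) p b = \sum_(k < N) gbin y k *: vop a x (p + k%:Z) b.
Proof.
move=> h; rewrite (vopE _ h).
rewrite [RHS](eq_bigr (fun k : 'I_N => \sum_(i < N) (gbin y k * gbin x i) *: vmode a (p + (k + i)%N%:Z) b)).
  rewrite (cauchy_sum (R := N) _ _ (A := fun r => vmode a (p + r%:Z) b)) //.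
by apply: eq_bigr => r _; rewrite gbin_vandermonde [y + x]addrC.
move=> k _; rewrite (vopE (N := N)); last first.
  by move=> i hi; rewrite -addrA -PoszD h //; lia.
rewrite scaler_sumr; apply: eq_bigr => i _.
by rewrite scalerA -addrA -PoszD.
Qed.

Lemma vop_pascal a x p b : vop a (x + 1) p b = vop a x (p + 1) b + vop a x p b.
Proof.
have [N h] := vop_trunc a b p.
have h' (i : nat) : (N.+2 <= i)%N -> vmode a (p + i%:Z) b = 0 by move=> hi; apply: h; lia.
rewrite (vop_shift _ _ h') !big_ord_recl big1 => [|i _].
  by rewrite gbin0 gbin1 !scale1r addr0 addr0 addrC.
rewrite -[1]/(1%:R) gbin_nat bin_small ?scale0r //.
Qed.

(** The Jacobi identity integrated against (1 + y1)^al y1^p (1 + y2)^be y2^q. In the iterate y1 = y2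
    + y0: the factor C(al, k - w) comes from expanding (1 + y2 + y0)^al and C(p, w) from (y2 +
    y0)^p. A single bound N0 covers all the truncated sums. *)
Theorem vop_borcherds i j a b v (al be : K) (l p q : int) : par i a -> par j b ->
  exists N0, forall N, (N0 <= N)%N ->
  (\sum_(k < N) ((-1) ^+ k * gbin l%:~R k) *:
      vop a al (p + l - k%:Z) (vop b be (q + k%:Z) v))
  - (-1) ^+ (i && j) *:
    (\sum_(k < N) ((-1) ^ (l - k%:Z) * gbin l%:~R k) *:
      vop b be (q + l - k%:Z) (vop a al (p + k%:Z) v))
  = \sum_(k < N) \sum_(w < k.+1) (gbin al (k - w) * gbin p%:~R w) *:
      vop (vmode a (l + k%:Z) b) (al + be - (k - w)%:R) (p + q - w%:Z) v.
Proof.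
move=> pa pb.
have [N1 h1] := vmode2_trunc a b v (p + l) q.
have [N2 h2] := vmode2_trunc b a v (q + l) p.
have [N3 h3] := vmode_iter_trunc a b v l (p + q).
have [N4 h4] := vop_trunc b v q.
have [N5 h5] := vop_trunc a v p.
exists (N1 + N2 + N3 + N4 + N5)%N => N hN.
have double c d (x y : K) (r r' : int) M M' :
    (forall k i i' : nat, [|| M <= k, M <= i | M <= i']%N ->
       vmode c (r - k%:Z + i%:Z) (vmode d (r' + k%:Z + i'%:Z) v) = 0) ->
    (forall k : nat, (M' <= k)%N -> vmode d (r' + k%:Z) v = 0) -> (M + M' <= N)%N ->
    forall k : nat, vop c x (r - k%:Z) (vop d y (r' + k%:Z) v) =
     \sum_(e < N) \sum_(e' < N) (gbin x e * gbin y e') *: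
       vmode c (r - k%:Z + e%:Z) (vmode d (r' + k%:Z + e'%:Z) v).
  move=> hM hd MN k; rewrite (vopE (N := N) (a := d)); last first.
    by move=> e he; rewrite -addrA -PoszD hd //; lia.
  rewrite (lin_sum (vop_linr _ _ _)) exchange_big /=; apply: eq_bigr => e' _.
  rewrite (linZ (vop_linr _ _ _)) (vopE (N := N)) => [|e he]; last by apply: hM; lia.
  by rewrite scaler_sumr; apply: eq_bigr => e _; rewrite scalerA mulrC.
(* For each pair (e, e') the bracket is the Jacobi identity with m = p + e and n = q + e'. *)
transitivity (\sum_(e < N) \sum_(e' < N) (gbin al e * gbin be e') *:
   ((\sum_(k < N) ((-1) ^+ k * gbin l%:~R k) *:
      vmode a (p + e%:Z + l - k%:Z) (vmode b (q + e'%:Z + k%:Z) v))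
  - (-1) ^+ (i && j) *:
    (\sum_(k < N) ((-1) ^ (l - k%:Z) * gbin l%:~R k) *:
      vmode b (q + e'%:Z + l - k%:Z) (vmode a (p + e%:Z + k%:Z) v)))).
  under [in RHS]eq_bigr do under eq_bigr do rewrite scalerBr.
  under [in RHS]eq_bigr do rewrite sumrB.
  rewrite [RHS]sumrB; congr (_ - _).
    transitivity (\sum_(k < N) ((-1) ^+ k * gbin l%:~R k) *:
      \sum_(e < N) \sum_(e' < N) (gbin al e * gbin be e') *:
       vmode a (p + l - k%:Z + e%:Z) (vmode b (q + k%:Z + e'%:Z) v)).
      apply: eq_bigr => k _; congr (_ *: _); apply: (double _ _ _ _ _ _ N1 N4) => //; lia.
    rewrite (exchange_sum3 N (fun k => (-1) ^+ k * gbin l%:~R k)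
      (fun e e' => gbin al e * gbin be e')
      (fun k e e' => vmode a (p + l - k%:Z + e%:Z) (vmode b (q + k%:Z + e'%:Z) v))).
    apply: eq_bigr => e _; apply: eq_bigr => e' _.
    congr (_ *: _); apply: eq_bigr => k _; congr (_ *: vmode _ _ (vmode _ _ _)); lia.
  transitivity (\sum_(e < N) \sum_(e' < N) (gbin be e * gbin al e') *:
     ((-1) ^+ (i && j) *: \sum_(k < N) ((-1) ^ (l - k%:Z) * gbin l%:~R k) *:
       vmode b (q + l - k%:Z + e%:Z) (vmode a (p + k%:Z + e'%:Z) v))).
    under [in RHS]eq_bigr do under eq_bigr do rewrite scalerA [X in X *: _]mulrC -scalerA.
    under [in RHS]eq_bigr do rewrite -scaler_sumr.
    rewrite -scaler_sumr -(exchange_sum3 N (fun k => (-1) ^ (l - k%:Z) * gbin l%:~R k)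
      (fun e e' => gbin be e * gbin al e')
      (fun k e e' => vmode b (q + l - k%:Z + e%:Z) (vmode a (p + k%:Z + e'%:Z) v))).
    congr (_ *: _).
    apply: eq_bigr => k _; congr (_ *: _); apply: (double _ _ _ _ _ _ N2 N5) => //; lia.
  rewrite exchange_big /=; apply: eq_bigr => e _; apply: eq_bigr => e' _.
  rewrite mulrC; congr (_ *: (_ *: _)); apply: eq_bigr => k _.
  congr (_ *: vmode _ _ (vmode _ _ _)); lia.
transitivity (\sum_(e < N) \sum_(e' < N) (gbin al e * gbin be e') *:
   \sum_(k < N) gbin (p + e%:Z)%:~R k *:
      vmode (vmode a (l + k%:Z) b) (p + q - k%:Z + e%:Z + e'%:Z) v).
  apply: eq_bigr => e _; apply: eq_bigr => e' _; congr (_ *: _).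
  have := borcherds v l (p + e%:Z) (q + e'%:Z) pa pb.
  rewrite !(nsumE (N := N)).
  - move=> ->; apply: eq_bigr => k _; congr (_ *: vmode _ _ _); lia.
  - move=> k hk; rewrite (_ : p + _ + _ - _ = p + q - k%:Z + e%:Z + e'%:Z); last lia.
    by rewrite h3 ?scaler0 //; lia.
  - move=> k hk; rewrite (_ : q + _ + _ - _ = q + l - k%:Z + e'%:Z); last lia.
    rewrite (_ : p + _ + _ = p + k%:Z + e%:Z); last lia.
    by rewrite h2 ?scaler0 //; lia.
  - move=> k hk; rewrite (_ : q + _ + _ = q + k%:Z + e'%:Z); last lia.
    rewrite (_ : p + _ + _ - _ = p + l - k%:Z + e%:Z); last lia.
    by rewrite h1 ?scaler0 //; lia.
under eq_bigr do under eq_bigr do rewrite scaler_sumr.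
under eq_bigr do rewrite exchange_big /=.
rewrite exchange_big /=; apply: eq_bigr => k _.
set c := vmode a (l + k%:Z) b.
pose A r := vmode c (p + q - k%:Z + r%:Z) v.
have A0 r : (N3 <= r)%N -> A r = 0.
  by move=> hr; rewrite /A -[X in vmode _ X]addr0 addrAC h3 // hr !orbT.
(* C(p + e, k) is split into the products C(p, w) C(e, k - w). The sum over e then represents the
   derivative of order k - w of (1 + y2)^al, up to a factorial and a power of y2. *)
transitivity (\sum_(e < N) \sum_(e' < N)
  \sum_(w < k.+1) (gbin p%:~R w * (gbin al e * gbin e%:R (k - w) * gbin be e')) *: A (e + e')%N).
  apply: eq_bigr => e _; apply: eq_bigr => e' _.
  rewrite (_ : _ - _ + _ + _ = p + q - k%:Z + (e + e')%N%:Z); last lia.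
  rewrite -/(A _) scalerA -scaler_suml; congr (_ *: _).
  rewrite rmorphD /= -pmulrn -gbin_vandermonde mulr_sumr; apply: eq_bigr => w _.
  ring.
under [LHS]eq_bigr do rewrite exchange_big /=.
rewrite exchange_big /=; apply: eq_bigr => w _; set u := (k - w)%N.
have uw : (u + w)%N = k :> nat by rewrite subnK // -ltnS.
under [LHS]eq_bigr do under eq_bigr do rewrite -scalerA.
under [LHS]eq_bigr do rewrite -scaler_sumr.
rewrite -scaler_sumr.
rewrite (cauchy_sum (R := N3) (fun e => gbin al e * gbin e%:R u) (gbin be)) //; [|lia|lia].
pose B r := (\sum_(i < r.+1) gbin al i * gbin i%:R u * gbin be (r - i)) *: A r.
(* The range is padded to u + N3 so that the first u terms, zero because C(i, u) = 0 for i < u, can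
   be split off. *)
rewrite -[X in _ *: X](@ord_widen _ N3 (u + N3) B) ?leq_addl //; last first.
  by move=> r /A0; rewrite /B => ->; rewrite scaler0.
rewrite big_split_ord /= big1 ?add0r => [|r _]; last first.
  rewrite /B big1 ?scale0r // => e _; rewrite gbin_nat_small ?mulr0 ?mul0r //.
  by rewrite (leq_trans (ltn_ord e)).
rewrite [gbin al u * _]mulrC -[in RHS]scalerA (vopE (N := N3)); last first.
  move=> r hr; have := A0 (u + r)%N; rewrite /A => <-; last lia.
  by congr (vmode _ _ _); lia.
congr (_ *: _); rewrite scaler_sumr; apply: eq_bigr => r _.
rewrite /B gbin_vandermonde_shift scalerA; congr (_ *: vmode _ _ _); lia.
Qed.
End Modes.

Lemma nsum1 (U : zmodType) (F : nat -> U) :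
  (forall k, F k.+1 = 0) -> \sum_(k \in [set: nat]) F k = F 0%N.
Proof. by move=> F0; rewrite (nsumE (N := 1)) ?big_ord1 // => -[]. Qed.

Lemma nsum2 (U : zmodType) (F : nat -> U) :
  (forall k, F k.+2 = 0) -> \sum_(k \in [set: nat]) F k = F 0%N + F 1%N.
Proof.
move=> F0; rewrite (nsumE (N := 2)) => [|[|[]] //].
by rewrite big_ord_recr big_ord1.
Qed.

(** * Weights of modes, and residues normalized by the weight *)

Section ConformalWeights.
Variables (K : numFieldType) (V : svoa K).
Implicit Types (a b c v : V) (i j : bool) (s t : rat) (l m n p q x y : int).

Lemma gbin0l k : gbin (0 : K) k = (k == 0%N)%:R.
Proof. by rewrite -[0]/(0%:R) gbin_nat bin0n. Qed.

Lemma commutator_formula i j a b v m n : par i a -> par j b ->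
  vmode a m (vmode b n v) - (-1) ^+ (i && j) *: vmode b n (vmode a m v) =
  \sum_(k \in [set: nat]) gbin m%:~R k *: vmode (vmode a k%:Z b) (m + n - k%:Z) v.
Proof.
move=> pa pb; have := borcherds v 0 m n pa pb.
rewrite nsum1 => [|k]; last by rewrite gbin0l mulr0 scale0r.
rewrite nsum1 => [|k]; last by rewrite gbin0l mulr0 scale0r.
rewrite gbin0 !mulr1 !subr0 expr0 !scale1r.
move=> ->; apply: eq_fsbigr => k _.
by rewrite add0r.
Qed.

(** Mode 0 of [conf] is L_(-1) and mode 1 is L_0. For m = 0 only the k = 0 term of the commutator
    formula survives; for m = 1, in the next lemma, k = 0 and k = 1 do. *)
Lemma conf0_comm j b v n : par j b ->
  vmode (conf V) 0 (vmode b n v) = vmode b n (vmode (conf V) 0 v) - n%:~R *: vmode b (n - 1) v.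
Proof.
move=> pb; apply/eqP; rewrite -subr_eq0 opprD addrA opprK; apply/eqP.
have := commutator_formula v 0 n (conf_par V) pb.
rewrite nsum1 => [|k]; last by rewrite gbin0l scale0r.
rewrite gbin0 expr0 !scale1r subr0 add0r => ->.
have := vderiv b n v; rewrite /virL addNr => ->.
by rewrite scaleNr addNr.
Qed.

Lemma conf1_comm j t b v n : homog j t b ->
  vmode (conf V) 1 (vmode b n v) =
  vmode b n (vmode (conf V) 1 v) + (ratr t - n%:~R - 1) *: vmode b n v.
Proof.
move=> [pb wb _].
have := commutator_formula v 1 n (conf_par V) pb.
rewrite nsum2 => [|k]; last first.
  by rewrite -[1%:~R]/(1%:R) gbin_nat_small ?scale0r.
rewrite gbin0 gbin1 expr0 !scale1r => /eqP; rewrite subr_eq => /eqP ->.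
rewrite addrC; congr (_ + _); rewrite subr0.
have := vderiv b (1 + n) v; rewrite /virL addNr => ->.
have : vmode (conf V) 1 b = ratr t *: b by exact: wb.
move=> ->; rewrite (linZ (vmode_linl _ _)).
rewrite (_ : 1 + n - 1 = n); last lia.
rewrite -scalerDl; congr (_ *: _); rewrite rmorphD /=; ring.
Qed.

Lemma homog_conf : homog false 2 (conf V).
Proof. by split; [exact: conf_par|exact: conf_wt|exists 2; rewrite /qhalf mul0r addr0]. Qed.

Lemma homog_vac : homog false 0 (vac V).
Proof.
split; [exact: vac_par| |by exists 0; rewrite /qhalf mul0r addr0].
by rewrite /wtsp /= /virL add0r vac_trunc // rmorph0 scale0r.
Qed.

Lemma homog_vmode i j s t a b n : homog i s a -> homog j t b ->
  homog (i (+) j) (s + t - n%:~R - 1) (vmode a n b).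
Proof.
move=> ha hb; have [pa wa sa] := ha; have [pb wb tb] := hb; split.
- exact: par_vmode.
- rewrite /wtsp /= /virL add0r (conf1_comm b n ha).
  have -> : vmode (conf V) 1 b = ratr t *: b by exact: wb.
  rewrite (linZ (vmode_linr _ _)) -scalerDl; congr (_ *: _).
  rewrite !rmorphB rmorphD /= ratr_int rmorph1; ring.
- have := hcosetD (- n - 1) sa tb; congr (hcoset _ _).
  by rewrite rmorphB rmorphN /= addrA.
Qed.

Lemma homog_conf0 i s a : homog i s a -> homog i (s + 1) (vmode (conf V) 0 a).
Proof.
by move=> ha; have := homog_vmode 0 homog_conf ha; congr (homog _ _ _); rewrite subr0; ring.
Qed.

(** Integration by parts, since Y(L_(-1) a, y) is the derivative of Y(a, y). *)
Lemma vop_conf0 a (x : K) p b :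
  vop (vmode (conf V) 0 a) x p b = - (x *: vop a (x - 1) p b) - p%:~R *: vop a x (p - 1) b.
Proof.
have [N h] := vmode_trunc_nat a b (p - 1).
rewrite !(vopE (N := N.+1)).
- rewrite (eq_bigr (fun i : 'I_N.+1 => - (i%:R * gbin x i) *: vmode a (p - 1 + i%:Z) b
        - (p%:~R * gbin x i) *: vmode a (p - 1 + i%:Z) b)); last first.
    move=> i _; have := vderiv a (p + i%:Z) b; rewrite /virL addNr => ->.
    rewrite (_ : p + _ - 1 = p - 1 + i%:Z); last lia.
    rewrite scalerA -scalerBl; congr (_ *: _); rewrite rmorphD /=; ring.
  rewrite sumrB; congr (_ - _); last first.
    by rewrite scaler_sumr; apply: eq_bigr => i _; rewrite scalerA.
  rewrite big_ord_recl mul0r oppr0 scale0r add0r big_ord_recr /= h; last lia.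
  rewrite scaler0 addr0 scaler_sumr -sumrN; apply: eq_bigr => i _.
  rewrite /bump /= add1n gbinS scalerA -scaleNr.
  rewrite (_ : p - 1 + i.+1%:Z = p + i%:Z); last lia.
  congr (_ *: _).
  have := @gbin_sym K x 1 i; rewrite !gbin1 => ->; ring.
- by move=> i hi; apply: h; lia.
- by move=> i hi; apply: h; lia.
- move=> i hi; have := vderiv a (p + i%:Z) b; rewrite /virL addNr => ->.
  by rewrite h ?scaler0 //; lia.
Qed.

Lemma vop_vacl (x : K) b : vop (vac V) x (-1) b = b.
Proof.
rewrite /vop nsum1 => [|i]; last by rewrite vac_mode; case: eqP; [lia|rewrite scaler0].
by rewrite gbin0 scale1r addr0 vac_mode eqxx.
Qed.

Lemma vop_vacr a (x : K) : vop a x (-1) (vac V) = a.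
Proof.
rewrite /vop nsum1 => [|i]; last by rewrite vac_trunc ?scaler0 //; lia.
by rewrite gbin0 scale1r addr0 vac_create.
Qed.

(* For [a] of weight [s], the residue at [z = 1] of
   [z^(s - 1 + x) (z - 1)^p Y(a, z - 1) b dz]. *)
Definition wop s a x p b : V := vop a (ratr s - 1 + x%:~R) p b.

(** One factor z of the integrand is written as (z - 1) + 1. *)
Lemma wop_pascal s a x p b : wop s a (x + 1) p b = wop s a x (p + 1) b + wop s a x p b.
Proof. by rewrite /wop rmorphD /= addrA vop_pascal. Qed.

Lemma wop_linr s a x p : linear (wop s a x p). Proof. exact: vop_linr. Qed.

Lemma wop_linl s x p b : linear (fun a => wop s a x p b). Proof. exact: vop_linl. Qed.

(** This is where the shift s - 1 pays off: a_(l+k) b has weight s + t - (l + k) - 1, so the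
    exponent of z in the iterate is again weight - 1 plus an integer, and that integer x + y + l + w
    does not involve k. *)
Lemma wop_borcherds i j s t a b v (l x y p q : int) : homog i s a -> homog j t b ->
  exists N0, forall N, (N0 <= N)%N ->
  (\sum_(k < N) ((-1) ^+ k * gbin l%:~R k) *:
      wop s a x (p + l - k%:Z) (wop t b y (q + k%:Z) v))
  - (-1) ^+ (i && j) *:
    (\sum_(k < N) ((-1) ^ (l - k%:Z) * gbin l%:~R k) *:
      wop t b y (q + l - k%:Z) (wop s a x (p + k%:Z) v))
  = \sum_(k < N) \sum_(w < k.+1) (gbin (ratr s - 1 + x%:~R) (k - w) * gbin p%:~R w) *:
      wop (s + t - (l + k%:Z)%:~R - 1) (vmode a (l + k%:Z) b) (x + y + l + w%:Z)
        (p + q - w%:Z) v.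
Proof.
move=> [pa _ _] [pb _ _].
have [N0 h] := vop_borcherds v (ratr s - 1 + x%:~R) (ratr t - 1 + y%:~R) l p q pa pb.
exists N0 => N /h ->; apply: eq_bigr => k _; apply: eq_bigr => w _.
congr (_ *: _); rewrite /wop; congr (vop _ _ _ _).
have wk : (w <= k)%N by rewrite -ltnS.
rewrite natrB // !rmorphB rmorphD /= ratr_int rmorph1 !rmorphD /= -!pmulrn; ring.
Qed.

Lemma wop_commutator i j s t a b v x y p q : homog i s a -> homog j t b ->
  exists N,
  wop s a x p (wop t b y q v) - (-1) ^+ (i && j) *: wop t b y q (wop s a x p v)
  = \sum_(k < N) \sum_(r < k.+1) (gbin (ratr s - 1 + x%:~R) (k - r) * gbin p%:~R r) *:
      wop (s + t - k%:R - 1) (vmode a k%:Z b) (x + y + r%:Z) (p + q - r%:Z) v.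
Proof.
move=> ha hb; have [N0 hN0] := wop_borcherds v 0 x y p q ha hb.
exists N0.+1; have := hN0 N0.+1 (leqnSn _).
rewrite big_ord_recl big1 => [|k _]; last by rewrite gbin0l mulr0 scale0r.
rewrite big_ord_recl [X in _ *: (_ + X)]big1 => [|k _]; last first.
  by rewrite gbin0l mulr0 scale0r.
rewrite gbin0 !mulr1 expr0 !scale1r !addr0 => ->.
apply: eq_bigr => k _; apply: eq_bigr => r _.
by rewrite add0r.
Qed.

End ConformalWeights.

(** * The twisted Zhu algebra *)

Section ZhuAlgebra.
Variables (K : numFieldType) (V : svoa K).
Implicit Types (a b c u v : V) (i j : bool) (s t : rat) (l m n p q x y : int) (r : nat).

Lemma tres_ext r a b :
  tres r a b = lin_ext (@wtsp K V) (fun s a => vop a (ratr s) (- r%:Z) b) a.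
Proof.
apply: eq_fsbigr => s _; apply: eq_fsbigr => k _.
by rewrite addrC.
Qed.

Lemma tres_linl r b : linear (fun a => tres r a b).
Proof.
move=> k u v; rewrite !tres_ext.
by apply: lin_ext_linear => [|s]; [exact: wt_direct|exact: vop_linl].
Qed.

Lemma tres_wt s r a b : wtsp s a -> tres r a b = vop a (ratr s) (- r%:Z) b.
Proof.
move=> wa; rewrite tres_ext (lin_extE _ _ wa) //; first exact: wt_direct.
by move=> t; apply: vop_linl.
Qed.

(** In the coordinates (x, p), the product *_t is (1, -1) and the generators of O_t(V) are (1,
    -2). *)
Lemma tres_wop i s r a b : homog i s a -> tres r a b = wop s a 1 (- r%:Z) b.
Proof. by case=> _ wa _; rewrite (tres_wt _ _ wa) /wop subrK. Qed.

Lemma tres_linr r a : linear (tres r a).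
Proof.
move=> k u v; move: a; apply: homog_ind => [|i s a ha].
  split=> [|k' a b /= ha hb]; first by rewrite !(lin0 (tres_linl _ _)) scaler0 addr0.
  by rewrite !(tres_linl r _ k' a b) ha hb !scalerDr !scalerA [k' * k]mulrC addrACA.
by rewrite !(tres_wop _ _ ha) wop_linr.
Qed.

Lemma Ot_tcirc a b : Ot (tcirc a b).
Proof.
exists 1%N, (fun=> 1), (fun=> tcirc a b); split; first by exists a, b.
by rewrite big_ord1 scale1r.
Qed.

(** For x = 1, p descends from -2: the induction hypothesis is applied to L_(-1) a and integrated by
    parts. Larger x reduces to x = 1 by [wop_pascal], which respects x + p <= -1. *)
Lemma Ot_wop i s a b x p : homog i s a -> 1 <= x -> x + p <= -1 -> Ot (wop s a x p b).
Proof.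
have sO := Ot_subspace V.
have wop1 (m : nat) : forall i s a, homog i s a -> Ot (wop s a 1 (- 2 - m%:Z) b).
  elim: m => [|m IH] {}i {}s {}a ha.
    by rewrite subr0 -(tres_wop 2 _ ha); apply: Ot_tcirc.
  have := IH _ _ _ (homog_conf0 ha).
  rewrite /wop vop_conf0 (_ : ratr (s + 1) - 1 + 1%:~R = ratr s + 1 :> K); last first.
    by rewrite rmorphD /= rmorph1; ring.
  rewrite addrK (_ : - 2 - m%:Z - 1 = - 2 - m.+1%:Z); last lia.
  have e := vop_pascal a (ratr s) (- 2 - m.+1%:Z) b.
  rewrite (_ : - 2 - m.+1%:Z + 1 = - 2 - m%:Z) in e; last lia.
  have h1 := IH _ _ _ ha; rewrite /wop subrK in h1 *.
  rewrite {}e; set A := vop a (ratr s) (- 2 - m%:Z) b in h1 *.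
  set B := vop a _ _ b; set k := (- 2 - m%:Z)%:~R.
  rewrite scalerDr (opprD (k *: A)) addrA -(opprD _ (k *: A)) -scalerDl => h2.
  (* The new residue B has the coefficient -k with k = -2 - m, nonzero in characteristic 0. *)
  have := subZ sO (- k)^-1 (subD sO h2 (subZ sO (ratr s + 1 + k) h1)).
  rewrite addrAC addNr add0r -scaleNr scalerA mulVf ?scale1r // oppr_eq0 intr_eq0; lia.
case: x => [[//|n]|//] ha _; elim: n p => [|n IH] p hp.
  have -> : p = - 2 - (absz (- 2 - p)%R)%:Z by lia.
  exact: wop1 ha.
rewrite (_ : n.+2%:Z = n.+1%:Z + 1); last lia.
by rewrite wop_pascal; apply: (subD sO); apply: IH; lia.
Qed.

(* The iterate formula at [p = 0] turns a product of modes into [(a_l b) * c]. *)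
Lemma tstar_tres i j s t a b c (r : nat) : homog i s a -> homog j t b -> (0 < r)%N ->
  Ot (tstar (tres r a b) c - wop s a 1 (- r%:Z) (wop t b r%:Z (-1) c)).
Proof.
move=> ha hb r_gt0; have sO := Ot_subspace V.
(* Taking y = r cancels l = -r in x + y + l, so the iterates keep the exponent 1 of *_t; p = 0
   leaves only w = 0. *)
have [N0 hN0] := wop_borcherds c (- r%:Z) 1 r%:Z 0 (-1) ha hb.
have [N1 hN1] := vop_trunc a b (- r%:Z).
have := hN0 (N0 + N1).+1 ltac:(lia); set N := (N0 + N1).+1.
have -> : \sum_(k < N) \sum_(w < k.+1) (gbin (ratr s - 1 + 1%:~R) (k - w) * gbin (0%:~R : K) w) *:
      wop (s + t - (- r%:Z + k%:Z)%:~R - 1) (vmode a (- r%:Z + k%:Z) b) (1 + r%:Z - r%:Z + w%:Z)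
        (0 - 1 - w%:Z) c = tstar (tres r a b) c.
  rewrite (tres_wop _ _ ha) /wop (vopE (N := N)); last by move=> k hk; apply: hN1; lia.
  rewrite /tstar (lin_sum (tres_linl 1 c)); apply: eq_bigr => k _.
  rewrite big_ord_recl /= big1 ?addr0 => [|w _]; last by rewrite gbin0l mulr0 scale0r.
  rewrite gbin0 mulr1 subn0 (linZ (tres_linl 1 c)); congr (_ *: _).
  rewrite (tres_wop _ _ (homog_vmode (- r%:Z + k%:Z) ha hb)).
  rewrite /wop; congr (vop _ (_ + _%:~R) _ _); rewrite /=; lia.
move=> <-; rewrite big_ord_recl /= gbin0 mulr1 expr0 scale1r subr0 addr0 add0r.
rewrite -!addrA addrC -!addrA addNr addr0.
(* In the first sum the exponents (1, -r-k) with k >= 1, in the second the exponents (r, -1-r-k)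
   with any k, add up to at most -1. *)
apply: (subD sO).
  apply: (sub_sum sO) => k _; apply: (subZ sO); apply: (Ot_wop _ ha) => //.
  rewrite /bump /=; lia.
apply: (subN sO); apply: (subZ sO); apply: (sub_sum sO) => k _; apply: (subZ sO).
by apply: (Ot_wop _ hb); lia.
Qed.

(** For r = 2 the main term in [tstar_tres] is itself of the form a o_t b'. *)
Lemma Ot_tstar_tcircl a b c : Ot (tstar (tcirc a b) c).
Proof.
have sO := Ot_subspace V.
have lin_b b' : linear (fun a => tstar (tcirc a b') c).
  by move=> k u v; rewrite /tstar /tcirc !(tres_linl 2) (tres_linl 1).
have lin_a a' : linear (fun b => tstar (tcirc a' b) c).
  by move=> k u v; rewrite /tstar /tcirc !tres_linr (tres_linl 1).
have sub_lin (f : V -> V) : linear f -> subspace [set u | Ot (f u)].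
  by move=> lf; apply: sub_preim.
move: a; apply: homog_ind => [|i s a ha]; first exact: sub_lin.
move: b; apply: homog_ind => [|j t b hb]; first exact: sub_lin.
have := tstar_tres c ha hb (isT : 0 < 2)%N; rewrite /tcirc.
have : Ot (wop s a 1 (- 2%:Z) (wop t b 2%:Z (-1) c)) by apply: (Ot_wop _ ha).
by move=> h1 h2; have := subD sO h2 h1; rewrite subrK.
Qed.

(** Moving a past b gives b o_t (a *_t c) up to sign, and every commutator term has exponents with
    sum -1. *)
Lemma Ot_tstar_tcircr a b c : Ot (tstar a (tcirc b c)).
Proof.
have sO := Ot_subspace V.
have lin_a b' : linear (fun a => tstar a (tcirc b' c)) by exact: tres_linl.
have lin_b a' : linear (fun b => tstar a' (tcirc b c)).
  by move=> k u v; rewrite /tstar /tcirc !(tres_linl 2) tres_linr.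
have sub_lin (f : V -> V) : linear f -> subspace [set u | Ot (f u)].
  by move=> lf; apply: sub_preim.
move: a; apply: homog_ind => [|i s a ha]; first exact: sub_lin.
move: b; apply: homog_ind => [|j t b hb]; first exact: sub_lin.
rewrite /tstar /tcirc (tres_wop _ _ ha) (tres_wop _ _ hb).
have [N] := wop_commutator c 1 1 (-1) (-2) ha hb.
move=> /eqP; rewrite subr_eq => /eqP e; rewrite [X in Ot X]e; apply: (subD sO).
  apply: (sub_sum sO) => k _; apply: (sub_sum sO) => r _; apply: (subZ sO).
  by apply: (Ot_wop _ (homog_vmode k%:Z ha hb)); lia.
by apply: (subZ sO); apply: (Ot_wop _ hb); lia.
Qed.

Lemma Ot_tstarl u b : Ot u -> Ot (tstar u b).
Proof.
move=> [n [c [x [hx ->]]]]; rewrite /tstar (lin_sum (tres_linl 1 b)).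
apply: (sub_sum (Ot_subspace V)) => k _; rewrite (linZ (tres_linl 1 b)).
apply: (subZ (Ot_subspace V)); have [a [a' ->]] := hx k.
exact: Ot_tstar_tcircl.
Qed.

Lemma Ot_tstarr a u : Ot u -> Ot (tstar a u).
Proof.
move=> [n [c [x [hx ->]]]]; rewrite /tstar (lin_sum (tres_linr 1 a)).
apply: (sub_sum (Ot_subspace V)) => k _; rewrite (linZ (tres_linr 1 a)).
apply: (subZ (Ot_subspace V)); have [b [b' ->]] := hx k.
exact: Ot_tstar_tcircr.
Qed.

Lemma zcl_lin : linear (@zcl K V).
Proof. by move=> k u v; rewrite /zcl qprojD qprojZ. Qed.

Lemma zcl_eq u v : zcl u = zcl v <-> Ot (u - v).
Proof. exact: qproj_eq. Qed.

Lemma zcl_eq0 u : Ot u -> zcl u = 0.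
Proof. by move=> hu; rewrite -(lin0 zcl_lin); apply/zcl_eq; rewrite subr0. Qed.

Lemma zmul_zcl a b : zmul (zcl a) (zcl b) = zcl (tstar a b).
Proof.
have sO := Ot_subspace V.
apply/zcl_eq; set a' := qrepr _; set b' := qrepr _.
have ha : Ot (a' - a) by apply/zcl_eq; rewrite /zcl qreprK.
have hb : Ot (b' - b) by apply/zcl_eq; rewrite /zcl qreprK.
have := subD sO (Ot_tstarl b' ha) (Ot_tstarr a hb).
by rewrite /tstar (linB (tres_linl 1 b')) (linB (tres_linr 1 a)) addrA subrK.
Qed.

Lemma zcl_surj (z : zhu V) : exists a, z = zcl a.
Proof. by exists (qrepr z); rewrite /zcl qreprK. Qed.

Lemma tstarA a b c : Ot (tstar (tstar a b) c - tstar a (tstar b c)).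
Proof.
have sO := Ot_subspace V.
have sub_lin (f : V -> V) : linear f -> subspace [set u | Ot (f u)].
  by move=> lf; apply: sub_preim.
move: a; apply: homog_ind => [|i s a ha].
  apply: (sub_lin (fun a => tstar (tstar a b) c - tstar a (tstar b c))) => k u v.
  by rewrite /tstar !(tres_linl 1) scalerBr opprD addrACA.
move: b; apply: homog_ind => [|j t b hb].
  apply: (sub_lin (fun b => tstar (tstar a b) c - tstar a (tstar b c))) => k u v.
  by rewrite /tstar !(tres_linr 1 a) !(tres_linl 1) (tres_linr 1 a) scalerBr opprD addrACA.
have := tstar_tres c ha hb (isT : 0 < 1)%N.
by rewrite /tstar (tres_wop _ _ ha) (tres_wop _ (tres 1 b c) ha) (tres_wop _ _ hb).
Qed.

Lemma tstar_vacl b : tstar (vac V) b = b.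
Proof. by rewrite /tstar (tres_wop _ _ (homog_vac V)) /wop vop_vacl. Qed.

Lemma tstar_vacr a : tstar a (vac V) = a.
Proof.
move: a; apply: homog_ind => [|i s a ha]; last first.
  by rewrite /tstar (tres_wop _ _ ha) /wop vop_vacr.
split=> [|k u v] /=; first exact: lin0 (tres_linl 1 _).
by rewrite /tstar (tres_linl 1) => -> ->.
Qed.

Lemma par_tres i j r a b : par i a -> par j b -> par (i (+) j) (tres r a b).
Proof.
move=> pa pb; have sP := par_subspace V (i (+) j).
move: a pa; apply: par_homog_ind => [|s a ha].
  split=> [|k u v hu hv] /=; first by rewrite (lin0 (tres_linl r b)); apply: sub0.
  by rewrite (tres_linl r b); apply: (proj2 sP).
have [N hN] := vop_trunc a b (- r%:Z).
have [pa _ _] := ha.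
rewrite (tres_wop _ _ ha) /wop (vopE _ hN); apply: (sub_sum sP) => k _.
by apply: (subZ sP); apply: par_vmode.
Qed.

(** O_t(V) is spanned by products of vectors of pure parity. This makes the sum of the two parity
    parts of A_t(V) direct. *)
Lemma Ot_component u i : Ot u -> Ot (component (@par K V) u i).
Proof.
have sO := Ot_subspace V; have dP := par_sum V.
move=> [n [c [x [hx ->]]]]; rewrite (lin_sum (component_lin dP i)).
apply: (sub_sum sO) => k _; rewrite (linZ (component_lin dP i)).
apply: (subZ sO); have [a [b ->]] := hx k => {hx}.
have sub_lin (f : V -> V) : linear f -> subspace [set u | Ot (component (@par K V) (f u) i)].
  move=> lf; split=> [|k' u' v' hu hv] /=.
    by rewrite (lin0 lf) (lin0 (component_lin dP i)); apply: sub0.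
  by rewrite lf (component_lin dP i); apply: (proj2 sO).
move: a; apply: (direct_sum_ind dP) => [|j a pa]; first exact/sub_lin/tres_linl.
move: b; apply: (direct_sum_ind dP) => [|j' b pb]; first exact/sub_lin/tres_linr.
rewrite /= (component_in dP (par_tres 2 pa pb)); case: eqP => _; last exact: sub0.
exact: Ot_tcirc.
Qed.

Lemma bool_sum (U : zmodType) (F : bool -> U) :
  \sum_(i \in [set: bool]) F i = F true + F false.
Proof. by rewrite (@fsum_seq _ _ [:: true; false]) ?big_cons ?big_nil ?addr0 // => -[]. Qed.

Lemma bool_decomposes (U : lmodType K) (P : bool -> set U) (w : U) f :
  decomposes P w f <-> (forall i, P i (f i)) /\ w = f true + f false.
Proof.
split=> [[_ Pf ->]|[Pf ->]]; first by rewrite bool_sum.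
by split; rewrite ?bool_sum //; apply/finite_support_seq; exists [:: true; false] => // -[].
Qed.

Lemma zhu_direct_sum : direct_sum setT (@zpar K V).
Proof.
have dP := par_sum V; have sO := Ot_subspace V.
have sZ i : subspace (@zpar K V i).
  split=> [|k _ _ [a pa ->] [b pb ->]].
    by exists 0; [apply: sub0; apply: par_subspace|rewrite (lin0 zcl_lin)].
  by exists (k *: a + b); [apply: (proj2 (par_subspace V i))|rewrite zcl_lin].
split=> // z _; have [a ->] := zcl_surj z.
exists (fun i => zcl (component (@par K V) a i)); split=> [|g].
  apply/bool_decomposes; split=> [i|].
    by exists (component (@par K V) a i) => //; apply: componentU.
  rewrite -(linD zcl_lin); congr zcl.
  by have /bool_decomposes[_ {1}->] := componentP dP a.
move=> /bool_decomposes[pg e]; apply: funext => i.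
have [b1 pb1 e1] := pg true; have [b0 pb0 e0] := pg false.
have /zcl_eq h : zcl a = zcl (b1 + b0) by rewrite e e1 e0 (linD zcl_lin).
have := Ot_component i h; rewrite (linB (component_lin dP i)).
rewrite (linD (component_lin dP i)) (component_in dP pb1) (component_in dP pb0).
move=> /zcl_eq ->; case: i => /=; rewrite ?addr0 ?add0r ?e1 ?e0 //.
Qed.

Theorem zhu_algebra : zhu_graded_algebra V.
Proof.
split.
- exact: zmul_zcl.
- move=> z k z1 z2; have [c ->] := zcl_surj z; have [a ->] := zcl_surj z1.
  have [b ->] := zcl_surj z2.
  by rewrite -zcl_lin !zmul_zcl /tstar (tres_linl 1) zcl_lin.
- move=> z k z1 z2; have [c ->] := zcl_surj z; have [a ->] := zcl_surj z1.
  have [b ->] := zcl_surj z2.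
  by rewrite -zcl_lin !zmul_zcl /tstar tres_linr zcl_lin.
- move=> z1 z2 z3; have [c ->] := zcl_surj z3; have [a ->] := zcl_surj z1.
  have [b ->] := zcl_surj z2.
  by rewrite !zmul_zcl; apply/esym/zcl_eq/tstarA.
- by move=> z; have [a ->] := zcl_surj z; rewrite zmul_zcl tstar_vacl.
- by move=> z; have [a ->] := zcl_surj z; rewrite zmul_zcl tstar_vacr.
- exact: zhu_direct_sum.
- move=> i j _ _ [a pa ->] [b pb ->]; exists (tstar a b); first exact: par_tres.
  exact: zmul_zcl.
Qed.

End ZhuAlgebra.

(** * The top level of a twisted module *)

Section SubspaceTypes.
Variables (K : fieldType) (V : lmodType K) (U : set V) (hU : subspace U).

Lemma sub_val_lin : linear (@sub_val K V U hU).
Proof. exact: (linearP (val : subspace_type hU -> V)). Qed.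

Lemma sub_val_inj : injective (@sub_val K V U hU).
Proof. exact: val_inj. Qed.

Lemma sub_valE (w : subspace_type hU) : U (sub_val w).
Proof. by apply/asboolP; apply: (sub_valP w). Qed.

Definition to_sub v (Uv : U v) : subspace_type hU :=
  @SubspaceType K V U hU v (introT (asboolP _) Uv).

End SubspaceTypes.

Section TopLevelModule.
Variables (K : numFieldType) (V : svoa K) (M : twisted_module V).
Implicit Types (a b : V) (i j : bool) (s t : rat) (v : M).

Definition oact a v : M := lin_ext (@wtsp K V) (fun s a => tmode a (s - 1) v) a.

Lemma oact_linl v : linear (fun a => oact a v).
Proof.
by apply: lin_ext_linear => [|s]; [exact: wt_direct|exact: tmode_linl].
Qed.

Lemma oact_wt s a v : wtsp s a -> oact a v = tmode a (s - 1) v.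
Proof.
move=> wa; rewrite /oact (lin_extE _ _ wa) //; first exact: wt_direct.
by move=> t; apply: tmode_linl.
Qed.

Lemma oact_linr a : linear (oact a).
Proof.
move=> k u v; move: a; apply: homog_ind => [|i s a [_ wa _]].
  split=> [|k' a b /= ha hb]; first by rewrite !(lin0 (oact_linl _)) scaler0 addr0.
  by rewrite !(oact_linl _ k' a b) ha hb !scalerDr !scalerA [k' * k]mulrC addrACA.
by rewrite !(oact_wt _ wa) tmode_linr.
Qed.

Lemma oact_top a v : tgr 0 v -> tgr 0 (oact a v).
Proof.
move=> v0; have sT := subspace_tgr M 0; move: a; apply: homog_ind => [|i s a [_ wa _]].
  split=> [|k a b /= ha hb]; first by rewrite (lin0 (oact_linl _)); apply: sub0.
  by rewrite oact_linl; apply: (proj2 sT).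
rewrite (oact_wt _ wa); have := tmode_gr (s - 1) wa v0.
case=> [->|[k e]]; first exact: sub0.
suff -> : k = 0%N by [].
by apply/eqP; rewrite -(eqr_nat rat) -e; apply/eqP; ring.
Qed.

Lemma tmode_lower s a v (n : rat) : tgr 0 v -> wtsp s a -> s - 1 < n -> tmode a n v = 0.
Proof.
move=> v0 wa sn; have := tmode_gr n wa v0; case=> // -[k e _].
have : (k%:R : rat) < 0 by rewrite -e; lra.
by rewrite ltrn0.
Qed.

(** The Jacobi identity with l = -r, m = s, n = t - 2 + r on a lowest vector. The second product
    vanishes because a_(s+k) lowers the degree; the first keeps at most k = 0, and that only for r =
    1; the iterates are the zero modes of the terms of [tres r a b]. The case r = 1 gives
    multiplicativity, r = 2 the vanishing of O_t(V). *)
Lemma oact_tres i j s t a b v (r : nat) : homog i s a -> homog j t b -> tgr 0 v ->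
  (0 < r)%N ->
  oact (tres r a b) v = if r == 1%N then oact a (oact b v) else 0.
Proof.
move=> ha hb v0 r_gt0; have [pa wa sa] := ha; have [pb wb tb] := hb.
have tb' : hcoset j (t - 2 + r%:R).
  case: tb => k ->; exists (k - 2 + r%:Z).
  by rewrite !rmorphD /= -pmulrn; ring.
have := tjacobi v (- r%:Z) pa pb sa tb'.
rewrite nsum1 => [|k]; last first.
  rewrite (tmode_lower v0 wb) ?(lin0 (tmode_linr _ _)) ?scaler0 //.
  rewrite -natr1; have : 0 <= k%:R :> rat by rewrite ler0n.
  have : 1 <= r%:R :> rat by rewrite ler1n.
  lra.
rewrite [X in _ - _ *: X](@nsumE _ 0%N) ?big_ord0 ?scaler0 ?subr0 => [|k _]; last first.
  rewrite (tmode_lower v0 wa) ?(lin0 (tmode_linr _ _)) ?scaler0 //.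
  have : 0 <= k%:R :> rat by rewrite ler0n.
  lra.
rewrite expr0 gbin0 mulr1 scale1r => e.
transitivity (tmode a (s + (- r%:Z)%:~R) (tmode b (t - 2 + r%:R) v)); last first.
  case: eqP => [->|r1].
    rewrite (oact_wt _ wb) (oact_wt _ wa); congr tmode; congr tmode; ring.
  rewrite (tmode_lower v0 wb) ?(lin0 (tmode_linr _ _)) //.
  have : 2%:R <= r%:R :> rat by rewrite ler_nat; lia.
  lra.
rewrite e (tres_wt _ _ wa).
have [N hN] := vop_trunc a b (- r%:Z).
rewrite (vopE _ hN) (lin_sum (oact_linl v)) (nsumE (N := N)) => [|k hk]; last first.
  by rewrite hN // (lin0 (tmode_linl _ _)) scaler0.
apply: eq_bigr => k _; rewrite (linZ (oact_linl v)) -[in LHS]gbin_neg.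
congr (_ * gbin _ _ *: _); first by rewrite !rmorphB rmorph1 /= ratr_nat.
have [_ wab _] := homog_vmode (- r%:Z + k%:Z) ha hb.
rewrite (oact_wt _ wab); congr tmode.
by rewrite rmorphD rmorphN /= -!pmulrn; ring.
Qed.

Lemma oact_Ot a v : tgr 0 v -> Ot a -> oact a v = 0.
Proof.
move=> v0 [n [c [x [hx ->]]]]; rewrite (lin_sum (oact_linl v)) big1 // => k _.
rewrite (linZ (oact_linl v)); have [b [d ->]] := hx k => {hx}.
suff -> : oact (tcirc b d) v = 0 by rewrite scaler0.
have sub_lin (f : V -> M) : linear f -> subspace [set u | f u = 0].
  move=> lf; split=> [|k' u' v' /= hu hv]; first exact: lin0 lf.
  by rewrite lf hu hv scaler0 addr0.
move: b; apply: homog_ind => [|i s b hb].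
  by apply: sub_lin => k' u u'; rewrite /tcirc (tres_linl 2) oact_linl.
move: d; apply: homog_ind => [|j t d hd].
  by apply: sub_lin => k' u u'; rewrite /tcirc (tres_linr 2) oact_linl.
exact: (oact_tres hb hd v0 (r := 2)).
Qed.

Lemma oact_tstar a b v : tgr 0 v -> oact (tstar a b) v = oact a (oact b v).
Proof.
move=> v0; apply/eqP; rewrite -subr_eq0; apply/eqP.
have sub_lin (f : V -> M) : linear f -> subspace [set u | f u = 0].
  move=> lf; split=> [|k' u' v' /= hu hv]; first exact: lin0 lf.
  by rewrite lf hu hv scaler0 addr0.
move: a; apply: homog_ind => [|i s a ha].
  apply: (sub_lin (fun a => oact (tstar a b) v - oact a (oact b v))) => k u u'.
  by rewrite /tstar (tres_linl 1) !oact_linl scalerBr opprD addrACA.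
move: b; apply: homog_ind => [|j t b hb].
  apply: (sub_lin (fun b => oact (tstar a b) v - oact a (oact b v))) => k u u'.
  by rewrite /tstar (tres_linr 1) !oact_linl oact_linr scalerBr opprD addrACA.
by rewrite /tstar (oact_tres ha hb v0 (r := 1)) ?subrr.
Qed.

Lemma oact_zcl a b v : tgr 0 v -> zcl a = zcl b -> oact a v = oact b v.
Proof.
move=> v0 /zcl_eq h; apply/eqP; rewrite -subr_eq0 -(linB (oact_linl v)).
by rewrite (oact_Ot v0 h).
Qed.

Definition top_act (z : zhu V) (w : top_level M) : top_level M :=
  to_sub (subspace_tgr M 0) (oact_top (qrepr z) (sub_valE w)).

Lemma top_act_val a w : sub_val (top_act (zcl a) w) = oact a (sub_val w).
Proof.
by apply: (oact_zcl (sub_valE w)); rewrite /zcl qreprK.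
Qed.

Theorem top_actP : top_action top_act.
Proof.
have inj := @sub_val_inj _ _ _ (subspace_tgr M 0).
have svl := @sub_val_lin _ _ _ (subspace_tgr M 0).
split; last by move=> s a w wa; rewrite /top_val top_act_val (oact_wt _ wa).
split.
- move=> w k z1 z2; have [a ->] := zcl_surj z1; have [b ->] := zcl_surj z2.
  by apply: inj; rewrite -zcl_lin svl !top_act_val oact_linl.
- move=> z k w w'; have [a ->] := zcl_surj z.
  by apply: inj; rewrite svl !top_act_val svl oact_linr.
- move=> w; have [_ w0 _] := homog_vac V.
  by apply: inj; rewrite top_act_val (oact_wt _ w0) tmode_vac sub0r eqxx.
- move=> z1 z2 w; have [a ->] := zcl_surj z1; have [b ->] := zcl_surj z2.
  apply: inj; rewrite zmul_zcl !top_act_val oact_tstar //; exact: sub_valE.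
Qed.

End TopLevelModule.

(** * Modes on functionals *)

Section ExpansionCoefficients.
Variable K : numFieldType.
Implicit Types (p q x y : int) (j r N : nat).

(* The coefficient of z^j in the expansion of (z - 1)^p at z = 0. *)
Definition bcf p j : K := (-1) ^ (p - j%:Z) * gbin p%:~R j.

Lemma signz_neq0 p : (-1) ^ p != 0 :> K.
Proof. by rewrite expfz_neq0 // oppr_eq0 oner_eq0. Qed.

Lemma signzD p q : (-1) ^ (p + q) = (-1) ^ p * (-1) ^ q :> K.
Proof. by rewrite expfzDr // oppr_eq0 oner_eq0. Qed.

Lemma signzB1 p : (-1) ^ (p - 1) = - (-1) ^ p :> K.
Proof. by rewrite signzD [(-1) ^ (-1)]exprN1 invrN1 mulrN1. Qed.

Lemma bcf0 p : bcf p 0 = (-1) ^ p.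
Proof. by rewrite /bcf subr0 gbin0 mulr1. Qed.

(** (z - 1)^(p+1) = z (z - 1)^p - (z - 1)^p. *)
Lemma bcf_pascal p j : bcf (p + 1) j.+1 = bcf p j - bcf p j.+1.
Proof.
rewrite /bcf (_ : p + 1 - j.+1%:Z = p - j%:Z); last lia.
rewrite (_ : p - j.+1%:Z = p - j%:Z - 1); last lia.
by rewrite signzB1 rmorphD /= gbin_pascal; ring.
Qed.

Lemma bcf_pascal0 p : bcf (p + 1) 0 = - bcf p 0.
Proof. by rewrite !bcf0 -[p in RHS](addrK 1) signzB1 opprK. Qed.

Lemma bcfD p q r : \sum_(i < r.+1) bcf p i * bcf q (r - i) = bcf (p + q) r.
Proof.
rewrite /bcf rmorphD /= -gbin_vandermonde mulr_sumr; apply: eq_bigr => i _.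
have ir : (i <= r)%N by rewrite -ltnS.
by rewrite (_ : p + q - r%:Z = (p - i%:Z) + (q - (r - i)%N%:Z)) ?signzD; [ring|lia].
Qed.

Lemma bcf0l r : bcf 0 r = (r == 0%N)%:R.
Proof.
by rewrite /bcf gbin0l; case: r => [|r]; rewrite ?mulr0 // mulr1 subr0.
Qed.

Lemma bcf_nat_small n j : (n < j)%N -> bcf n%:Z j = 0.
Proof. by move=> nj; rewrite /bcf -pmulrn gbin_nat_small // mulr0. Qed.

Lemma bcfN1 j : bcf (-1) j = -1.
Proof.
elim: j => [|j IH]; first by rewrite bcf0 exprN1 invrN1.
have := bcf_pascal (-1) j; rewrite addNr bcf0l IH => /eqP.
by rewrite eq_sym subr_eq0 => /eqP <-.
Qed.

(** A triangular system: c x has a sign as its coefficient and the other terms have larger index, so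
    downward induction from B applies. The exponent p may vary with x. *)
Lemma bcf_unique (U : lmodType K) (L B : int) (c : int -> U) :
  (forall x, B < x -> c x = 0) ->
  (forall x, L <= x -> exists p N, B < x + N%:Z /\
     \sum_(j < N) bcf p j *: c (x + j%:Z) = 0) ->
  forall x, L <= x -> c x = 0.
Proof.
move=> c0 cS x; have [m] : exists m : nat, B < x + m%:Z by exists `|B - x|.+1; lia.
elim: m x => [|m IH] x hx Lx; first by apply: c0; lia.
have [p [[|N] [hN]]] := cS x Lx; first by move=> _; apply: c0; lia.
rewrite big_ord_recl big1 => [|j _]; last first.
  by rewrite lift0 IH ?scaler0 //; lia.
rewrite addr0 addr0 bcf0 => /eqP; rewrite scaler_eq0 (negPf (signz_neq0 p)) /=.
by move/eqP.
Qed.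

End ExpansionCoefficients.

(** * Parity signs and the vector field z d/dz *)

Section Parity.
Variables (K : numFieldType) (V : svoa K).
Implicit Types (a b v : V) (i j : bool) (s t : rat) (m n p q x y : int).

(* The [i]-th power of the parity automorphism v |-> (-1)^|v| v. *)
Definition sg i v : V :=
  if i then component (@par K V) v false - component (@par K V) v true else v.

Lemma sg_lin i : linear (sg i).
Proof.
case: i => k u v //; rewrite /sg !(component_lin (par_sum V)).
by rewrite scalerBr opprD addrACA.
Qed.

Lemma sg_par i j v : par j v -> sg i v = (-1) ^+ (i && j) *: v.
Proof.
move=> pv; case: i; last by rewrite scale1r.
rewrite /sg (component_in (par_sum V) pv); case: (j) => /=.
  by rewrite sub0r expr1 scaleN1r.
by rewrite subr0 scale1r.
Qed.

Lemma sg_vmode i j a n v : par j a ->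
  sg i (vmode a n v) = (-1) ^+ (i && j) *: vmode a n (sg i v).
Proof.
move=> pa; move: v; apply: (direct_sum_ind (par_sum V)) => [|j' v pv].
  split=> [|k u v] /=.
    by rewrite (lin0 (sg_lin i)) (lin0 (vmode_linr a n)) (lin0 (sg_lin i)) scaler0.
  rewrite vmode_linr !(sg_lin i) vmode_linr => -> ->.
  by rewrite scalerDr !scalerA mulrC.
rewrite (sg_par i (par_vmode n pa pv)) (sg_par i pv) (linZ (vmode_linr a n)) scalerA.
by congr (_ *: _); case: i j j' {pa pv} => [] [] [];
  rewrite /= ?expr0 ?expr1 ?mulr1 ?mul1r ?mulrN1 ?opprK.
Qed.

Lemma sg_wop i j s a x p v : par j a ->
  sg i (wop s a x p v) = (-1) ^+ (i && j) *: wop s a x p (sg i v).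
Proof.
move=> pa; have [N hN] := vop_trunc a v p; have [N' hN'] := vop_trunc a (sg i v) p.
rewrite /wop !(@vopE _ _ (N + N')) => [|k hk|k hk]; [|by apply: hN'; lia|by apply: hN; lia].
rewrite (lin_sum (sg_lin i)) scaler_sumr; apply: eq_bigr => k _.
by rewrite (linZ (sg_lin i)) (sg_vmode _ _ _ pa) !scalerA mulrC.
Qed.

Lemma sg_addb i j v : sg (i (+) j) v = sg i (sg j v).
Proof.
move: v; apply: (direct_sum_ind (par_sum V)) => [|j' v pv].
  split=> [|k u v] /=; first by rewrite !(lin0 (sg_lin _)).
  by rewrite !sg_lin => -> ->.
rewrite (sg_par _ pv) (sg_par j pv) (linZ (sg_lin i)) (sg_par i pv) scalerA.
by congr (_ *: _); case: i j j' {pv} => [] [] [];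
  rewrite /= ?expr0 ?expr1 ?mulr1 ?mul1r ?mulrN1 ?opprK.
Qed.

Lemma sgC i j v : sg i (sg j v) = sg j (sg i v).
Proof. by rewrite -!sg_addb addbC. Qed.

Lemma sgK i v : sg i (sg i v) = v.
Proof. by rewrite -sg_addb addbb. Qed.

Lemma sg_vac i : sg i (vac V) = vac V.
Proof. by rewrite (sg_par i (vac_par V)) andbF scale1r. Qed.

(* L_(-1) + L_0, the vector field z d/dz in the coordinate z = 1 + y *)
Definition euler v : V := vmode (conf V) 0 v + vmode (conf V) 1 v.

Lemma euler_lin : linear euler.
Proof. by move=> k u v; rewrite /euler !vmode_linr scalerDr addrACA. Qed.

Lemma euler_vac : euler (vac V) = 0.
Proof. by rewrite /euler !vac_trunc // addr0. Qed.

Lemma sg_euler i v : sg i (euler v) = euler (sg i v).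
Proof.
rewrite /euler (linD (sg_lin i)) !(sg_vmode _ _ _ (conf_par V)).
by rewrite andbF !scale1r.
Qed.

(** The commutator of L_(-1) + L_0 with Y(b, z - 1) is z d/dz + t applied to it. Integrated by parts
    against z^(t-1+y) (z - 1)^q, the weight t cancels and only y and q remain. *)
Lemma euler_wop j t b y q v : homog j t b ->
  euler (wop t b y q v) = wop t b y q (euler v) - y%:~R *: wop t b y q v
    - q%:~R *: wop t b (y + 1) (q - 1) v.
Proof.
move=> hb; have [pb _ _] := hb.
have euler_vmode n : euler (vmode b n v) = vmode b n (euler v)
    - n%:~R *: vmode b (n - 1) v + (ratr t - n%:~R - 1) *: vmode b n v.
  rewrite /euler (conf0_comm _ _ pb) (conf1_comm _ _ hb) (linD (vmode_linr b n)).
  by rewrite addrA [X in X + _]addrAC.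
have [N1 h1] := vop_trunc b v (q - 1).
have [N2 h2] := vop_trunc b (euler v) q.
pose N := (N1 + N2).+1; set be := ratr t - 1 + y%:~R : K.
have hA (i : nat) : (N <= i.+1)%N -> vmode b (q - 1 + i%:Z) v = 0 by move=> hi; apply: h1; lia.
rewrite /wop -/be (_ : ratr t - 1 + (y + 1)%:~R = be + 1); last by rewrite rmorphD /= addrA.
have hA1 (i : nat) : (N.+1 <= i)%N -> vmode b (q - 1 + i%:Z) v = 0.
  by move=> hi; apply: hA; lia.
have hv (i : nat) : (N <= i)%N -> vmode b (q + i%:Z) v = 0.
  by move=> hi; rewrite (_ : q + i%:Z = q - 1 + i.+1%:Z) ?hA //; lia.
have he (i : nat) : (N <= i)%N -> vmode b (q + i%:Z) (euler v) = 0.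
  by move=> hi; apply: h2; lia.
rewrite (vopE _ hA1) !(vopE _ hv) (vopE _ he).
rewrite (lin_sum euler_lin).
pose A (i : nat) := vmode b (q - 1 + i%:Z) v.
have AS (i : nat) : vmode b (q + i%:Z) v = A i.+1 by rewrite /A; congr (vmode _ _ _); lia.
rewrite (eq_bigr (fun i : 'I_N => gbin be i *: vmode b (q + i%:Z) (euler v) +
   ((gbin be i * (ratr t - (q + i%:Z)%:~R - 1)) *: A i.+1
    - (gbin be i * (q + i%:Z)%:~R) *: A i))); last first.
  move=> i _; rewrite (linZ euler_lin) euler_vmode AS !scalerDr scalerN !scalerA -[LHS]addrA.
  congr (_ + _); rewrite [LHS]addrC (_ : q + _ - 1 = q - 1 + i%:Z) //; lia.
rewrite big_split /= -[RHS]addrA; congr (_ + _).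
rewrite [X in _ - _ *: X]big_ord_recl gbin0 scale1r scalerDr opprD addrCA.
rewrite sumrB; pose B (i : nat) := (gbin be i * (q + i%:Z)%:~R) *: A i.
rewrite -[X in _ - X](@ord_widen _ N N.+1 B) //; last first.
  by move=> i Ni; rewrite /B /A hA ?scaler0 //; lia.
rewrite [X in _ - X]big_ord_recl {1}/B gbin0 mul1r addr0 opprD [LHS]addrCA; congr (_ + _).
rewrite !scaler_sumr -!sumrN -!big_split /=; apply: eq_bigr => i _.
rewrite /bump /= add1n AS /B -/(A _) !scalerA -!scaleNr -!scalerDl; congr (_ *: _).
have := gbinS be i; rewrite gbin_pascal -natr1 !rmorphD /= -!pmulrn.
rewrite -[i.+1%:R]natr1 /be => e.
have e0 := congr1 (fun z => z - (ratr t - 1 + y%:~R - i%:R) * gbin (ratr t - 1 + y%:~R) i) e.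
rewrite subrr in e0; apply/eqP; rewrite -subr_eq0 -oppr_eq0 -e0; apply/eqP; ring.
Qed.

End Parity.

Lemma fct_lin (K : fieldType) (T : Type) (W : lmodType K) k (f g : T -> W) x :
  (k *: f + g) x = k *: f x + g x.
Proof. by []. Qed.

Lemma fct0 (K : fieldType) (T : Type) (W : lmodType K) x : (0 : T -> W) x = 0.
Proof. by []. Qed.

(** * Smooth functionals and their expansion at 0 *)

Section CoinducedModule.
Variables (K : numFieldType) (V : svoa K) (W : lmodType K).
Variable act : zhu V -> W -> W.
Hypothesis hact : zhu_module act.
Implicit Types (a b v : V) (i j : bool) (s t : rat) (m n p q x y : int) (D N : nat).
Implicit Types (phi psi : V -> W) (w : W).

(* The functionals <w', Y(v, 1) u>, where w' is killed by the modes that raise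
   the degree and u by those that lower it by more than D: the residue theorem
   for z^(s-1+x) (z-1)^p <w', Y(v, 1) Y(a, z) u> leaves only the contribution of
   infinity, which is o(a) when x + p = 0. *)
Definition smooth D phi : Prop := linear phi /\
  forall i s a x p v, homog i s a -> D%:Z < x -> x + p <= 0 ->
    phi (wop s a x p v) = if x + p == 0 then act (zcl a) (phi v) else 0.

Lemma smooth_mono D D' phi : (D <= D')%N -> smooth D phi -> smooth D' phi.
Proof.
move=> DD [lphi h]; split=> // i s a x p v ha hx hp.
by apply: (h i) => //; lia.
Qed.

Lemma smooth_subspace D : subspace [set phi | smooth D phi].
Proof.
have lact z := zhu_module_linr hact z.
split=> [|k phi psi [lphi hphi] [lpsi hpsi]] /=.
  split=> [k u v|i s a x p v _ _ _]; first by rewrite !fct0 scaler0 addr0.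
  by rewrite !fct0 (lin0 (lact _)) if_same.
split=> [k' u v|i s a x p v ha hx hp].
  by rewrite !fct_lin lphi lpsi !scalerDr !scalerA addrACA [k' * k]mulrC.
rewrite !fct_lin (hphi i) // (hpsi i) //; case: eqP => _; last by rewrite scaler0 addr0.
by rewrite lact.
Qed.

(** For p = -(D+1) the residues of phi are, up to a global sign, the coefficients of (z -
    1)^(-(D+1)) times the wanted expansion at 0. Multiplying by the polynomial (z - 1)^(D+1), with
    its D + 2 coefficients, recovers the expansion. Indices above D, where infinity may contribute,
    are cut off; [sg i] is the sign of moving a past v. *)
Definition dmode D i s a x phi v : W :=
  - \sum_(r < D.+2) bcf K D.+1%:Z r *:
      (if x + r%:Z <= D%:Z then phi (wop s a (x + r%:Z) (- D.+1%:Z) (sg i v)) else 0).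

Lemma dmode_linv D i s a x phi : linear phi -> linear (dmode D i s a x phi).
Proof.
move=> lphi k u v; rewrite /dmode scalerN -opprD; congr (- _).
rewrite scaler_sumr -big_split; apply: eq_bigr => r _ /=.
case: ifP => _; last by rewrite !scaler0 addr0.
by rewrite (sg_lin i) wop_linr lphi scalerDr !scalerA mulrC.
Qed.

Lemma dmode_lina D i s x phi v : linear phi -> linear (fun a => dmode D i s a x phi v).
Proof.
move=> lphi k u u'; rewrite /dmode scalerN -opprD; congr (- _).
rewrite scaler_sumr -big_split; apply: eq_bigr => r _ /=.
case: ifP => _; last by rewrite !scaler0 addr0.
by rewrite wop_linl lphi scalerDr !scalerA mulrC.
Qed.

Lemma dmode_linphi D i s a x v : linear (fun phi => dmode D i s a x phi v).
Proof.
move=> k phi psi; rewrite /dmode scalerN -opprD; congr (- _).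
rewrite scaler_sumr -big_split; apply: eq_bigr => r _ /=.
case: ifP => _; last by rewrite !scaler0 addr0.
by rewrite !fct_lin scalerDr !scalerA mulrC.
Qed.

Lemma dmode_large D i s a x phi v : D%:Z < x -> dmode D i s a x phi v = 0.
Proof.
move=> Dx; rewrite /dmode big1 ?oppr0 // => r _.
by case: ifP => [|_]; [lia|rewrite scaler0].
Qed.

Section Residue.
Variables (D : nat) (phi : V -> W) (i : bool) (s : rat) (a v : V).
Hypotheses (sphi : smooth D phi) (ha : homog i s a).

Let c x := dmode D i s a x phi v.
Let lam x p := phi (wop s a x p (sg i v)).

(** The definition is inverted: the expansions of (z - 1)^(-(D+1)) and (z - 1)^(D+1) have product
    1. *)
Lemma dmode_res_base N x : x <= D%:Z -> D%:Z < x + N%:Z ->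
  lam x (- D.+1%:Z) = - \sum_(r < N) bcf K (- D.+1%:Z) r *: c (x + r%:Z).
Proof.
move=> xD xN.
pose A (r : nat) := if x + r%:Z <= D%:Z then lam (x + r%:Z) (- D.+1%:Z) else 0.
have A0 r : (N <= r)%N -> A r = 0 by move=> hr; rewrite /A; case: ifP => //; lia.
have cE (r : nat) : c (x + r%:Z) = - \sum_(e < N + D.+2) bcf K D.+1%:Z e *: A (r + e)%N.
  rewrite (ord_widen (leq_addl N D.+2) (F := fun e => bcf K D.+1%:Z e *: A (r + e)%N)).
    by congr (- _); apply: eq_bigr => e _; rewrite /A PoszD addrA.
  by move=> e he; rewrite bcf_nat_small ?scale0r.
under eq_bigr do rewrite cE scalerN scaler_sumr.
rewrite sumrN opprK; under eq_bigr do under eq_bigr do rewrite scalerA.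
rewrite (cauchy_sum (R := N)) ?leq_addr //.
under eq_bigr do rewrite bcfD addNr bcf0l.
case: N xN A0 {cE} => [|N] xN A0; first by lia.
rewrite big_ord_recl big1 ?addr0 => [|r _]; last by rewrite scale0r.
by rewrite scale1r /A addr0 xD.
Qed.

(** Downward induction on x. Above D both sides vanish by smoothness. At x <= D, the two Pascal
    rules and the case x + 1 link p with p + 1, so every p is reached from -(D+1). *)
Lemma dmode_res N x p : x + p <= -1 -> D%:Z < x + N%:Z ->
  lam x p = - \sum_(r < N) bcf K p r *: c (x + r%:Z).
Proof.
have [lphi hphi] := sphi.
pose S x p N := - \sum_(r < N) bcf K p r *: c (x + r%:Z).
have c0 x' : D%:Z < x' -> c x' = 0 by apply: dmode_large.
have S_widen x' p' (N' M : nat) : D%:Z < x' + N'%:Z -> (N' <= M)%N -> S x' p' M = S x' p' N'.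
  move=> h NM; congr (- _); apply: (ord_widen NM (F := fun r => bcf K p' r *: c (x' + r%:Z))).
  by move=> r hr; rewrite c0 ?scaler0 //; lia.
have S_pascal x' p' N' : S (x' + 1) p' N' = S x' (p' + 1) N'.+1 + S x' p' N'.+1.
  rewrite /S -opprD -big_split; congr (- _).
  rewrite big_ord_recl /= bcf_pascal0 scaleNr addNr add0r; apply: eq_bigr => r _.
  by rewrite -scalerDl /bump /= add1n bcf_pascal subrK; congr (_ *: c _); lia.
have [m] : exists m : nat, D%:Z < x + m%:Z by exists `|D%:Z - x|.+1; lia.
elim: m x p N => [|m IH] x p N hm hp hN.
  rewrite big1 ?oppr0 => [|r _]; last by rewrite c0 ?scaler0 //; lia.
  by rewrite /lam (hphi i) //; [case: eqP => //; lia|lia|lia].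
case: (leP x D%:Z) => xD; last by apply: IH => //; lia.
have step p' : x + p' <= -2 ->
    (lam x p' = S x p' N <-> lam x (p' + 1) = S x (p' + 1) N).
  move=> hp'; have e : lam x p' + lam x (p' + 1) = S x p' N + S x (p' + 1) N.
    have := IH (x + 1) p' N ltac:(lia) ltac:(lia) ltac:(lia).
    rewrite -/(S _ _ _) S_pascal !(S_widen _ _ N N.+1) //; try lia.
    by rewrite /lam wop_pascal (linD lphi) => e; rewrite addrC e addrC.
  by split=> h; move: e; rewrite h; [move/addrI|move/addIr].
have base : lam x (- D.+1%:Z) = S x (- D.+1%:Z) N by apply: dmode_res_base.
case: (leP (- D.+1%:Z) p) => pD.
  have [k pk] : exists k : nat, p = - D.+1%:Z + k%:Z.
    by exists (absz (p + D.+1%:Z)%R); lia.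
  rewrite -/(S _ _ _) {}pk in hp *; elim: k hp => [|k IHk] hk; first by rewrite addr0.
  rewrite (_ : - D.+1%:Z + k.+1%:Z = - D.+1%:Z + k%:Z + 1); last lia.
  apply/(step (- D.+1%:Z + k%:Z)); first lia.
  by apply: IHk; lia.
have [k ->] : exists k : nat, p = - D.+1%:Z - k%:Z.
  by exists (absz (p + D.+1%:Z)%R); lia.
rewrite -/(S _ _ _); elim: k => [|k IHk]; first by rewrite subr0.
apply/(step (- D.+1%:Z - k.+1%:Z)); first lia.
by rewrite (_ : - D.+1%:Z - k.+1%:Z + 1 = - D.+1%:Z - k%:Z) //; lia.
Qed.

End Residue.

(** Both expansions have the same residues at 1, and these determine them. *)
Lemma dmode_indep D D' i s a x phi : smooth D phi -> smooth D' phi -> homog i s a ->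
  dmode D i s a x phi = dmode D' i s a x phi.
Proof.
move=> sD sD' ha; apply: funext => v; apply/eqP; rewrite -subr_eq0; apply/eqP.
apply: (bcf_unique (L := x) (B := (D + D')%:Z)
  (c := fun x => dmode D i s a x phi v - dmode D' i s a x phi v)) => //.
  by move=> y hy; rewrite !dmode_large ?subr0 //; lia.
move=> y _; exists (-1 - y), (`|(D + D')%:Z - y|.+1); split; first lia.
under eq_bigr do rewrite scalerBr.
set N := `|_|.+1.
have e1 := dmode_res (N := N) (x := y) (p := -1 - y) v sD ha ltac:(lia) ltac:(lia).
have e2 := dmode_res (N := N) (x := y) (p := -1 - y) v sD' ha ltac:(lia) ltac:(lia).
by rewrite sumrB; move: e1; rewrite e2 => /oppr_inj ->; rewrite subrr.
Qed.

End CoinducedModule.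

(** * Stability, grading and lowest part of the space of smooth functionals *)

Section CoinducedModes.
Variables (K : numFieldType) (V : svoa K) (W : lmodType K).
Variable act : zhu V -> W -> W.
Hypothesis hact : zhu_module act.
Implicit Types (a b v : V) (i j : bool) (s t : rat) (d m n p q x y : int) (D N : nat).
Implicit Types (phi psi : V -> W) (w : W).

(** Any smoothness bound will do by [dmode_indep]; choosing one lets modes be composed without
    carrying bounds. The value 0 is a default for functionals that are not smooth. *)
Definition deg phi : nat :=
  if pselect (exists D, smooth act D phi) is left e then projT1 (cid e) else 0%N.

Definition emode i s a x phi : V -> W := dmode (deg phi) i s a x phi.

Lemma emodeE D i s a x phi : smooth act D phi -> homog i s a ->
  emode i s a x phi = dmode D i s a x phi.
Proof.
move=> sphi ha; rewrite /emode /deg; case: pselect => [e|]; last by case; exists D.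
by case: cid => D' /= sD'; apply: (dmode_indep x sD' sphi ha).
Qed.

Lemma emode_large D i s a x phi : smooth act D phi -> homog i s a -> D%:Z < x ->
  emode i s a x phi = 0.
Proof.
move=> sphi ha Dx; rewrite (emodeE _ sphi ha); apply: funext => v.
exact: dmode_large.
Qed.

Lemma emode_res D N i s a x p phi v : smooth act D phi -> homog i s a ->
  x + p <= -1 -> D%:Z < x + N%:Z ->
  phi (wop s a x p (sg i v)) = - \sum_(r < N) bcf K p r *: emode i s a (x + r%:Z) phi v.
Proof.
move=> sphi ha hp hN; rewrite (dmode_res v sphi ha hp hN); congr (- _).
by apply: eq_bigr => r _; rewrite (emodeE _ sphi ha).
Qed.

Lemma emode_linv D i s a x phi : smooth act D phi -> linear (emode i s a x phi).
Proof. by case=> lphi _; apply: dmode_linv. Qed.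

Lemma emode_lina D i s x phi v : smooth act D phi ->
  linear (fun a => emode i s a x phi v).
Proof. by case=> lphi _; apply: dmode_lina. Qed.

Lemma smooth2 D D' phi psi : smooth act D phi -> smooth act D' psi ->
  smooth act (D + D') phi /\ smooth act (D + D') psi.
Proof.
by split; [apply: smooth_mono H; rewrite leq_addr|apply: smooth_mono H0; rewrite leq_addl].
Qed.

Lemma emode_linphi D D' i s a x k phi psi : smooth act D phi -> smooth act D' psi ->
  homog i s a ->
  emode i s a x (k *: phi + psi) = k *: emode i s a x phi + emode i s a x psi.
Proof.
move=> sphi spsi ha; have [s1 s2] := smooth2 sphi spsi.
have s3 : smooth act (D + D') (k *: phi + psi) by apply: (proj2 (smooth_subspace hact _)).
rewrite (emodeE _ s1 ha) (emodeE _ s2 ha) (emodeE _ s3 ha); apply: funext => v.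
exact: dmode_linphi.
Qed.

(** On residues, [wop s a x p] is moved past [wop t b y q] with q = -1 - y. The commutator terms
    have exponents with sum x + p - 1 <= -1 and first exponent x + y + r, which exceeds D because D
    - y <= D1 < x; so phi kills them. *)
Lemma smooth_emode D D1 j t b y phi : smooth act D phi -> homog j t b ->
  (D <= D1)%N -> D%:Z - y <= D1%:Z -> smooth act D1 (emode j t b y phi).
Proof.
move=> sphi hb DD1 DyD1; split; first exact: emode_linv sphi.
move=> i s a x p v ha hx hp; have [lphi hphi] := sphi.
have lact z := zhu_module_linr hact z.
have actE (b' : bool) (u : W) : (if b' then act (zcl a) u else 0) =
    b'%:R *: act (zcl a) u by case: b'; rewrite ?scale1r ?scale0r.
apply/eqP; rewrite actE -subr_eq0 -actE; apply/eqP.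
pose c y := emode j t b y phi (wop s a x p v) - (x + p == 0)%:R *: act (zcl a) (emode j t b y phi v).
rewrite actE -/(c y); apply: (bcf_unique (L := D%:Z + 1 - x) (B := D%:Z)); last by lia.
  by move=> y' hy'; rewrite /c !(emode_large sphi hb hy') fct0 (lin0 (lact _)) scaler0 subr0.
move=> {DyD1} {}y hy; exists (-1 - y), (absz (D%:Z - y)%R).+1; split; first lia.
set N := (absz _).+1; set q := -1 - y.
under eq_bigr do rewrite /c scalerBr.
have e1 := emode_res (N := N) (x := y) (p := q) (wop s a x p v) sphi hb ltac:(lia) ltac:(lia).
have e2 := emode_res (N := N) (x := y) (p := q) v sphi hb ltac:(lia) ltac:(lia).
rewrite sumrB -[X in X - _]opprK -e1.
rewrite [X in _ - X](_ : _ = - ((x + p == 0)%:R *: act (zcl a) (phi (wop t b y q (sg j v))))).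
  have [pa _ _] := ha; rewrite opprK (sg_wop j s x p v pa).
  rewrite (linZ (wop_linr _ _ _ _)) (linZ lphi).
  have [N0 e3] := wop_commutator (sg j v) x y p q ha hb.
  have := congr1 phi e3; rewrite (linB lphi) (linZ lphi) [in RHS](lin_sum lphi) [RHS]big1 => [|k _]; last first.
    rewrite (lin_sum lphi) big1 // => r _; rewrite (linZ lphi).
    rewrite (hphi (i (+) j)) //; try lia.
      by case: eqP => [|_]; [lia|rewrite scaler0].
    rewrite /q; have := homog_vmode k%:Z ha hb; congr (homog _ _ _).
  rewrite andbC => /eqP; rewrite subr_eq0 => /eqP <-.
  by rewrite (hphi i) // -?actE ?addNr //; lia.
rewrite e2 (linN (lact _)) scalerN opprK (lin_sum (lact _)) scaler_sumr.
by apply: eq_bigr => r _; rewrite (linZ (lact _)) !scalerA mulrC.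
Qed.

(* For u of degree d, translating z d/dz from v to u in <w', Y(v, 1) u> gives - d. *)
Definition graded d phi : Prop :=
  (exists D, smooth act D phi) /\ forall v, phi (euler v) = - d%:~R *: phi v.

Lemma graded_subspace d : subspace (graded d).
Proof.
split=> [|k phi psi [[D sphi] ephi] [[D' spsi] epsi]].
  by split=> [|v]; [exists 0%N; apply: sub0; apply: smooth_subspace|rewrite !fct0 scaler0].
have [s1 s2] := smooth2 sphi spsi; split=> [|v].
  by exists (D + D')%N; apply: (proj2 (smooth_subspace hact _)).
by rewrite !fct_lin ephi epsi scalerDr !scalerA mulrC.
Qed.

(** On residues this is [euler_wop]; its last term matches the derivative of (z - 1)^q, whose
    coefficients satisfy r bcf(q, r) = q bcf(q - 1, r - 1). *)
Lemma graded_emode d j t b y phi : homog j t b -> graded d phi ->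
  graded (d - y) (emode j t b y phi).
Proof.
move=> hb [[D sphi] ephi]; have [lphi hphi] := sphi; split.
  by exists (D + `|D%:Z - y|)%N; apply: (smooth_emode sphi hb); lia.
move=> v; apply/eqP; rewrite -subr_eq0 scaleNr opprK; apply/eqP.
pose c y := emode j t b y phi (euler v) + (d - y)%:~R *: emode j t b y phi v.
rewrite -/(c y); apply: (bcf_unique (L := y) (B := D%:Z)) => //.
  by move=> y' hy'; rewrite /c !(emode_large sphi hb hy') !fct0 scaler0 addr0.
move=> {}y _; exists (-1 - y), (absz (D%:Z - y)%R).+1; split; first lia.
set N := (absz _).+1; set q := -1 - y.
have e1 := emode_res (N := N) (x := y) (p := q) (euler v) sphi hb ltac:(lia) ltac:(lia).
have e2 := emode_res (N := N) (x := y) (p := q) v sphi hb ltac:(lia) ltac:(lia).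
have e3 := emode_res (N := N) (x := y + 1) (p := q - 1) v sphi hb ltac:(lia) ltac:(lia).
pose A (r : nat) := emode j t b (y + r%:Z) phi v.
(* The shifted expansion [e3] runs up to the index y + N, one further than the sum to be matched. *)
have AN : A N = 0 by rewrite /A (emode_large sphi hb) //; lia.
transitivity (\sum_(r < N) bcf K q r *: emode j t b (y + r%:Z) phi (euler v)
   + ((d - y)%:~R *: \sum_(r < N) bcf K q r *: A r - \sum_(r < N) (r%:R * bcf K q r) *: A r)).
  rewrite scaler_sumr -sumrB -big_split; apply: eq_bigr => r _ /=.
  rewrite /c scalerDr !scalerA -scalerBl -/(A _); congr (_ + _ *: _).
  by rewrite opprD addrA rmorphB /= -pmulrn; ring.
rewrite -[X in X + _]opprK -e1 -[X in _ *: X]opprK -e2.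
rewrite (_ : \sum_(r < N) (r%:R * bcf K q r) *: A r = - q%:~R *: phi (wop t b (y + 1) (q - 1) (sg j v))); last first.
  rewrite e3 scaleNr scalerN opprK big_ord_recl mul0r scale0r add0r.
  rewrite big_ord_recr /= (_ : emode _ _ _ _ _ _ = A N); last first.
    by rewrite /A; congr (emode _ _ _ _ _ _); lia.
  rewrite AN scaler0 addr0 scaler_sumr; apply: eq_bigr => r _.
  rewrite /bump /= add1n scalerA /A (_ : y + r.+1%:Z = y + 1 + r%:Z); last lia.
  congr (_ *: _); rewrite /bcf (_ : q - 1 - r%:Z = q - r.+1%:Z); last lia.
  rewrite mulrCA [RHS]mulrCA; congr (_ * _).
  by rewrite gbin_absorb [in RHS](@intrD _ q (-1)).
rewrite sg_euler; have e4 := congr1 phi (euler_wop y q (sg j v) hb).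
rewrite !(linB lphi) !(linZ lphi) ephi in e4.
have -> : phi (wop t b y q (euler (sg j v))) = - d%:~R *: phi (wop t b y q (sg j v))
   + y%:~R *: phi (wop t b y q (sg j v)) + q%:~R *: phi (wop t b (y + 1) (q - 1) (sg j v)).
  by move/esym/eqP: e4; rewrite !subr_eq => /eqP ->; rewrite addrAC.
set A1 := phi _; set B1 := phi _.
pose Z := (d - y)%:~R *: A1.
have -> : - d%:~R *: A1 + y%:~R *: A1 = - Z.
  by rewrite /Z [(d - y)%:~R]rmorphB /= scalerBl opprB scaleNr addrC.
by rewrite scalerN -/Z scaleNr opprK opprD opprK addrACA subrr addNr addr0.
Qed.

(** The residue at (x, p) = (0, -1) applied to the vacuum is a, and 1/(z - 1) = -(1 + z + z^2 +
    ...). *)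
Lemma emode_vac D N i s a phi : smooth act D phi -> homog i s a -> D%:Z < N%:Z ->
  phi a = \sum_(r < N) emode i s a r%:Z phi (vac V).
Proof.
move=> sphi ha DN.
have := emode_res (N := N) (x := 0) (p := -1) (vac V) sphi ha ltac:(lia) ltac:(lia).
rewrite sg_vac /wop vop_vacr => ->; rewrite -sumrN; apply: eq_bigr => r _.
by rewrite bcfN1 scaleN1r opprK add0r.
Qed.

Lemma graded_vac d phi : graded d phi -> d <> 0 -> phi (vac V) = 0.
Proof.
move=> [[D [lphi _]] ephi] d0; have := ephi (vac V).
rewrite euler_vac (lin0 lphi) => /esym/eqP; rewrite scaler_eq0 oppr_eq0 intr_eq0.
by case/orP => /eqP.
Qed.

(** L_(-1) + L_0 kills the vacuum, so among the modes in [emode_vac] only the one of degree 0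
    contributes. *)
Lemma graded_value i s a (n : nat) phi : graded n%:Z phi -> homog i s a ->
  phi a = emode i s a n%:Z phi (vac V).
Proof.
move=> gphi ha; have [[D sphi] _] := gphi.
have nD : (n < D + n.+1)%N by lia.
rewrite (emode_vac (N := (D + n.+1)%N) sphi ha); last by lia.
rewrite [LHS](bigD1 (Ordinal nD) isT) -[RHS]addr0; congr (_ + _).
rewrite big1 // => r /eqP rn.
apply: (graded_vac (graded_emode r%:Z ha gphi)) => e; apply: rn.
by apply/val_inj; move: e; case: r => r hr /=; lia.
Qed.

(** All modes in [emode_vac] then have negative degree and vanish at the vacuum. Lower boundedness
    of the grading thus needs no separate construction. *)
Lemma graded_neg d phi : graded d phi -> d < 0 -> phi = 0.
Proof.
move=> gphi d0; have [[D sphi] _] := gphi; have [lphi _] := sphi.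
apply: funext => v; rewrite fct0; move: v; apply: homog_ind => [|i s a ha].
  by split=> [|k u v] /=; [exact: lin0 lphi|rewrite lphi => -> ->; rewrite scaler0 addr0].
rewrite (emode_vac (N := D.+1) sphi ha); last by lia.
apply: big1 => r _.
by apply: (graded_vac (graded_emode r%:Z ha gphi)); lia.
Qed.

(** Beyond n all modes have negative degree, so residues with x + p <= -1 vanish there. By
    [wop_pascal] the residue is then constant along x + p = 0, and can be moved past any known bound
    D. *)
Lemma graded_smooth (n : nat) phi : graded n%:Z phi -> smooth act n phi.
Proof.
move=> gphi; have [[D sphi] _] := gphi; have [lphi hphi] := sphi; split=> //.
move=> i s a x p v ha nx xp.
have neg x' p' : n%:Z < x' -> x' + p' <= -1 -> phi (wop s a x' p' v) = 0.
  move=> hx' hp'; rewrite -(sgK i v).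
  rewrite (emode_res (N := (absz (D%:Z - x')%R).+1) _ sphi ha hp'); last lia.
  rewrite big1 ?oppr0 // => r _.
  by rewrite (graded_neg (graded_emode _ ha gphi)) ?fct0 ?scaler0 //; lia.
case: eqP => xp0; last by apply: neg; lia.
have -> : p = - x by lia.
have step (k : nat) : phi (wop s a x (- x) v) = phi (wop s a (x + k%:Z) (- x - k%:Z) v).
  elim: k => [|k ->]; first by rewrite addr0 subr0.
  rewrite (_ : x + k.+1%:Z = x + k%:Z + 1); last lia.
  rewrite wop_pascal (linD lphi) [X in _ = _ + X]neg; [|lia|lia].
  by rewrite addr0 (_ : - x - k.+1%:Z + 1 = - x - k%:Z) //; lia.
rewrite (step (D + absz x)%N) (hphi i) //; try lia.
by case: eqP => //; lia.
Qed.

Definition top_fun w : V -> W := fun v => act (zcl v) w.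

Lemma top_fun_lin : linear top_fun.
Proof. by move=> k w w'; apply: funext => v; rewrite fct_lin /top_fun (zhu_module_linr hact). Qed.

(** Along x + p = 0 consecutive residues differ by an element of O_t(V), so all of them have the
    class of the one at (1, -1), which is a *_t v. *)
Lemma top_fun_smooth w : smooth act 0 (top_fun w).
Proof.
split=> [k u v|i s a x p v ha x0 xp]; first by rewrite /top_fun zcl_lin (zhu_module_linl hact).
rewrite /top_fun; case: eqP => xp0; last first.
  by rewrite zcl_eq0 ?(lin0 (zhu_module_linl hact w)) //; apply: (Ot_wop _ ha); lia.
rewrite -(zhu_module_mul hact) zmul_zcl /tstar (tres_wop _ _ ha).
have -> : p = - x by lia.
case: x x0 {xp xp0} => [[//|n]|//] _; congr (act _ w).
elim: n => [//|n <-]; apply/zcl_eq.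
have e := wop_pascal s a n.+1%:Z (- n.+2%:Z) v.
rewrite (_ : n.+1%:Z + 1 = n.+2%:Z) in e; last lia.
rewrite (_ : - n.+2%:Z + 1 = - n.+1%:Z) in e; last lia.
rewrite {}e [X in Ot X]addrC addKr.
by apply: (Ot_wop _ ha); lia.
Qed.

(** For homogeneous a, (L_(-1) + L_0) a = a o_t 1 lies in O_t(V). *)
Lemma top_fun_graded w : graded 0 (top_fun w).
Proof.
split=> [|v]; first by exists 0%N; apply: top_fun_smooth.
rewrite oppr0 scale0r /top_fun zcl_eq0 ?(lin0 (zhu_module_linl hact w)) //.
move: v; apply: homog_ind => [|i s a ha].
  have sO := Ot_subspace V; split=> [|k u v hu hv] /=.
    by rewrite (lin0 (@euler_lin K V)); apply: sub0.
  by rewrite euler_lin; apply: (proj2 sO).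
have [_ wa _] := ha; rewrite /euler (_ : vmode _ 1 a = ratr s *: a); last exact: wa.
rewrite (_ : _ + _ = wop s a 1 (-2) (vac V)); first exact: (Ot_wop _ ha).
rewrite /wop subrK /vop nsum2 => [|k]; last by rewrite vac_trunc ?scaler0 //; lia.
rewrite gbin0 gbin1 scale1r; congr (_ + _ *: _); last by rewrite vac_create.
rewrite -[LHS](@vac_create K V); have := vderiv a (-1) (vac V).
by rewrite /virL addNr => ->; rewrite rmorphN1 opprK scale1r.
Qed.

(** Degree 0 gives the smoothness bound 0, so (x, p) = (1, -1) at the vacuum is allowed and yields
    phi(a) = o(a) phi(1). Hence degree 0 contains nothing but W. *)
Lemma graded0_top_fun phi : graded 0 phi -> phi = top_fun (phi (vac V)).
Proof.
move=> gphi; have [[D [lphi _]] _] := gphi; have [_ hphi] := graded_smooth gphi.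
apply: funext => v; move: v; apply: homog_ind => [|i s a ha].
  split=> [|k u v] /=.
    by rewrite (lin0 lphi) /top_fun (lin0 (@zcl_lin K V)) (lin0 (zhu_module_linl hact _)).
  by rewrite lphi /top_fun (@zcl_lin K V) (zhu_module_linl hact) => -> ->.
by have := hphi _ _ _ 1 (-1) (vac V) ha; rewrite /wop vop_vacr => ->.
Qed.

Lemma top_fun_vac w : top_fun w (vac V) = w.
Proof. exact: zhu_module_unit. Qed.

Lemma emode_top_fun i s a w : homog i s a -> emode i s a 0 (top_fun w) = top_fun (act (zcl a) w).
Proof.
move=> ha; have g0 := graded_emode 0 ha (top_fun_graded w); rewrite subr0 in g0.
by rewrite (graded0_top_fun g0) -(graded_value (n := 0) (top_fun_graded w) ha).
Qed.

End CoinducedModes.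

(** * The Jacobi identity for functionals *)

Lemma signz_sqr (K : numFieldType) m : (-1) ^ m * (-1) ^ m = 1 :> K.
Proof. by rewrite -expfzMl mulrNN mulr1 exp1rz. Qed.

Lemma gbin_swap (K : numFieldType) (x q : K) k r :
  \sum_(e < r.+1) gbin x e * gbin q (r - e) * gbin (x - e%:R) k
    = gbin x k * gbin (q + x - k%:R) r.
Proof.
rewrite -[q + x - _]addrA [q + _]addrC -gbin_vandermonde mulr_sumr.
by apply: eq_bigr => e _; rewrite mulrAC gbin_sym -mulrA mulrC mulrC.
Qed.

(** Coefficient of z^(w+e) in the product of (z^w / w!) (d/dz)^w (z - 1)^p and (z - 1)^q. *)
Lemma bcf_vandermonde_shift (K : numFieldType) p q w e :
  \sum_(r < (w + e).+1) bcf K p r * gbin r%:R w * bcf K q (w + e - r)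
    = gbin p%:~R w * bcf K (p + q - w%:Z) e.
Proof.
rewrite /bcf !rmorphB rmorphD /= -pmulrn mulrCA -gbin_vandermonde_shift mulr_sumr.
apply: eq_bigr => r _; have hr : (r <= w + e)%N by rewrite -ltnS.
rewrite (_ : (-1) ^ (p + q - w%:Z - e%:Z) = (-1) ^ (p - r%:Z) * (-1) ^ (q - (w + e - r)%N%:Z)).
  by move: ((-1) ^ _) ((-1) ^ _) => A B; ring.
by rewrite -signzD; congr (_ ^ _); lia.
Qed.

Section CoinducedJacobi.
Variables (K : numFieldType) (V : svoa K) (W : lmodType K).
Variable act : zhu V -> W -> W.
Hypothesis hact : zhu_module act.
Implicit Types (a b v : V) (i j : bool) (s t : rat) (d m n p q x y : int) (D N : nat).
Implicit Types (phi psi : V -> W) (w : W).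

(** Both integrands carry the coefficient of t^r in (1 + t)^q (z + t)^l; on the left z + t is
    expanded as (1 + t) + (z - 1). *)
Lemma wop_sum_swap s a x p (l q : int) M r v :
  (forall k : nat, (M <= k)%N -> vmode a (p + k%:Z) v = 0) ->
  \sum_(k < M) (gbin l%:~R k * gbin (q + l - k%:Z)%:~R r) *: wop s a x (p + k%:Z) v
  = \sum_(e < r.+1) (gbin l%:~R e * gbin q%:~R (r - e)) *: wop s a (x + l - e%:Z) p v.
Proof.
move=> hM.
rewrite [RHS](eq_bigr (fun e : 'I_r.+1 => \sum_(k < M) (gbin (l%:~R : K) e * gbin q%:~R (r - e) * gbin (l%:~R - e%:R) k) *: wop s a x (p + k%:Z) v)).
  rewrite [RHS]exchange_big; apply: eq_bigr => k _ /=.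
  by rewrite -scaler_suml gbin_swap rmorphB rmorphD /= -pmulrn.
move=> e _; rewrite /wop (_ : _ + _%:~R = ratr s - 1 + x%:~R + (l%:~R - e%:R)); last first.
  by rewrite rmorphB rmorphD /= -pmulrn; ring.
by rewrite (vop_shift _ _ hM) scaler_sumr; apply: eq_bigr => k _; rewrite scalerA.
Qed.

Lemma smooth0 D : smooth act D 0.
Proof. by apply: sub0; apply: smooth_subspace. Qed.

Lemma emode0 i s a x : homog i s a -> emode act i s a x 0 = 0.
Proof.
move=> ha; apply: funext => v; rewrite (emodeE _ (smooth0 0) ha) fct0.
exact: lin0 (dmode_linphi 0 i s a x v).
Qed.

Lemma graded_smooth_absz d phi : graded act d phi -> smooth act (absz d) phi.
Proof.
case: (lerP 0 d) => hd gphi; last by rewrite (graded_neg hact gphi hd); apply: smooth0.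
by apply: (graded_smooth hact); rewrite gez0_abs.
Qed.

Lemma graded_res d N i s a x p phi v : graded act d phi -> homog i s a ->
  x + p <= -1 -> d < x + N%:Z ->
  phi (wop s a x p (sg i v)) =
    - \sum_(r < N) bcf K p r *: emode act i s a (x + r%:Z) phi v.
Proof.
move=> gphi ha hp hN; case: (lerP 0 d) => hd.
  apply: (emode_res v (graded_smooth_absz gphi) ha hp); lia.
rewrite (graded_neg hact gphi hd) fct0 big1 ?oppr0 // => r _.
by rewrite emode0 // fct0 scaler0.
Qed.

Lemma emode2_eq0 d i j s t a b x y phi : homog i s a -> homog j t b ->
  graded act d phi -> d < x + y ->
  emode act i s a x (emode act j t b y phi) = 0.
Proof.
move=> ha hb gphi hd.
by apply: (graded_neg hact (graded_emode hact x ha (graded_emode hact y hb gphi))); lia.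
Qed.

Lemma emode_neg d i s a x phi : homog i s a -> graded act d phi -> d < x ->
  emode act i s a x phi = 0.
Proof.
by move=> ha gphi hd; apply: (graded_neg hact (graded_emode hact x ha gphi)); lia.
Qed.

Section Products.
Variables (d : int) (i j : bool) (s t : rat) (a b : V) (phi : V -> W) (l : int) (v : V).
Hypotheses (ha : homog i s a) (hb : homog j t b) (gphi : graded act d phi).

Definition prod_sum N x y : W := \sum_(k < N) ((-1) ^+ k * gbin l%:~R k) *:
  emode act i s a (x + l - k%:Z) (emode act j t b (y + k%:Z) phi) v.

(** The operator of b stands outermost, so it meets phi first and becomes the inner mode. The two
    hypotheses keep infinity out of the residue expansions for b and for a; between them
    [wop_sum_swap] turns the powers of z1 - 1 into powers of z1. *)
Lemma product_expansion x y p q : y + q + l <= -1 -> x + l + p <= -1 ->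
  exists N0, forall M N, (N0 <= M)%N -> (N0 <= N)%N ->
  \sum_(k < M) ((-1) ^ (l - k%:Z) * gbin l%:~R k) *:
     phi (wop t b y (q + l - k%:Z) (wop s a x (p + k%:Z) (sg i (sg j v))))
  = (-1) ^+ (i && j) *: \sum_(r < N) \sum_(e < N)
      (bcf K p r * bcf K q e) *: prod_sum N (x + r%:Z) (y + e%:Z).
Proof.
move=> hyq hxp.
have [M0 hM0] := vop_trunc a (sg i v) p.
exists (M0 + absz d + absz x + absz y + absz l).+1 => M N hM hN.
have [[D [lphi _]] _] := gphi.
pose psi (e : nat) := emode act j t b (y + e%:Z) phi.
have gpsi e : graded act (d - (y + e%:Z)) (psi e) by apply: (graded_emode hact).
have lpsi e : linear (psi e) by have [[D' []]] := gpsi e.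
pose u k := wop s a x (p + k%:Z) (sg i v).
have term (k : 'I_M) : ((-1) ^ (l - k%:Z) * gbin (l%:~R : K) k) *:
     phi (wop t b y (q + l - k%:Z) (wop s a x (p + k%:Z) (sg i (sg j v))))
  = (-1) ^+ (i && j) *: - \sum_(e < N) ((-1) ^ (q - e%:Z) *
      (gbin (l%:~R : K) k * gbin (q + l - k%:Z)%:~R e)) *: psi e (u k).
  have [pa _ _] := ha.
  have -> : wop s a x (p + k%:Z) (sg i (sg j v)) = (-1) ^+ (i && j) *: sg j (u k).
    rewrite /u (sg_wop j s x _ _ pa) scalerA andbC -exprD addnn -signr_odd odd_double.
    by rewrite scale1r sgC.
  rewrite (linZ (wop_linr _ _ _ _)) (linZ lphi).
  rewrite (graded_res (N := N) (u k) gphi hb); [|lia|lia].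
  rewrite scalerA mulrC -scalerA; congr (_ *: _); rewrite scalerN scaler_sumr; congr (- _).
  apply: eq_bigr => e _; rewrite scalerA; congr (_ *: _); rewrite /bcf.
  rewrite (_ : (-1) ^ (q + l - k%:Z - e%:Z) = (-1) ^ (q - e%:Z) * (-1) ^ (l - k%:Z)); last first.
    by rewrite -signzD; congr (_ ^ _); lia.
  have := signz_sqr K (l - k%:Z); move: ((-1) ^ (l - k%:Z)) => B hB.
  rewrite [LHS](_ : _ = (-1) ^ (q - e%:Z) * (gbin l%:~R k * gbin (q + l - k%:Z)%:~R e)
     * (B * B)); first by rewrite hB mulr1.
  move: ((-1) ^ _) (gbin _ _) (gbin _ _) => A C C'; ring.
under eq_bigr do rewrite term.
rewrite -scaler_sumr sumrN exchange_big /=; congr (_ *: _); rewrite -sumrN.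
pose G (r f e : nat) := ((-1) ^+ f * gbin (l%:~R : K) f * bcf K q e * bcf K p r) *:
  emode act i s a (x + l - f%:Z + r%:Z) (psi (f + e)%N) v.
have G0 r f e : (N <= f + e)%N -> G r f e = 0.
  move=> hfe; rewrite /G /psi (emode_neg hb gphi); last lia.
  by rewrite emode0 // fct0 scaler0.
transitivity (\sum_(e < N) \sum_(f < e.+1) \sum_(r < N) G r f (e - f)%N).
  apply: eq_bigr => e _.
  under eq_bigr do rewrite -scalerA -(linZ (lpsi e)).
  have hMk (k : nat) : (M <= k)%N -> vmode a (p + k%:Z) (sg i v) = 0.
    by move=> hk; apply: hM0; lia.
  rewrite -scaler_sumr -(lin_sum (lpsi e)) (wop_sum_swap s x l q e hMk).
  rewrite (lin_sum (lpsi e)) scaler_sumr -sumrN; apply: eq_bigr => f _.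
  have hf : (f <= e)%N by rewrite -ltnS.
  rewrite (linZ (lpsi e)) (graded_res (N := N) v (gpsi e) ha); [|lia|lia].
  rewrite !scalerN opprK !scaler_sumr; apply: eq_bigr => r _.
  rewrite /G subnKC // !scalerA; congr (_ *: _).
  rewrite /bcf (_ : (-1) ^ (q - (e - f)%N%:Z) = (-1) ^ (q - e%:Z) * (-1) ^ f%:Z); last first.
    by rewrite -signzD; congr (_ ^ _); lia.
  rewrite -exprnP; have := signz_sqr K f%:Z; rewrite -exprnP.
  move: ((-1) ^+ f) => B hB.
  rewrite [RHS](_ : _ = (-1) ^ (q - e%:Z) * (gbin l%:~R f * gbin q%:~R (e - f)
     * ((-1) ^ (p - r%:Z) * gbin p%:~R r)) * (B * B)); last first.
    by move: ((-1) ^ _) ((-1) ^ _) (gbin _ _) (gbin _ _) (gbin _ _) => ? ? ? ? ?; ring.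
  by rewrite hB mulr1; ring.
under [LHS]eq_bigr do rewrite exchange_big /=.
rewrite [LHS]exchange_big /=; apply: eq_bigr => r _.
rewrite -(square_sum (M := N) (M' := N)) //; last by move=> f e; apply: G0.
rewrite exchange_big /=; apply: eq_bigr => e _.
rewrite /prod_sum scaler_sumr; apply: eq_bigr => f _; rewrite /G /psi scalerA.
rewrite (_ : x + r%:Z + l - f%:Z = x + l - f%:Z + r%:Z); last lia.
rewrite (_ : y + (f + e)%N%:Z = y + e%:Z + f%:Z); last lia.
congr (_ *: _); move: (bcf K p r) (bcf K q e) (gbin _ _) ((-1) ^+ _) => A B C S; ring.
Qed.

Definition iter_sum N x y : W := \sum_(k < N) gbin (ratr s - 1 + x%:~R) k *:
  emode act (i (+) j) (s + t - (l + k%:Z)%:~R - 1) (vmode a (l + k%:Z) b) (x + y + l) phi v.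

(** Only one variable is left, so the expansions of (z - 1)^p and (z - 1)^q multiply;
    [bcf_vandermonde_shift] absorbs the factor C(r, w) coming from C(s - 1 + x + r, k). *)
Lemma iterate_expansion x y p q M N : x + y + l + p + q <= -1 -> d < x + y + l + N%:Z ->
  \sum_(k < M) \sum_(w < k.+1) (gbin (ratr s - 1 + x%:~R) (k - w) * gbin p%:~R w) *:
      phi (wop (s + t - (l + k%:Z)%:~R - 1) (vmode a (l + k%:Z) b) (x + y + l + w%:Z)
        (p + q - w%:Z) (sg i (sg j v)))
  = - \sum_(r < N) \sum_(e < N) (bcf K p r * bcf K q e) *: iter_sum M (x + r%:Z) (y + e%:Z).
Proof.
move=> hpq hN; rewrite /iter_sum.
under [in RHS]eq_bigr do under eq_bigr do rewrite scaler_sumr.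
under [in RHS]eq_bigr do rewrite exchange_big /=.
rewrite [in RHS]exchange_big -sumrN; apply: eq_bigr => k _ /=.
set c := vmode a _ b; set u := s + t - _ - 1.
have hc : homog (i (+) j) u c by apply: homog_vmode.
pose B (n : nat) := emode act (i (+) j) u c (x + y + l + n%:Z) phi v.
have B0 (n : nat) : (N <= n)%N -> B n = 0.
  by move=> hn; rewrite /B (emode_neg hc gphi) ?fct0 //; lia.
transitivity (- \sum_(w < k.+1) \sum_(r < N) \sum_(e < N)
    (gbin (ratr s - 1 + x%:~R) (k - w) * (bcf K p r * gbin r%:R w * bcf K q e)) *: B (r + e)%N);
  last first.
  congr (- _); rewrite exchange_big /=; apply: eq_bigr => r _.
  rewrite exchange_big /=; apply: eq_bigr => e _.
  rewrite scalerA (_ : x + r%:Z + (y + e%:Z) + l = x + y + l + (r + e)%N%:Z); last lia.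
  rewrite -/(B _) -scaler_suml; congr (_ *: _).
  rewrite (_ : ratr s - 1 + (x + r%:Z)%:~R = r%:R + (ratr s - 1 + x%:~R)); last first.
    by rewrite rmorphD /= -pmulrn; ring.
  rewrite -gbin_vandermonde mulr_sumr; apply: eq_bigr => w _.
  by move: (bcf K p r) (bcf K q e) (gbin _ _) (gbin _ _) => A1 A2 A3 A4; ring.
rewrite -sumrN; apply: eq_bigr => w _.
under eq_bigr do under eq_bigr do rewrite -scalerA.
under eq_bigr do rewrite -scaler_sumr.
rewrite -scaler_sumr -scalerN -scalerA -sg_addb (graded_res (N := N) v gphi hc); [|lia|lia].
congr (_ *: _); rewrite scalerN; congr (- _).
rewrite (cauchy_sum (R := N) (fun r => bcf K p r * gbin r%:R w) (bcf K q)) //.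
pose C (n : nat) := (\sum_(r < n.+1) bcf K p r * gbin r%:R w * bcf K q (n - r)) *: B n.
rewrite -[RHS](@ord_widen _ N (w + N) C) ?leq_addl //; last first.
  by move=> n /B0; rewrite /C => ->; rewrite scaler0.
rewrite big_split_ord /= [X in _ = X + _]big1 ?add0r => [|n _]; last first.
  rewrite /C big1 ?scale0r // => r _; rewrite gbin_nat_small ?mulr0 ?mul0r //.
  by rewrite (leq_trans (ltn_ord r)).
rewrite scaler_sumr; apply: eq_bigr => e _.
rewrite /C bcf_vandermonde_shift scalerA; congr (_ *: _).
by rewrite /B; congr (emode _ _ _ _ _ _ _); lia.
Qed.

End Products.

Section Jacobi.
Variables (d : int) (i j : bool) (s t : rat) (a b : V) (phi : V -> W) (l : int) (v : V).
Hypotheses (ha : homog i s a) (hb : homog j t b) (gphi : graded act d phi).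

(** [prod_sum] has the coefficient (-1)^k C(l, k); the factor (-1)^l adapts it to the sign
    (-1)^(l-k) of the reversed product. *)
Let defect N x y : W := prod_sum i j s t a b phi l v N x y
  - (-1) ^+ (i && j) *: ((-1) ^ l *: prod_sum j i t s b a phi l v N y x)
  - iter_sum i j s t a b phi l v N x y.

(** phi is applied to [wop_borcherds] and each sum is expanded at 0. Since the order of operators is
    reversed, the first sum there gives the second product here, and conversely. *)
Lemma defect_recurrence x y p q :
  x + l + p <= -1 -> y + q + l <= -1 -> x + y + l + p + q <= -1 ->
  exists N0, forall N, (N0 <= N)%N ->
  \sum_(r < N) \sum_(e < N) (bcf K p r * bcf K q e) *: defect N (x + r%:Z) (y + e%:Z) = 0.
Proof.
move=> hxp hyq hpq; pose v' := sg i (sg j v).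
have [[D [lphi _]] _] := gphi.
have [N1 h1] := product_expansion v ha hb gphi hyq hxp.
have hxp' : x + p + l <= -1 by lia.
have hyq' : y + l + q <= -1 by lia.
have [N2 h2] := product_expansion v hb ha gphi hxp' hyq'.
have [N3 h3] := wop_borcherds v' l x y p q ha hb.
exists (N1 + N2 + N3 + absz (d - (x + y + l))%R).+1 => N hN.
pose S1 := \sum_(r < N) \sum_(e < N) (bcf K p r * bcf K q e) *:
  prod_sum i j s t a b phi l v N (x + r%:Z) (y + e%:Z).
pose S2 := \sum_(r < N) \sum_(e < N) (bcf K p r * bcf K q e) *:
  ((-1) ^+ (i && j) *: ((-1) ^ l *: prod_sum j i t s b a phi l v N (y + e%:Z) (x + r%:Z))).
pose S3 := \sum_(r < N) \sum_(e < N) (bcf K p r * bcf K q e) *: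
  iter_sum i j s t a b phi l v N (x + r%:Z) (y + e%:Z).
transitivity (S1 - S2 - S3).
  rewrite -!sumrB; apply: eq_bigr => r _; rewrite -!sumrB; apply: eq_bigr => e _.
  by rewrite -!scalerBr.
have e1 : (-1) ^+ (i && j) *: (\sum_(k < N) ((-1) ^ (l - k%:Z) * gbin l%:~R k) *:
     phi (wop t b y (q + l - k%:Z) (wop s a x (p + k%:Z) v'))) = S1.
  rewrite (h1 N N); [|lia|lia].
  by rewrite scalerA -exprD addnn -signr_odd odd_double scale1r.
have e2 : \sum_(k < N) ((-1) ^+ k * gbin l%:~R k) *:
     phi (wop s a x (p + l - k%:Z) (wop t b y (q + k%:Z) v')) = S2.
  transitivity ((-1) ^ l *: \sum_(k < N) ((-1) ^ (l - k%:Z) * gbin (l%:~R : K) k) *: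
     phi (wop s a x (p + l - k%:Z) (wop t b y (q + k%:Z) v'))).
    rewrite scaler_sumr; apply: eq_bigr => k _; rewrite scalerA mulrA; congr (_ * _ *: _).
    rewrite signzD mulrA signz_sqr mul1r -exprnN -signr_odd -[in RHS]signr_odd.
    by case: (odd k); rewrite ?expr0 ?invr1 // expr1 invrN1.
  rewrite /v' sgC (h2 N N); [|lia|lia].
  rewrite /S2 exchange_big /= scalerA scaler_sumr; apply: eq_bigr => r _.
  rewrite scaler_sumr; apply: eq_bigr => e _.
  rewrite !scalerA andbC; congr (_ *: _).
  by move: (bcf _ _ _) (bcf _ _ _) ((-1) ^ l) ((-1) ^+ _) => A1 A2 A3 A4; ring.
have e3 := iterate_expansion v ha hb gphi N (N := N) hpq ltac:(lia).
have := congr1 phi (h3 N ltac:(lia)).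
rewrite (linB lphi) (linZ lphi) [in LHS](lin_sum lphi) [X in _ - _ *: X](lin_sum lphi).
rewrite [RHS](lin_sum lphi).
under [X in X - _]eq_bigr do rewrite (linZ lphi).
under [X in _ - _ *: X]eq_bigr do rewrite (linZ lphi).
under [RHS]eq_bigr do rewrite (lin_sum lphi).
under [RHS]eq_bigr do under eq_bigr do rewrite (linZ lphi).
rewrite e1 e2 e3 -/S3 => e; by rewrite -[S1 - S2]opprB e opprK subrr.
Qed.

(** The two-variable form of [bcf_unique]: both sides vanish by degree when x + y + l > d, and all
    other terms of the recurrence at (x, y) have a larger value of x + y. *)
Lemma emode_jacobi x y :
  (\sum_(k \in [set: nat]) ((-1) ^+ k * gbin l%:~R k) *:
     emode act i s a (x + l - k%:Z) (emode act j t b (y + k%:Z) phi) v)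
  - (-1) ^+ (i && j) *:
    (\sum_(k \in [set: nat]) ((-1) ^ (l - k%:Z) * gbin l%:~R k) *:
       emode act j t b (y + l - k%:Z) (emode act i s a (x + k%:Z) phi) v)
  = \sum_(k \in [set: nat]) gbin (ratr s - 1 + x%:~R) k *:
      emode act (i (+) j) (s + t - (l + k%:Z)%:~R - 1) (vmode a (l + k%:Z) b) (x + y + l) phi v.
Proof.
pose J x y := (\sum_(k \in [set: nat]) ((-1) ^+ k * gbin l%:~R k) *:
     emode act i s a (x + l - k%:Z) (emode act j t b (y + k%:Z) phi) v)
  - (-1) ^+ (i && j) *:
    (\sum_(k \in [set: nat]) ((-1) ^ (l - k%:Z) * gbin l%:~R k) *:
       emode act j t b (y + l - k%:Z) (emode act i s a (x + k%:Z) phi) v)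
  - \sum_(k \in [set: nat]) gbin (ratr s - 1 + x%:~R) k *:
      emode act (i (+) j) (s + t - (l + k%:Z)%:~R - 1) (vmode a (l + k%:Z) b) (x + y + l) phi v.
have [[D sphi] _] := gphi.
suff J0 : forall (m : nat) x y, d < x + y + l + m%:Z -> J x y = 0.
  apply/eqP; rewrite -subr_eq0; apply/eqP; apply: (J0 (absz (d - (x + y + l))%R).+1); lia.
have [N1 hN1] := vop_trunc a b l.
have defectE N x' y' : (N1 <= N)%N -> d < x' + N%:Z -> d < y' + N%:Z ->
    defect N x' y' = J x' y'.
  move=> hN hx hy; rewrite /defect /J /prod_sum /iter_sum.
  congr (_ - _ *: _ - _); first by rewrite (nsumE (N := N)) // => k hk;
    rewrite (emode_neg hb gphi) ?emode0 ?fct0 ?scaler0 //; lia.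
    rewrite scaler_sumr (nsumE (N := N)) => [|k hk]; last first.
      by rewrite (emode_neg ha gphi) ?emode0 ?fct0 ?scaler0 //; lia.
    apply: eq_bigr => k _; rewrite scalerA mulrA; congr (_ * _ *: _).
    rewrite signzD -exprnN; congr (_ * _); rewrite -signr_odd -[in RHS]signr_odd.
    by case: (odd k); rewrite ?expr0 ?invr1 // expr1 invrN1.
  rewrite (nsumE (N := N)) // => k hk; rewrite hN1 ?(leq_trans hN) //.
  by rewrite (lin0 (emode_lina _ _ _ v sphi)) scaler0.
elim=> [|m IH] x' y' hd.
  have c0 z z' : d < z + z' -> emode act i s a z (emode act j t b z' phi) = 0.
    by apply: emode2_eq0.
  have c0' z z' : d < z + z' -> emode act j t b z (emode act i s a z' phi) = 0.
    by apply: emode2_eq0.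
  rewrite /J !fsbig1 ?scaler0 ?subr0 // => k _.
  - rewrite (emode_neg (homog_vmode (l + k%:Z) ha hb) gphi) ?fct0 ?scaler0 //; lia.
  - by rewrite c0' ?fct0 ?scaler0 //; lia.
  - by rewrite c0 ?fct0 ?scaler0 //; lia.
(* With p = q = -c all three inequalities of [defect_recurrence] hold. *)
pose c := (absz x' + absz y' + absz l + 1)%N.
have [N0 hN0] := @defect_recurrence x' y' (- c%:Z) (- c%:Z) ltac:(lia) ltac:(lia) ltac:(lia).
pose N := (N0 + N1 + absz (d - x')%R + absz (d - y')%R)%N.
have := hN0 N.+1 ltac:(lia); rewrite big_ord_recl [X in _ + X]big1 => [|r _]; last first.
  apply: big1 => e _; rewrite defectE ?IH ?scaler0 //= /bump; lia.
rewrite big_ord_recl [X in _ + X + _]big1 => [|e _]; last first.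
  rewrite defectE ?IH ?scaler0 //= /bump; lia.
rewrite !addr0 defectE; [|lia|lia|lia].
move/eqP; rewrite scaler_eq0 mulf_eq0 !bcf0 !(negPf (signz_neq0 _ _)) /= => /eqP.
done.
Qed.

End Jacobi.
End CoinducedJacobi.

(** * The irreducible module *)

Lemma rat_nat_bound (N n : rat) : exists m : nat, forall k : nat, (m <= k)%N -> N <= n + k%:R.
Proof.
exists (Num.bound (N - n)) => k hk; rewrite -lerBlDl.
apply: (@le_trans _ _ (Num.bound (N - n))%:R); last by rewrite ler_nat.
apply: (le_trans (ler_norm _)); apply/ltW; have := archi_boundP (normr_ge0 (N - n)).
by rewrite /Num.bound normr_id.
Qed.

Lemma nsum_linear (K : fieldType) (X Y : lmodType K) (F : nat -> X -> Y) :
  (forall k, linear (F k)) ->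
  (forall u, exists N : nat, forall k : nat, (N <= k)%N -> F k u = 0) ->
  linear (fun u => \sum_(k \in [set: nat]) F k u).
Proof.
move=> lF F0 c u u'; have [N hN] := F0 u; have [N' hN'] := F0 u'.
have h k : (N + N' <= k)%N -> F k u = 0 by move=> hk; apply: hN; lia.
have h' k : (N + N' <= k)%N -> F k u' = 0 by move=> hk; apply: hN'; lia.
have h2 k : (N + N' <= k)%N -> F k (c *: u + u') = 0.
  by move=> hk; rewrite lF h // h' // scaler0 addr0.
rewrite (nsumE h) (nsumE h') (nsumE h2) scaler_sumr -big_split.
by apply: eq_bigr => k _; rewrite lF.
Qed.

(** * The module generated by the functionals of W *)

Section GeneratedModule.
Variables (K : numFieldType) (V : svoa K) (W : lmodType K).
Variable act : zhu V -> W -> W.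
Hypothesis hact : zhu_module act.
Implicit Types (a b v : V) (i j : bool) (s t : rat) (d m p q x y : int) (n : rat).
Implicit Types (phi psi : V -> W) (w : W).

(** For positive indices z the residues with p = -1 - z vanish because C(z - 1, z) = 0, and
    uniqueness applies. Index 0 is read off with p = -1, negative indices with p = 0, where the
    expansion has a single term. *)
Lemma emode_vacl D x phi : smooth act D phi ->
  emode act false 0 (vac V) x phi = if x == 0 then phi else 0.
Proof.
move=> sphi; have h0 := homog_vac V; have [lphi _] := sphi; apply: funext => v.
pose c y := emode act false 0 (vac V) y phi v.
have cpos y : 1 <= y -> c y = 0.
  apply: (bcf_unique (L := 1) (B := D%:Z)) => z hz.
    by rewrite /c (emode_large sphi h0 hz) fct0.
  exists (-1 - z), (absz (D%:Z - z)%R).+1; split; first lia.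
  set N := (absz _).+1.
  have := emode_res (N := N) (x := z) (p := -1 - z) v sphi h0 ltac:(lia) ltac:(lia).
  rewrite /= (_ : wop _ _ _ _ _ = 0) ?(lin0 lphi) => [/esym/eqP|].
    by rewrite oppr_eq0 => /eqP.
  rewrite /wop /vop fsbig1 // => k _; rewrite vac_mode; case: eqP => hk; last by rewrite scaler0.
  have -> : k = absz z by lia.
  rewrite rmorph0 sub0r (_ : -1 + z%:~R = (absz z).-1%:R :> K); last first.
    by rewrite [RHS]pmulrn (_ : (absz z).-1%:Z = -1 + z) ?rmorphD //=; lia.
  by rewrite gbin_nat_small ?scale0r //; lia.
case: eqP => [->|/eqP x0].
  have := emode_res (N := D.+1) (x := 0) (p := -1) v sphi h0 ltac:(lia) ltac:(lia).
  rewrite /= /wop vop_vacl big_ord_recl big1 => [|r _]; last first.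
    by rewrite -/(c _) cpos ?scaler0 // /bump /=; lia.
  by rewrite bcfN1 scaleN1r addr0 opprK addr0 => ->.
case: (lerP 1 x) => hx; first exact: cpos.
have := emode_res (N := (absz (D%:Z - x)%R).+1) (x := x) (p := 0) v sphi h0 ltac:(lia) ltac:(lia).
rewrite big_ord_recl big1 => [|r _]; last by rewrite bcf0l scale0r.
rewrite bcf0l scale1r !addr0 /= (_ : wop _ _ _ _ _ = 0) ?(lin0 lphi) => [/esym/eqP|].
  by rewrite oppr_eq0 => /eqP.
by apply: vop_eq0 => k; rewrite vac_mode; case: eqP => //; lia.
Qed.

(* On functionals, the mode a_n is extended linearly in a from the
   weight-homogeneous vectors; a_n = 0 unless n - wt a is an integer. *)
Definition fmode a n phi : V -> W :=
  lin_ext (@wtsp K V) (fun s a => if denq (n - s + 1) == 1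
    then emode act (wpar s) s a (numq (n - s + 1)) phi else 0) a.

Lemma fmode_wt D s a n phi : smooth act D phi -> wtsp s a ->
  fmode a n phi = if denq (n - s + 1) == 1
    then emode act (wpar s) s a (numq (n - s + 1)) phi else 0.
Proof.
move=> sphi wa; rewrite /fmode (lin_extE _ _ wa) //; first exact: wt_direct.
move=> t k u v; case: ifP => _; last by rewrite scaler0 addr0.
by apply: funext => v'; rewrite (emode_lina _ _ _ _ sphi).
Qed.

Lemma fmode_lina D n phi : smooth act D phi -> linear (fun a => fmode a n phi).
Proof.
move=> sphi; apply: lin_ext_linear => [|s]; first exact: wt_direct.
move=> k u v; case: ifP => _; last by rewrite scaler0 addr0.
by apply: funext => v'; rewrite (emode_lina _ _ _ _ sphi).
Qed.

Lemma fmodeE D i s a x phi : smooth act D phi -> homog i s a ->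
  fmode a (s - 1 + x%:~R) phi = emode act i s a x phi.
Proof.
move=> sphi [pa wa sa]; rewrite (fmode_wt _ sphi wa).
rewrite (_ : _ - s + 1 = x%:~R); last by ring.
by rewrite denq_int eqxx numq_int (wparE sa).
Qed.

Lemma fmode_cases D i s a n phi : smooth act D phi -> homog i s a ->
  (exists x, n = s - 1 + x%:~R /\ fmode a n phi = emode act i s a x phi) \/
  ((forall x, n <> s - 1 + x%:~R) /\ fmode a n phi = 0).
Proof.
move=> sphi ha; case: (eqVneq (denq (n - s + 1)) 1) => [e|ne].
  have en : n = s - 1 + (numq (n - s + 1))%:~R.
    have := divq_num_den (n - s + 1); rewrite e divr1 => ->; ring.
  by left; exists (numq (n - s + 1)); split=> //; rewrite {1}en (fmodeE _ sphi ha).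
right; split=> [x e|]; last first.
  by have [_ wa _] := ha; rewrite (fmode_wt _ sphi wa) (negPf ne).
by case/eqP: ne; rewrite e (_ : _ - s + 1 = x%:~R) ?denq_int //; ring.
Qed.

(** The impredicative form is its own induction principle. Stability is asked at smooth functionals
    only, since elsewhere [emode] rests on a default. *)
Definition gen : set (V -> W) := [set phi | forall U : set (V -> W), subspace U ->
  (forall w, U (top_fun act w)) ->
  (forall i s a x psi, homog i s a -> (exists D, smooth act D psi) -> U psi ->
     U (emode act i s a x psi)) -> U phi].

Lemma gen_subspace : subspace gen.
Proof.
split=> [|k u v hu hv] U sU h1 h2; first exact: sub0.
by apply: (proj2 sU); [apply: hu|apply: hv].
Qed.

Lemma gen_top_fun w : gen (top_fun act w).
Proof. by move=> U _ h _; apply: h. Qed.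

Lemma smooth_ex_subspace : subspace [set phi | exists D, smooth act D phi].
Proof.
split=> [|k phi psi [D sphi] [D' spsi]]; first by exists 0%N; apply: smooth0.
have [s1 s2] := smooth2 sphi spsi; exists (D + D')%N.
exact: (proj2 (smooth_subspace hact _)).
Qed.

Lemma gen_smooth phi : gen phi -> exists D, smooth act D phi.
Proof.
move=> gphi; apply: (gphi [set phi | exists D, smooth act D phi]).
- exact: smooth_ex_subspace.
- by move=> w; exists 0%N; apply: top_fun_smooth.
- move=> i s a x psi ha [D spsi] _; exists (D + absz (D%:Z - x)%R)%N.
  by apply: (smooth_emode hact spsi ha); lia.
Qed.

Lemma gen_emode i s a x phi : homog i s a -> gen phi -> gen (emode act i s a x phi).
Proof.
move=> ha gphi U sU h1 h2; apply: (h2) => //; first exact: gen_smooth.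
exact: (gphi U sU h1 h2).
Qed.

Lemma gen_fmode a n phi : gen phi -> gen (fmode a n phi).
Proof.
move=> gphi; have [D sphi] := gen_smooth gphi.
move: a; apply: homog_ind => [|i s a ha].
  split=> [|k u v hu hv] /=; first by rewrite (lin0 (fmode_lina n sphi)); apply: sub0 gen_subspace.
  by rewrite (fmode_lina n sphi); apply: (proj2 gen_subspace).
case: (fmode_cases n sphi ha) => [[x [_ ->]]|[_ ->]]; last exact: sub0 gen_subspace.
exact: gen_emode.
Qed.

Lemma fmode_linphi a n k phi psi : gen phi -> gen psi ->
  fmode a n (k *: phi + psi) = k *: fmode a n phi + fmode a n psi.
Proof.
move=> gphi gpsi; have [D sphi] := gen_smooth gphi; have [D' spsi] := gen_smooth gpsi.
have [D2 s2] := gen_smooth (proj2 gen_subspace k _ _ gphi gpsi).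
move: a; apply: homog_ind => [|i s a ha].
  split=> [|c u v hu hv] /=.
    by rewrite (lin0 (fmode_lina n sphi)) (lin0 (fmode_lina n spsi)) (lin0 (fmode_lina n s2)) scaler0 addr0.
  rewrite (fmode_lina n sphi) (fmode_lina n spsi) (fmode_lina n s2) hu hv.
  by rewrite !scalerDr !scalerA [c * k]mulrC addrACA.
have [_ wa _] := ha.
rewrite (fmode_wt n sphi wa) (fmode_wt n spsi wa) (fmode_wt n s2 wa).
case: ifP => _; last by rewrite scaler0 addr0.
have := emode_linphi hact (numq (n - s + 1)) k sphi spsi ha.
by have [_ _ sa] := ha; rewrite (wparE sa).
Qed.

Definition gen_graded d : set (V -> W) := [set phi | gen phi /\ graded act d phi].

Lemma gen_graded_subspace d : subspace (gen_graded d).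
Proof.
split=> [|k u v [hu hu'] [hv hv']].
  by split; [apply: sub0 gen_subspace|apply: sub0; apply: graded_subspace].
split; first exact: (proj2 gen_subspace).
exact: (proj2 (graded_subspace hact d)).
Qed.

Lemma gen_decomposes phi : gen phi -> exists f, decomposes (fun k : nat => gen_graded k%:Z) phi f.
Proof.
have sG (k : nat) : subspace (gen_graded k%:Z) by apply: gen_graded_subspace.
have sU := decomposes_subspace sG.
move=> gphi; apply: (gphi _ sU) => [w|i s a x psi ha [D spsi] [f df]].
  exists (fun j : nat => if j == 0%N then top_fun act w else 0).
  by apply: decomposes_single => //; split; [apply: gen_top_fun|apply: top_fun_graded].
(* Smoothness is part of [P] because the linearity of [emode] in psi is available for smooth
   functionals only. *)
pose P := [set psi | (exists D, smooth act D psi) /\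
  exists f, decomposes (fun k : nat => gen_graded k%:Z) (emode act i s a x psi) f].
suff [] : P psi by [].
apply: (decomposes_in (P := P) _ df) => [|k].
  split=> [|c u v [[D1 s1] h1] [[D2 s2] h2]].
    by split; [exists 0%N; apply: smooth0|rewrite (emode0 hact x ha); apply: sub0 sU].
  split; first by apply: (proj2 smooth_ex_subspace); [exists D1|exists D2].
  by rewrite (emode_linphi hact x c s1 s2 ha); apply: (proj2 sU).
case: df => _ /(_ k)[gf grf] _; split; first by case: grf.
have gr := graded_emode hact x ha grf.
case: (lerP 0 (k%:Z - x)) => hk; last first.
  by rewrite (graded_neg hact gr hk); apply: sub0 sU.
exists (fun j : nat => if j == absz (k%:Z - x) then emode act i s a x (f k) else 0).
apply: decomposes_single => //; split; first exact: gen_emode.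
by rewrite (gez0_abs hk).
Qed.

Definition gen_type : lmodType K := subspace_type gen_subspace.

Definition gmode a n (u : gen_type) : gen_type :=
  to_sub gen_subspace (gen_fmode a n (sub_valE u)).

Definition ggr (k : nat) : set gen_type := [set u | graded act k%:Z (sub_val u)].

Lemma ggr_subspace k : subspace (ggr k).
Proof.
have sG := graded_subspace hact k%:Z.
split=> [|c u v hu hv]; first exact: (sub0 sG).
by rewrite /ggr /mkset (@sub_val_lin _ _ _ gen_subspace); apply: (proj2 sG).
Qed.

Lemma ggr_sum : direct_sum setT ggr.
Proof.
have svl := @sub_val_lin _ _ _ gen_subspace.
have svi := @sub_val_inj _ _ _ gen_subspace.
apply: (@eigen_direct_sum _ _ gen_type (V -> W) (@sub_val _ _ _ gen_subspace)
  (fun u v => sub_val u (euler v)) (fun k : nat => - k%:R)) => //.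
- by move=> k l /oppr_inj /eqP; rewrite eqr_nat => /eqP.
- exact: ggr_subspace.
- by move=> k u [_ hu]; apply: funext => v; rewrite hu.
move=> u; have [f [/finite_support_seq[r ur fr] Gf e]] := gen_decomposes (sub_valE u).
pose g k : gen_type := to_sub gen_subspace (proj1 (Gf k)).
have gr k : k \notin r -> g k = 0 by move=> kr; apply: svi; apply: fr.
exists g; split; first by apply/finite_support_seq; exists r.
  by move=> k; case: (Gf k).
apply: svi; rewrite e (fsum_seq ur fr) (fsum_seq ur gr) (lin_sum svl).
exact: eq_bigr.
Qed.

Lemma gen_val_lin k (u v : gen_type) :
  sub_val (k *: u + v) = k *: sub_val u + sub_val v :> (V -> W).
Proof. exact: sub_val_lin. Qed.

Lemma gen_val_inj (u v : gen_type) : sub_val u = sub_val v :> (V -> W) -> u = v.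
Proof. exact: sub_val_inj. Qed.

Lemma gmode_val a n u : sub_val (gmode a n u) = fmode a n (sub_val u).
Proof. by []. Qed.

Lemma gmode_linl n u : linear (fun a => gmode a n u).
Proof.
move=> k a b; apply: gen_val_inj; rewrite gen_val_lin !gmode_val.
by have [D sphi] := gen_smooth (sub_valE u); rewrite (fmode_lina n sphi).
Qed.

Lemma gmode_linr a n : linear (gmode a n).
Proof.
move=> k u v; apply: gen_val_inj; rewrite gen_val_lin !gmode_val gen_val_lin.
by apply: fmode_linphi; apply: sub_valE.
Qed.

Lemma gmode_coset i a n u : par i a -> ~ hcoset i n -> gmode a n u = 0.
Proof.
move=> pa hn; move: a pa; apply: par_homog_ind => [|s a ha].
  split=> [|k a b ea eb] /=; first exact: lin0 (gmode_linl n u).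
  by rewrite (gmode_linl n u) ea eb scaler0 addr0.
apply: gen_val_inj => /=.
have [D sphi] := gen_smooth (sub_valE u).
case: (fmode_cases n sphi ha) => [[x [e _]]|[_ ->//]]; case: hn.
have [_ _ [k es]] := ha; exists (k - 1 + x).
by rewrite e es !rmorphD /= rmorphN /=; ring.
Qed.

Lemma gmode_trunc a u : exists N : rat, forall n, N <= n -> gmode a n u = 0.
Proof.
move: a; apply: homog_ind => [|i s a ha].
  split=> [|k a b [N hN] [N' hN']] /=; first by exists 0 => n _; exact: lin0 (gmode_linl n u).
  exists (Num.max N N') => n; rewrite ge_max => /andP[h h'].
  by rewrite (gmode_linl n u) hN // hN' // scaler0 addr0.
have [D sphi] := gen_smooth (sub_valE u).
exists (s + D%:R) => n hn; apply: gen_val_inj => /=.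
case: (fmode_cases n sphi ha) => [[x [e ->]]|[_ ->//]].
apply: (emode_large sphi ha).
rewrite -(ltr_int rat) -pmulrn; move: hn; rewrite e; lra.
Qed.

Lemma gmode_trunc_nat a u n : exists N : nat, forall k : nat, (N <= k)%N -> gmode a (n + k%:R) u = 0.
Proof.
have [N hN] := gmode_trunc a u; have [m hm] := rat_nat_bound N n.
by exists m => k /hm; apply: hN.
Qed.

Lemma gmode_vac n u : gmode (vac V) n u = if n == -1 then u else 0.
Proof.
have [D sphi] := gen_smooth (sub_valE u).
apply: gen_val_inj => /=.
case: (fmode_cases n sphi (homog_vac V)) => [[x [e ->]]|[ne ->]].
  rewrite (emode_vacl _ sphi) e (_ : (0 - 1 + x%:~R == -1 :> rat) = (x == 0)); last first.
    by rewrite -subr_eq0 (_ : _ - -1 = x%:~R) ?intr_eq0 //; ring.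
  by case: ifP.
by case: eqP => // e; case: (ne 0); rewrite e addr0 sub0r.
Qed.

Lemma gmode_gr s a n (k : nat) u : wtsp s a -> ggr k u ->
  gmode a n u = 0 \/ exists2 k' : nat, k%:R + s - n - 1 = k'%:R & ggr k' (gmode a n u).
Proof.
(* The zero vector has every weight, also those that belong to no parity, so it is set aside. *)
move=> wa gu; case: (pselect (a = 0)) => [->|a0].
  by left; exact: lin0 (gmode_linl n u).
have ha := wt_homog_wpar wa a0; have [D sphi] := gen_smooth (sub_valE u).
case: (fmode_cases n sphi ha) => [[x [e ex]]|[_ e]]; last first.
  by left; apply: gen_val_inj.
have gr := graded_emode hact x ha gu.
case: (lerP 0 (k%:Z - x)) => hk; last first.
  left; apply: gen_val_inj => /=.
  by rewrite ex (graded_neg hact gr hk).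
right; exists (absz (k%:Z - x)).
  by rewrite [RHS]pmulrn (gez0_abs hk) e rmorphB /= -pmulrn; ring.
by rewrite /ggr /= ex (gez0_abs hk).
Qed.

End GeneratedModule.

Lemma lin_nsum (K : fieldType) (X Y : lmodType K) (f : X -> Y) (F : nat -> X) :
  linear f -> (exists N : nat, forall k : nat, (N <= k)%N -> F k = 0) ->
  f (\sum_(k \in [set: nat]) F k) = \sum_(k \in [set: nat]) f (F k).
Proof.
move=> lf [N F0]; rewrite (nsumE F0) (lin_sum lf) (nsumE (N := N)) // => k /F0 ->.
exact: lin0.
Qed.

Lemma hcoset_shift i (n s : rat) : hcoset i n -> hcoset i s -> exists x : int, n = s - 1 + x%:~R.
Proof.
move=> [k ->] [l ->]; exists (k - l + 1).
by rewrite !rmorphD rmorphN /=; ring.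
Qed.

Section IrreducibleModule.
Variables (K : numFieldType) (V : svoa K) (W : lmodType K).
Variable act : zhu V -> W -> W.
Hypothesis hact : zhu_module act.
Implicit Types (a b v : V) (i j : bool) (s t : rat) (d p q x y l : int) (m n : rat).
Implicit Types (phi psi : V -> W) (w : W).

Let M0 := gen_type act.
Implicit Types (u : M0).

Let gm a n u : M0 := gmode hact a n u.

Definition gprod (c : nat -> K) l m n a b u : M0 :=
  \sum_(k \in [set: nat]) c k *: gm a (m + l%:~R - k%:R) (gm b (n + k%:R) u).

Definition giter (c : nat -> K) l n a b u : M0 :=
  \sum_(k \in [set: nat]) c k *: gm (vmode a (l + k%:Z) b) (n - k%:R) u.

Lemma gprod_trunc (c : nat -> K) l m n a b u : exists N : nat, forall k : nat, (N <= k)%N ->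
  c k *: gm a (m + l%:~R - k%:R) (gm b (n + k%:R) u) = 0.
Proof.
have [N hN] := gmode_trunc_nat hact b u n; exists N => k /hN e.
by rewrite /gm e (lin0 (gmode_linr hact _ _)) scaler0.
Qed.

Lemma giter_trunc (c : nat -> K) l n a b u : exists N : nat, forall k : nat, (N <= k)%N ->
  c k *: gm (vmode a (l + k%:Z) b) (n - k%:R) u = 0.
Proof.
have [N hN] := vop_trunc a b l; exists N => k /hN ->.
by rewrite /gm (lin0 (gmode_linl hact _ u)) scaler0.
Qed.

Lemma scaled_comm (X : lmodType K) (c k : K) (z z' : X) :
  c *: (k *: z + z') = k *: (c *: z) + c *: z'.
Proof. by rewrite scalerDr !scalerA mulrC. Qed.

Lemma gprod_lina c l m n b u : linear (fun a => gprod c l m n a b u).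
Proof.
apply: nsum_linear => [k e a a'|a]; last exact: gprod_trunc.
by rewrite /gm (gmode_linl hact) scaled_comm.
Qed.

Lemma gprod_linb c l m n a u : linear (fun b => gprod c l m n a b u).
Proof.
apply: nsum_linear => [k e b b'|b]; last exact: gprod_trunc.
by rewrite /gm (gmode_linl hact) (gmode_linr hact) scaled_comm.
Qed.

Lemma gprod_linu c l m n a b : linear (gprod c l m n a b).
Proof.
apply: nsum_linear => [k e u u'|u]; last exact: gprod_trunc.
by rewrite /gm !(gmode_linr hact) scaled_comm.
Qed.

Lemma giter_lina c l n b u : linear (fun a => giter c l n a b u).
Proof.
apply: nsum_linear => [k e a a'|a]; last exact: giter_trunc.
by rewrite vmode_addl /gm (gmode_linl hact) scaled_comm.
Qed.

Lemma giter_linb c l n a u : linear (fun b => giter c l n a b u).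
Proof.
apply: nsum_linear => [k e b b'|b]; last exact: giter_trunc.
by rewrite vmode_linr /gm (gmode_linl hact) scaled_comm.
Qed.

Lemma giter_linu c l n a b : linear (giter c l n a b).
Proof.
apply: nsum_linear => [k e u u'|u]; last exact: giter_trunc.
by rewrite /gm (gmode_linr hact) scaled_comm.
Qed.

Lemma gm_val i s a x u : homog i s a ->
  sub_val (gm a (s - 1 + x%:~R) u) = emode act i s a x (sub_val u).
Proof.
move=> ha; have [D sphi] := gen_smooth hact (sub_valE u).
by rewrite gmode_val (fmodeE _ sphi ha).
Qed.

Lemma gmode_jacobi i j a b u l m n : par i a -> par j b -> hcoset i m -> hcoset j n ->
  gprod (fun k => (-1) ^+ k * gbin l%:~R k) l m n a b u
  - (-1) ^+ (i && j) *: gprod (fun k => (-1) ^ (l - k%:Z) * gbin l%:~R k) l n m b a u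
  = giter (fun k => (-1) ^+ k * gbin (ratr (k%:R - m - 1)) k) l (m + n) a b u.
Proof.
move=> pa pb hm hn; apply/eqP; rewrite -subr_eq0; apply/eqP.
have lin3 (X : lmodType K) (f g h : X -> M0) (c : K) : linear f -> linear g -> linear h ->
    subspace [set z | f z - c *: g z - h z = 0].
  move=> lf lg lh; split=> [|e z z' hz hz'] /=.
    by rewrite (lin0 lf) (lin0 lg) (lin0 lh) scaler0 !subr0.
  rewrite lf lg lh scaled_comm !opprD [X in X + _]addrACA [LHS]addrACA -!scalerBr.
  by rewrite hz hz' scaler0 addr0.
set c1 := fun k : nat => (-1) ^+ k * gbin l%:~R k.
set c2 := fun k : nat => (-1) ^ (l - k%:Z) * gbin l%:~R k.
set c3 := fun k : nat => (-1) ^+ k * gbin (ratr _) k.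
move: u; apply: (direct_sum_ind (ggr_sum hact)) => [|d u gu].
  exact: (lin3 _ _ _ _ _ (gprod_linu c1 l m n a b) (gprod_linu c2 l n m b a)
    (giter_linu c3 l (m + n) a b)).
move: a pa; apply: par_homog_ind => [|s a ha].
  exact: (lin3 _ _ _ _ _ (gprod_lina c1 l m n b u) (gprod_linb c2 l n m b u)
    (giter_lina c3 l (m + n) b u)).
move: b pb; apply: par_homog_ind => [|t b hb].
  exact: (lin3 _ _ _ _ _ (gprod_linb c1 l m n a u) (gprod_lina c2 l n m a u)
    (giter_linb c3 l (m + n) a u)).
have [_ _ sa] := ha; have [_ _ tb] := hb.
have [x em] := hcoset_shift hm sa; have [y en] := hcoset_shift hn tb.
apply/eqP; rewrite subr_eq0; apply/eqP; apply: gen_val_inj; apply: funext => v.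
(* Evaluation at v is linear, so it passes through the sums and leaves the identity for
   functionals. *)
have lev : linear (fun z : M0 => sub_val z v) by move=> c z z'; rewrite gen_val_lin.
rewrite -[LHS]/((fun z : M0 => sub_val z v) _) -[RHS]/((fun z : M0 => sub_val z v) _).
rewrite (linB lev) (linZ lev) !(lin_nsum lev); [|exact: giter_trunc|exact: gprod_trunc..].
have := emode_jacobi hact l v ha hb gu x y.
congr (_ - _ *: _ = _); apply: eq_fsbigr => k _; rewrite (linZ lev).
- congr (_ *: _); rewrite em en.
  rewrite (_ : s - 1 + x%:~R + l%:~R - k%:R = s - 1 + (x + l - k%:Z)%:~R); last first.
    by rewrite rmorphB rmorphD /= -pmulrn; ring.
  rewrite (_ : t - 1 + y%:~R + k%:R = t - 1 + (y + k%:Z)%:~R); last first.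
    by rewrite rmorphD /= -pmulrn; ring.
  by rewrite (gm_val _ _ ha) (gm_val _ _ hb).
- congr (_ *: _); rewrite em en.
  rewrite (_ : t - 1 + y%:~R + l%:~R - k%:R = t - 1 + (y + l - k%:Z)%:~R); last first.
    by rewrite rmorphB rmorphD /= -pmulrn; ring.
  rewrite (_ : s - 1 + x%:~R + k%:R = s - 1 + (x + k%:Z)%:~R); last first.
    by rewrite rmorphD /= -pmulrn; ring.
  by rewrite (gm_val _ _ hb) (gm_val _ _ ha).
rewrite em en (_ : s - 1 + x%:~R + (t - 1 + y%:~R) - k%:R
    = (s + t - (l + k%:Z)%:~R - 1) - 1 + (x + y + l)%:~R); last first.
  by rewrite !rmorphD /= -pmulrn; ring.
rewrite (gm_val _ _ (homog_vmode _ ha hb)); congr (_ *: _).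
rewrite /c3 -[LHS]gbin_neg; congr (_ * gbin _ _).
by rewrite em !rmorphB rmorphD rmorphB /= rmorph1 ratr_nat ratr_int; ring.
Qed.

Definition gen_module : twisted_module V :=
  @TwistedModule K V M0 gm (@ggr K V W act) (ggr_sum hact)
    (gmode_linl hact) (gmode_linr hact)
    (fun i a n u => @gmode_coset K V W act hact i a n u)
    (gmode_trunc hact) (gmode_vac hact)
    (fun s a n k u => @gmode_gr K V W act hact s a n k u)
    (fun i j a b u l m n => @gmode_jacobi i j a b u l m n).

End IrreducibleModule.

(** * Irreducibility and the top level *)

Section Irreducibility.
Variables (K : numFieldType) (V : svoa K) (W : lmodType K).
Variable act : zhu V -> W -> W.
Hypotheses (hact : zhu_module act) (irr : zhu_irreducible act).

Let M := gen_module hact.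
Implicit Types (u : M) (w : W) (a v : V).

Let val u : V -> W := sub_val (u : gen_type act).

Lemma tmode_val i s a x u : homog i s a ->
  val (tmode a (s - 1 + x%:~R) u) = emode act i s a x (val u).
Proof. exact: gm_val. Qed.

Definition low w : M := to_sub (gen_subspace act) (@gen_top_fun K V W act w).

Lemma low_tgr w : tgr 0 (low w).
Proof. exact: top_fun_graded. Qed.

Lemma low_lin : linear low.
Proof. by move=> k w w'; apply: gen_val_inj; rewrite gen_val_lin /= top_fun_lin. Qed.

Lemma tgr0_low u : tgr 0 u -> u = low (val u (vac V)).
Proof. by move=> gu; apply: gen_val_inj; apply: graded0_top_fun gu. Qed.

Lemma low_val w : val (low w) (vac V) = w.
Proof. exact: top_fun_vac. Qed.

Lemma tmode_low i s a w : homog i s a -> tmode a (s - 1) (low w) = low (act (zcl a) w).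
Proof.
move=> ha; apply: gen_val_inj; have := @tmode_val i s a 0 (low w) ha.
by rewrite mulr0z addr0 (emode_top_fun hact w ha).
Qed.

(** Let f N be the nonzero component of u of highest degree and v homogeneous with f N v nonzero.
    The mode of v that lowers degrees by N sends the components below N to negative degree, hence to
    0, and f N to a lowest vector whose value at the vacuum is f N v by [graded_value]. *)
Lemma submodule_meets_low (U : set M) : subspace U ->
  (forall a n u, U u -> U (tmode a n u)) -> (exists2 u, U u & u <> 0) ->
  exists2 w, U (low w) & w <> 0.
Proof.
move=> sU hU [u Uu u0].
have [_ _ _ ex] := ggr_sum hact.
have [f [[/finite_support_seq[r ur fr] gf eu] _]] := ex u Logic.I.
rewrite (fsum_seq ur fr) in eu.
have exP : exists k, f k != 0.
  apply: contrapT => nex; apply: u0; rewrite eu big1 // => k _.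
  by apply/eqP; apply: contrapT => /negP fk; apply: nex; exists k.
have boundP k : f k != 0 -> (k <= \max_(e <- r) e)%N.
  move=> fk; apply: leq_bigmax_seq => //.
  by apply: contraNT fk => /fr ->.
case: (ex_maxnP exP boundP) => N fN maxN.
have [i [s [v [hv fv]]]] : exists i s v, homog i s v /\ val (f N) v <> 0.
  apply: contrapT => nex; case/eqP: fN; apply: gen_val_inj; apply: funext => v.
  have [D [lphi _]] := gen_smooth hact (sub_valE (f N)).
  move: v; apply: homog_ind => [|i s a ha].
    by split=> [|k v v'] /=; [exact: lin0 lphi|rewrite lphi => -> ->; rewrite scaler0 addr0].
  by apply: contrapT => fa; apply: nex; exists i, s, a.
pose z : M := tmode v (s - 1 + (N%:Z)%:~R) u.
have zE : val z = emode act i s v N%:Z (val (f N)).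
  rewrite -(tmode_val _ _ hv) /z; congr val.
  have Nr : N \in r by apply: contraNT fN => /fr ->.
  rewrite eu (lin_sum (tmode_linr v _)) (bigD1_seq N Nr ur) /= [X in _ + X]big1 ?addr0 // => k kN.
  case: (ltnP k N) => hk.
    apply: gen_val_inj; rewrite -/(val _) (tmode_val _ _ hv).
    by apply: (graded_neg hact (graded_emode hact N%:Z hv (gf k))); lia.
  have -> : f k = 0; last exact: (lin0 (@tmode_linr K V M v (s - 1 + (N%:Z)%:~R))).
  by apply/eqP; apply: contraNT kN => /maxN; rewrite eqn_leq hk andbT.
have gz : tgr 0 z.
  have := graded_emode hact N%:Z hv (gf N); rewrite subrr -/(val (f N)) -zE.
  by [].
exists (val z (vac V)); first by rewrite -tgr0_low //; apply: hU.
by rewrite zE -(graded_value hact (gf N) hv).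
Qed.

Lemma gen_module_irreducible : twisted_irreducible M.
Proof.
have [[w0 w0N0] irrU] := irr; split.
  exists (low w0); apply: contra_neq w0N0 => e.
  by rewrite -[w0]low_val e.
move=> U sU hU; case: (pselect (exists2 u, U u & u <> 0)) => [ex|nex]; last first.
  left; apply/seteqP; split=> u /=; last by move->; apply: sub0.
  by move=> Uu; apply: contrapT => u0; apply: nex; exists u.
right; have [w1 Uw1 w1N0] := submodule_meets_low sU hU ex.
have lowU : forall w, U (low w).
  (* The lowest vectors in U form an A_t(V)-submodule of W, nonzero because of [w1]. *)
  pose P := [set w | U (low w)].
  have [|x w|P0|PT w] := irrU P.
  - split=> [|k w w' hw hw']; rewrite /P /mkset.
      by rewrite (lin0 low_lin); apply: sub0.
    by rewrite low_lin; apply: (proj2 sU).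
  - have [a ->] := zcl_surj x => Pw; rewrite /P /=; move: a.
    apply: homog_ind => [|i s a ha].
      split=> [|k a b hb hc] /=.
        by rewrite (lin0 (@zcl_lin K V)) (lin0 (zhu_module_linl hact w)) (lin0 low_lin); apply: sub0.
      by rewrite (@zcl_lin K V) (zhu_module_linl hact) low_lin; apply: (proj2 sU).
    by rewrite -(tmode_low w ha); apply: hU.
  - by have : P w1 by []; rewrite P0 => /w1N0.
  - by have : [set: W] w by []; rewrite -PT.
apply/seteqP; split=> // u _.
(* Induction on [gen]: the image of U contains the generators and is stable under modes. *)
pose U' := [set phi : V -> W | exists2 z : M, U z & val z = phi].
have [z Uz ez] : U' (val u).
  apply: (sub_valE (u : gen_type act)).
  - split=> [|k _ _ [z Uz <-] [z' Uz' <-]]; first by exists 0; [apply: sub0|].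
    by exists (k *: z + z'); [apply: (proj2 sU)|rewrite /val gen_val_lin].
  - by move=> w; exists (low w).
  - move=> i s a x _ ha _ [z Uz <-]; exists (tmode a (s - 1 + x%:~R) z); first exact: hU.
    exact: tmode_val.
by rewrite -(gen_val_inj ez).
Qed.

(** The map w |-> [low w] has evaluation at the vacuum as its inverse. *)
Lemma gen_module_top (actM : zhu V -> top_level M -> top_level M) :
  top_action actM -> zhu_isomorphic act actM.
Proof.
move=> [hM topM].
have svi := @sub_val_inj _ _ _ (subspace_tgr M 0).
have svl := @sub_val_lin _ _ _ (subspace_tgr M 0).
pose f w : top_level M := to_sub (subspace_tgr M 0) (low_tgr w).
exists f; split.
- by move=> k w w'; apply: svi; rewrite svl; apply: low_lin.
- exists (fun z : top_level M => val (sub_val z) (vac V)) => [w|z]; first exact: low_val.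
  by apply: svi => /=; rewrite -tgr0_low //; apply: sub_valE.
have lf : linear f by move=> k w w'; apply: svi; rewrite svl; apply: low_lin.
move=> x w; have [a ->] := zcl_surj x; move: a; apply: homog_ind => [|i s a ha].
  split=> [|k a b ea eb] /=.
    by rewrite (lin0 (@zcl_lin K V)) (lin0 (zhu_module_linl hact w))
      (lin0 (zhu_module_linl hM (f w))) (lin0 lf).
  by rewrite (@zcl_lin K V) (zhu_module_linl hact) lf ea eb (zhu_module_linl hM).
have [_ wa _] := ha; apply: svi; have := topM s a (f w) wa; rewrite /top_val => ->.
exact (esym (tmode_low w ha)).
Qed.

End Irreducibility.

Theorem theorem2p7 (R : realType) (V : svoa R[i]) :
  zhu_graded_algebra V
  /\ (forall M : twisted_module V,
        exists act : zhu V -> top_level M -> top_level M, top_action act)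
  /\ (forall (W : lmodType R[i]) (act : zhu V -> W -> W),
        zhu_module act -> zhu_irreducible act ->
        exists (M : twisted_module V)
               (actM : zhu V -> top_level M -> top_level M),
          [/\ twisted_irreducible M, top_action actM & zhu_isomorphic act actM]).
Proof.
split; first exact: zhu_algebra.
split=> [M|W act hact irr]; first by exists (@top_act _ _ M); apply: top_actP.
exists (gen_module hact), (@top_act _ _ (gen_module hact)); split.
- exact: gen_module_irreducible.
- exact: top_actP.
- exact/gen_module_top/top_actP.
Qed.
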